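(* For any $\theta\in(0,\frac{\pi}{2})$, the essential spectrum of the operator $\Delta^{\mathsf{Dir}}_{\Omega_\theta}$ coincides with $[1,+\infty)$.
   Context: For $\theta\in(0,\frac{\pi}{2})$ the broken guide is the unbounded V-shaped open set $$\Omega_\theta=\Big\{(x_1,x_2)\in\mathbb{R}^2:\ x_1\tan\theta<|x_2|<\Big(x_1+\frac{\pi}{\sin\theta}\Big)\tan\theta\Big\}.$$ $\Delta^{\mathsf{Dir}}_{\Omega_\theta}$ denotes the positive Dirichlet Laplacian on $\Omega_\theta$: the self-adjoint operator $\psi\mapsto-\Delta\psi$ on $L^2(\Omega_\theta)$ with domain $\{\psi\in H^1_0(\Omega_\theta):\ \Delta\psi\in L^2(\Omega_\theta)\}$. The essential spectrum of a self-adjoint operator $A$ on a Hilbert space $H$ is the set of $\lambda$ such that $A-\lambda\,\mathrm{Id}$ is not Fredholm from $\mathrm{Dom}(A)$ into $H$. *)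

(* Defs.v *)
From HB Require Import structures.
From mathcomp Require Import all_boot all_order all_algebra.
From mathcomp Require Import all_classical all_reals all_analysis.
From mathcomp Require Import complex.

Set Implicit Arguments.
Unset Strict Implicit.
Unset Printing Implicit Defensive.

Import Order.TTheory GRing.Theory Num.Theory.
Import numFieldNormedType.Exports.

Local Open Scope classical_set_scope.
Local Open Scope complex_scope.
Local Open Scope ring_scope.

(* The Hilbert space L^2(D, mu; C).  Its elements are represented by complex
   functions on the ambient space, of which only the a.e. class on D matters. *)
Section L2.
Context {d : measure_display} {T : measurableType d} {R : realType}.
Variables (mu : {measure set T -> \bar R}) (D : set T).
Implicit Types (u f g : T -> R[i]).

Definition Cintegral f : R[i] :=
  Rintegral mu D (fun x => complex.Re (f x)) +i* Rintegral mu D (fun x => complex.Im (f x)).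

Definition L2normsq f : \bar R :=
  (\int[mu]_(x in D) (ComplexField.Normc.normc (f x) ^+ 2)%:E)%E.

Definition L2 f : Prop :=
  [/\ measurable_fun D (fun x => complex.Re (f x)),
      measurable_fun D (fun x => complex.Im (f x)) &
      (L2normsq f < +oo)%E].

(* Unbounded operators are given by their graphs: A u f reads
   "u is in Dom(A) and A u = f". *)
Implicit Types (A : (T -> R[i]) -> (T -> R[i]) -> Prop) (lambda : R[i]).

Definition op_range A g : Prop := exists u, A u g.

Definition finite_dim_kernel A : Prop :=
  exists (n : nat) (e : 'I_n -> T -> R[i]),
    (forall i, A (e i) (fun=> 0)) /\
    forall u, A u (fun=> 0) -> exists c : 'I_n -> R[i],
      ae_eq mu D u (fun x => \sum_(i < n) c i * e i x).

Definition closed_range A : Prop :=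
  forall f, L2 f ->
    (forall eps : R, 0 < eps ->
       exists2 g, op_range A g & (L2normsq (fun x => (f x - g x)%R) < eps%:E)%E) ->
    op_range A f.

Definition finite_codim_range A : Prop :=
  exists (n : nat) (e : 'I_n -> T -> R[i]),
    (forall i, L2 (e i)) /\
    forall f, L2 f -> exists c : 'I_n -> R[i],
      op_range A (fun x => f x - \sum_(i < n) c i * e i x).

(* Boundedness from Dom(A), with its graph norm, into L^2 is automatic. *)
Definition Fredholm A : Prop :=
  [/\ finite_dim_kernel A, closed_range A & finite_codim_range A].

Definition op_shift A lambda : (T -> R[i]) -> (T -> R[i]) -> Prop :=
  fun u g => A u (fun x => g x + lambda * u x).

Definition essential_spectrum A : set R[i] :=
  [set lambda | ~ Fredholm (op_shift A lambda)].

End L2.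

Section DirichletLaplacian.
Context {R : realType}.
Implicit Types (D : set (R * R)) (u f g phi : R * R -> R[i]) (v : R * R).

Definition area : {measure set (measurableTypeR R * measurableTypeR R)%type -> \bar R} :=
  (@lebesgue_measure R \x @lebesgue_measure R)%E.

Definition e1 : R * R := (1, 0).
Definition e2 : R * R := (0, 1).

Definition Cderive v phi : R * R -> R[i] :=
  fun x => 'D_v (fun y => complex.Re (phi y)) x +i* 'D_v (fun y => complex.Im (phi y)) x.

Definition laplacian phi : R * R -> R[i] :=
  fun x => Cderive e1 (Cderive e1 phi) x + Cderive e2 (Cderive e2 phi) x.

(* All iterated directional derivatives exist and are differentiable. *)
Definition smooth phi : Prop :=
  forall (vs : seq (R * R)) (x : R * R),
    differentiable (fun y => complex.Re (foldr Cderive phi vs y)) x /\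
    differentiable (fun y => complex.Im (foldr Cderive phi vs y)) x.

Definition test_function D phi : Prop :=
  let supp := closure [set x | phi x != 0] in
  [/\ smooth phi, compact supp & supp `<=` D].

Definition weak_derivative D v u g : Prop :=
  forall phi, test_function D phi ->
    Cintegral area D (fun x => u x * Cderive v phi x)
    = - Cintegral area D (fun x => g x * phi x).

Definition weak_laplacian D u f : Prop :=
  forall phi, test_function D phi ->
    Cintegral area D (fun x => u x * laplacian phi x)
    = Cintegral area D (fun x => f x * phi x).

(* H^1_0(D): the closure of the test functions in H^1(D). *)
Definition H10 D u : Prop :=
  L2 area D u /\
  exists g1 g2,
    [/\ L2 area D g1 /\ weak_derivative D e1 u g1,
        L2 area D g2 /\ weak_derivative D e2 u g2 &
        forall eps : R, 0 < eps -> exists2 phi, test_function D phi &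
          (L2normsq area D (fun x => (u x - phi x)%R)
           + L2normsq area D (fun x => (g1 x - Cderive e1 phi x)%R)
           + L2normsq area D (fun x => (g2 x - Cderive e2 phi x)%R)
           < eps%:E)%E].

Definition dirichlet_laplacian D u f : Prop :=
  [/\ H10 D u, L2 area D f & weak_laplacian D u (fun x => - f x)].

Definition broken_guide (theta : R) : set (R * R) :=
  [set x | x.1 * tan theta < `|x.2| < (x.1 + pi / sin theta) * tan theta].

End DirichletLaplacian.

(* Main.v *)
Require Import Defs.
From HB Require Import structures.
From mathcomp Require Import all_boot all_order all_algebra.
From mathcomp Require Import all_classical all_reals all_analysis.
From mathcomp Require Import measurable_realfun.
From mathcomp Require Import complex ring lra.
Import Order.TTheory GRing.Theory Num.Theory.
Import numFieldNormedType.Exports.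
Set Implicit Arguments.
Unset Strict Implicit.
Unset Printing Implicit Defensive.
Local Open Scope classical_set_scope.
Local Open Scope complex_scope.
Local Open Scope ring_scope.

(** Far from its corner the guide consists of two straight strips of width pi,
    whose transversal Dirichlet ground state is the sine, with energy 1.  The
    spectrum near a number below 1 can therefore only be produced by the bounded
    corner region, where it is discrete; and every number [1 + k ^ 2] is reached by
    waves of wave number [k] travelling along an arm.

    The whole argument is carried out with real functions in the form domain
    [form_dom], the closure of the test functions, taken together with their two
    partial derivatives, in the norm of H^1; [dirichlet_forward] and
    [dirichlet_backward] translate between the complex operator and pairs of
    real weak equations.

    Fredholmness off the half-line ([guide_Fredholm]).  In an arm, integrating the
    divergence of [f ^ 2] times the transversal logarithmic derivative of the sine
    and completing the square shows that the square norm of [f] is at most its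
    energy, up to the square integral over a bounded box ([arm_energy]).  Paving
    the box by small squares and using Poincare's inequality on each of them bounds
    that integral by a small multiple of the energy plus finitely many squared
    means.  Hence for every [mu < 1] the form [energy - mu * mass] becomes
    nonnegative after the addition of finitely many squares of bounded functionals
    ([guide_coercive]).  By the Lax-Milgram lemma, applied to the real and
    imaginary parts together, a finite-rank perturbation of [A - lambda] is then
    boundedly invertible ([complex_resolvent_exists], [complex_resolvent_bound]);
    for nonreal [lambda] a multiple of the skew combination of the two real
    equations moves the real parameter below 1.  An operator with such a
    perturbation is Fredholm, since its kernel and range are described by the
    coefficients of the perturbation
    ([finite_rank_perturbation_Fredholm]).

    Failure on the half-line ([guide_not_Fredholm]).  Cutting off the wave
    [cos (k * along - phi) * sin (across)] along the arm at a large scale [L], and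
    near the walls at the scale [1 / L ^ 2], produces orthonormal test functions
    [v n] with disjoint supports on which the residual is as small as desired
    ([weyl_quasimode], [weyl_sequence]).  For [f = (A - lambda) u] the
    coefficients [(f, v n)] are thus bounded by a multiple of [1 / 4 ^ n].  On the
    other hand, the series of [v n / 2 ^ n] over the residue classes modulo [N + 1]
    are [N + 1] functions that are linearly independent modulo the range, so the
    range has infinite codimension ([quasimode_infinite_codim]).  This avoids the
    open mapping theorem, which a singular sequence alone would require. *)

(** * Square-integrable functions *)

(** Locked, so that unification compares inner products by their arguments and
    never descends into integrals over product measure spaces. *)
HB.lock Definition inner_product {d : measure_display} {T : measurableType d} {R : realType}
  (mu : {measure set T -> \bar R}) (D : set T) (f g : T -> R) : R :=
  \int[mu]_(x in D) (f x * g x).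
Canonical inner_product_unlockable := Unlockable inner_product.unlock.

Lemma ipE {d : measure_display} {T : measurableType d} {R : realType}
  (mu : {measure set T -> \bar R}) (D : set T) (f g : T -> R) :
  inner_product mu D f g = \int[mu]_(x in D) (f x * g x).
Proof. by rewrite unlock. Qed.

Section SquareIntegrable.
Context {d : measure_display} {T : measurableType d} {R : realType}.
Variables (mu : {measure set T -> \bar R}) (D : set T).
Hypothesis mD : measurable D.
Implicit Types f g h : T -> R.
Local Notation ip := (inner_product mu D).

Definition sqi f :=
  measurable_fun D f /\ mu.-integrable D (EFin \o (fun x => f x ^+ 2)).

Lemma integrable_le f g : measurable_fun D f ->
  mu.-integrable D (EFin \o g) -> (forall x, D x -> `|f x| <= g x) ->
  mu.-integrable D (EFin \o f).
Proof.
move=> mf ig fg; apply: (le_integrable mD _ _ ig); first exact/measurable_EFinP.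
by move=> x Dx /=; rewrite lee_fin (le_trans (fg x Dx))// ler_norm.
Qed.

Lemma integrable_lin a b f g : mu.-integrable D (EFin \o f) ->
  mu.-integrable D (EFin \o g) ->
  mu.-integrable D (EFin \o (fun x => a * f x + b * g x)).
Proof.
move=> i1 i2.
have := integrableD mD (integrableZl mD a i1) (integrableZl mD b i2).
by apply: eq_integrable => // x _; rewrite /= EFinD !EFinM.
Qed.

Lemma Rintegral_lin a b f g : mu.-integrable D (EFin \o f) ->
  mu.-integrable D (EFin \o g) ->
  \int[mu]_(x in D) (a * f x + b * g x)
  = a * \int[mu]_(x in D) f x + b * \int[mu]_(x in D) g x.
Proof.
move=> i1 i2; rewrite RintegralD ?RintegralZl//.
- by have := integrableZl mD a i1; apply: eq_integrable => // x _; rewrite /= EFinM.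
- by have := integrableZl mD b i2; apply: eq_integrable => // x _; rewrite /= EFinM.
Qed.

Lemma sqiM f g : sqi f -> sqi g ->
  mu.-integrable D (EFin \o (fun x => f x * g x)).
Proof.
move=> [mf i1] [mg i2].
apply: (@integrable_le _ (fun x => 1 * f x ^+ 2 + 1 * g x ^+ 2)).
- exact: measurable_funM.
- exact: integrable_lin.
- move=> x _; rewrite !mul1r normrM -[f x ^+ 2]real_normK ?num_real//.
  rewrite -[g x ^+ 2]real_normK ?num_real//.
  have := sqr_ge0 (`|f x| - `|g x|); have := normr_ge0 (f x); have := normr_ge0 (g x); nra.
Qed.

Lemma sqi_lin a b f g : sqi f -> sqi g -> sqi (fun x => a * f x + b * g x).
Proof.
move=> sf sg; have [mf i1] := sf; have [mg i2] := sg; split.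
  by apply: measurable_funD; apply: measurable_funM => //; exact: measurable_cst.
have := integrable_lin 1 1 (integrable_lin (a ^+ 2) (b ^+ 2) i1 i2)
  (integrable_lin (2 * a * b) 0 (sqiM sf sg) (sqiM sf sg)).
by apply: eq_integrable => // x _ /=; congr (_%:E); ring.
Qed.

Lemma sqi0 : sqi (fun=> 0).
Proof.
split; first exact: measurable_cst.
have := @integrable0 _ T R mu D; apply: eq_integrable => // x _ /=.
by rewrite expr2 mul0r.
Qed.

Lemma sqiZ a f : sqi f -> sqi (fun x => a * f x).
Proof.
move=> sf; have := sqi_lin a 0 sf sf; congr sqi.
by apply/funext => x; rewrite mul0r addr0.
Qed.

Lemma sqiD f g : sqi f -> sqi g -> sqi (fun x => f x + g x).
Proof.
by move=> sf sg; have := sqi_lin 1 1 sf sg; congr sqi; apply/funext => x; rewrite !mul1r.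
Qed.

Lemma sqiB f g : sqi f -> sqi g -> sqi (fun x => f x - g x).
Proof.
move=> sf sg; have := sqi_lin 1 (-1) sf sg; congr sqi.
by apply/funext => x; rewrite mul1r mulN1r.
Qed.

Lemma ipC f g : ip f g = ip g f.
Proof. by rewrite !ipE; congr Rintegral; apply/funext => x; rewrite mulrC. Qed.

Lemma ip_linl a b f g h : sqi f -> sqi g -> sqi h ->
  ip (fun x => a * f x + b * g x) h = a * ip f h + b * ip g h.
Proof.
move=> sf sg sh; rewrite !ipE -Rintegral_lin; [|exact: sqiM..].
by congr Rintegral; apply/funext => x; ring.
Qed.

Lemma ip_linr a b f g h : sqi f -> sqi g -> sqi h ->
  ip h (fun x => a * f x + b * g x) = a * ip h f + b * ip h g.
Proof. by move=> sf sg sh; rewrite ipC ip_linl// ![ip h _]ipC. Qed.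

Lemma ip_ge0 f : 0 <= ip f f.
Proof. by rewrite ipE; apply: Rintegral_ge0 => x _; rewrite -expr2 sqr_ge0. Qed.

Lemma ipBl f g h : sqi f -> sqi g -> sqi h ->
  ip (fun x => f x - g x) h = ip f h - ip g h.
Proof.
move=> sf sg sh; rewrite -[RHS]/(ip f h + - ip g h) -[ip f h]mul1r -mulN1r -ip_linl//.
by congr inner_product; apply/funext => x; rewrite mul1r mulN1r.
Qed.

Lemma ipBr f g h : sqi f -> sqi g -> sqi h ->
  ip h (fun x => f x - g x) = ip h f - ip h g.
Proof. by move=> sf sg sh; rewrite ipC ipBl// ![ip h _]ipC. Qed.

Lemma ipDl f g h : sqi f -> sqi g -> sqi h ->
  ip (fun x => f x + g x) h = ip f h + ip g h.
Proof.
move=> sf sg sh; rewrite -[ip f h]mul1r -[ip g h]mul1r -ip_linl//.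
by congr inner_product; apply/funext => x; rewrite !mul1r.
Qed.

Lemma ipZl a f h : sqi f -> sqi h -> ip (fun x => a * f x) h = a * ip f h.
Proof.
move=> sf sh; rewrite -[RHS]addr0 -[X in _ + X](mul0r (ip f h)) -ip_linl//.
by congr inner_product; apply/funext => x; rewrite mul0r addr0.
Qed.

(** The square norm of [a f + b g] is nonnegative for all coefficients; the
    optimal ones are [ip f g] and [- ip f f], or the symmetric choice when
    [f] is null. *)
Lemma ip_CS f g : sqi f -> sqi g -> ip f g ^+ 2 <= ip f f * ip g g.
Proof.
move=> sf sg.
have H a b : 0 <= a ^+ 2 * ip f f + 2 * a * b * ip f g + b ^+ 2 * ip g g.
  have := ip_ge0 (fun x => a * f x + b * g x).
  rewrite ip_linl//; last exact: sqi_lin.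
  rewrite !ip_linr// (ipC g f); congr (_ <= _); ring.
have A0 := ip_ge0 f; have B0 := ip_ge0 g.
have [A00|An0] := eqVneq (ip f f) 0; last first.
  have A1 : 0 < ip f f by rewrite lt_neqAle eq_sym An0.
  have := H (ip f g) (- ip f f).
  rewrite (_ : _ + _ = ip f f * (ip f f * ip g g - ip f g ^+ 2)); last by ring.
  by rewrite pmulr_rge0// subr_ge0.
have [B00|Bn0] := eqVneq (ip g g) 0.
  have := H 1 (- ip f g); rewrite A00 B00 !mulr0 !add0r; nra.
have B1 : 0 < ip g g by rewrite lt_neqAle eq_sym Bn0.
have := H (- ip g g) (ip f g).
rewrite (_ : _ + _ = ip g g * (ip f f * ip g g - ip f g ^+ 2)); last by ring.
by rewrite pmulr_rge0// subr_ge0.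
Qed.

End SquareIntegrable.

Section Completeness.
Context {d : measure_display} {T : measurableType d} {R : realType}.
Variables (mu : {measure set T -> \bar R}) (D : set T).
Hypothesis mD : measurable D.
Implicit Types f g h : T -> R.

Lemma ip_fin f g : sqi mu D f -> sqi mu D g ->
  (\int[mu]_(x in D) (f x * g x)%:E)%E = (inner_product mu D f g)%:E.
Proof.
move=> sf sg; rewrite ipE /Rintegral fineK//.
exact: (integrable_fin_num mD (sqiM mD sf sg)).
Qed.

Lemma sqi_of_lty f : measurable_fun D f ->
  (\int[mu]_(x in D) (f x ^+ 2)%:E < +oo)%E -> sqi mu D f.
Proof.
move=> mf fi; split=> //; apply/integrableP; split.
  apply/measurable_EFinP; under eq_fun do rewrite expr2; exact: measurable_funM.
apply: le_lt_trans fi; apply: ge0_le_integral => //=.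
- apply/measurable_EFinP; apply: measurableT_comp => //.
  under eq_fun do rewrite expr2; exact: measurable_funM.
- apply/measurable_EFinP; under eq_fun do rewrite expr2; exact: measurable_funM.
- by move=> x _; rewrite ger0_norm// sqr_ge0.
Qed.

(** A Cauchy sequence has a subsequence with quickly decreasing gaps, whose
    weighted squared gaps have a finite sum almost everywhere; this forces
    pointwise convergence, and Fatou's lemma turns the pointwise limit into a
    limit in the mean. *)
Lemma L2_complete (f : nat -> T -> R) : (forall n, sqi mu D (f n)) ->
  (forall e : R, 0 < e -> exists N, forall m n, (N <= m)%N -> (N <= n)%N ->
     inner_product mu D (fun x => f m x - f n x) (fun x => f m x - f n x) < e) ->
  exists2 g, sqi mu D g &
    forall e : R, 0 < e -> exists N, forall n, (N <= n)%N ->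
      inner_product mu D (fun x => f n x - g x) (fun x => f n x - g x) < e.
Proof.
move=> sf cf.
pose ee k : R := ((4 ^ k * 2 ^ k.+1)%:R)^-1.
have ee0 k : 0 < ee k by rewrite invr_gt0 ltr0n muln_gt0 !expn_gt0.
have [Nf NfP] := choice (fun k => cf (ee k) (ee0 k)).
(* An increasing choice of indices beyond all [Nf k]. *)
pose p k := (k + \sum_(i < k.+1) Nf i)%N.
have pN k : (Nf k <= p k)%N by rewrite /p big_ord_recr /= addnA leq_addl.
have pS k : (p k <= p k.+1)%N by rewrite /p [in leqRHS]big_ord_recr /= leq_add// leq_addr.
have pk k : (k <= p k)%N by exact: leq_addr.
pose dd k x := f (p k.+1) x - f (p k) x.
have sd k : sqi mu D (dd k) by exact: sqiB.
have ddle k : inner_product mu D (dd k) (dd k) < ee k.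
  by apply: NfP; [exact: leq_trans (pN k) (pS k)|exact: pN].
pose G k x := ((4 ^ k)%:R * (dd k x * dd k x))%:E.
have G0 k x : (0 <= G k x)%E by rewrite lee_fin mulr_ge0// -expr2 sqr_ge0.
have mG k : measurable_fun D (G k).
  apply/measurable_EFinP; apply: measurable_funM; first exact: measurable_cst.
  by apply: measurable_funM; case: (sd k).
pose u x := (\sum_(0 <= k <oo) G k x)%E.
have u0 x : (0 <= u x)%E by apply: nneseries_ge0.
have mu_ : measurable_fun D u.
  by have := @ge0_emeasurable_sum _ T R D G xpredT (fun k x _ _ => G0 k x) (fun k _ => mG k).
have iG k : (\int[mu]_(x in D) G k x = ((4 ^ k)%:R * inner_product mu D (dd k) (dd k))%:E)%E.
  rewrite EFinM -ip_fin// -ge0_integralZl//.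
  - apply/measurable_EFinP; apply: measurable_funM; by case: (sd k).
  - by move=> x _; rewrite lee_fin -expr2 sqr_ge0.
have iu : (\int[mu]_(x in D) u x < +oo)%E.
  rewrite integral_nneseries//.
  apply: (@le_lt_trans _ _ (1%:E)%E); last by rewrite ltry.
  have := @epsilon_trick0 R 1 xpredT ler01; apply: le_trans.
  apply: lee_nneseries => [i _ _|k _]; first exact: integral_ge0.
  rewrite iG lee_fin; apply: (@le_trans _ _ ((4 ^ k)%:R * ee k)).
    by rewrite ler_wpM2l// ltW.
  by rewrite /ee natrM invfM mulrA divff ?pnatr_eq0 ?expn_eq0.
have intu : mu.-integrable D u.
  apply/integrableP; split=> //; apply: le_lt_trans iu.
  apply: ge0_le_integral => //.
  - exact: measurableT_comp.
  - by move=> x _; rewrite gee0_abs.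
have aeu := integrable_ae mD intu.
pose E := D `&` [set x | (u x < +oo)%E].
have mE : measurable E by exact: emeasurable_fun_infty_o.
(* Off [E], a null set, the sequence is replaced by 0, so that it converges
   at every point. *)
pose h k x := f (p k) x * \1_E x.
have mh k : measurable_fun D (h k).
  by apply: measurable_funM; [case: (sf (p k))|exact: measurable_indic].
have hcvg x : D x -> cvgn (h ^~ x).
  move=> Dx; rewrite /h; have [xE|xE] := boolP (x \in E); last first.
    rewrite (_ : (fun k => _) = fun=> 0); first exact: is_cvg_cst.
    by apply/funext => k; rewrite indicE (negbTE xE) mulr0.
  rewrite (_ : (fun k => _) = fun k => f (p 0) x + series (dd ^~ x) k); last first.
    apply/funext => k; rewrite indicE xE mulr1.
    exact: (eq_sum_telescope (fun k => f (p k) x)).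
  apply: is_cvgD; first exact: is_cvg_cst.
  have uf : u x \is a fin_num.
    rewrite ge0_fin_numE//.
    by move: xE; rewrite inE => -[].
  have dle k : `|dd k x| <= geometric (1 + fine (u x)) (2^-1) k.
    have : (G k x <= u x)%E.
      rewrite /u; apply: (le_trans _ (@nneseries_lim_ge _ (G ^~ x) xpredT 0 k.+1 _)) => //.
      by rewrite big_nat_recr//= leeDr// sume_ge0.
    rewrite -(fineK uf) lee_fin => Gu.
    have u0x : 0 <= fine (u x) by apply: fine_ge0.
    rewrite /geometric /= exprVn ler_pdivlMr ?exprn_gt0//.
    rewrite -(@ler_pXn2r _ 2) ?nnegrE ?mulr_ge0 ?exprn_ge0 ?addr_ge0//.
    rewrite exprMn real_normK ?num_real// -exprM mulnC exprM.
    apply: (@le_trans _ _ (fine (u x))); last by nra.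
    apply: le_trans Gu; by rewrite [leLHS]mulrC -!natrX -expr2.
  apply: normed_cvg; apply: (series_le_cvg _ _ dle) => //.
    by move=> k; rewrite /geometric /= mulr_ge0// ?exprn_ge0// addr_ge0// fine_ge0.
  apply: is_cvg_geometric_series; rewrite ger0_norm//; lra.
pose g x := limn (h ^~ x).
have mg : measurable_fun D g by apply: (measurable_fun_cvg mh) => x /hcvg.
have key n (e : R) N : (forall m, (N <= m)%N ->
    inner_product mu D (fun x => f m x - f n x) (fun x => f m x - f n x) <= e) ->
  (\int[mu]_(x in D) ((f n x - g x) ^+ 2)%:E <= e%:E)%E.
  move=> Hk.
  pose F k x := ((h k x - f n x) ^+ 2)%:E.
  have mF k : measurable_fun D (F k).
    apply/measurable_EFinP; under eq_fun do rewrite expr2.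
    by apply: measurable_funM; apply: measurable_funB => //; case: (sf n).
  have -> : (\int[mu]_(x in D) ((f n x - g x) ^+ 2)%:E
     = \int[mu]_(x in D) limn_einf (F ^~ x))%E.
    apply: eq_integral => x /set_mem Dx.
    suff /cvg_limn_einf_sup[-> _] : F ^~ x @ \oo --> ((f n x - g x) ^+ 2)%:E by [].
    apply: cvg_EFin; first by near=> k.
    rewrite -[f n x - g x]opprB sqrrN expr2.
    rewrite (_ : fine \o _ = fun k => (h k x - f n x) * (h k x - f n x)); last first.
      by apply/funext => k /=; rewrite expr2.
    by apply: cvgM; apply: cvgB => //; [exact: hcvg|exact: cvg_cst|exact: hcvg|exact: cvg_cst].
  apply: (le_trans (@fatou _ _ _ mu D mD F mF _)); first by move=> k x _; rewrite lee_fin sqr_ge0.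
  rewrite limn_einf_lim; apply: lime_le; first exact: is_cvg_einfs.
  near=> k; apply: (@le_trans _ _ (\int[mu]_(x in D) F k x)%E).
    by apply: ereal_inf_lbound; exists k => /=.
  have -> : (\int[mu]_(x in D) F k x = \int[mu]_(x in D)
     ((f (p k) x - f n x) * (f (p k) x - f n x))%:E)%E.
    apply: ge0_ae_eq_integral => //.
    - apply/measurable_EFinP.
      by apply: measurable_funM; apply: measurable_funB; [case: (sf (p k))|case: (sf n)|case: (sf (p k))|case: (sf n)].
    - by move=> x _; rewrite lee_fin sqr_ge0.
    - by move=> x _; rewrite lee_fin -expr2 sqr_ge0.
    - move: aeu; apply: filterS => x ux Dx; rewrite /F /h indicE.
      have -> : x \in E by rewrite inE; split=> //=; rewrite -ge0_fin_numE ?ux.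
      by rewrite mulr1 expr2.
  rewrite ip_fin; [|exact: sqiB..]; rewrite lee_fin; apply: Hk.
  by apply: leq_trans (pk k); near: k; exists N.
have sfg n e N : (forall m, (N <= m)%N ->
    inner_product mu D (fun x => f m x - f n x) (fun x => f m x - f n x) <= e) ->
  sqi mu D (fun x => f n x - g x).
  move=> /key h1; apply: sqi_of_lty; last by apply: le_lt_trans h1 _; rewrite ltry.
  by apply: measurable_funB => //; case: (sf n).
have sg : sqi mu D g.
  have [N NP] := cf 1 ltr01.
  have /(sqiB mD (sf N)) : sqi mu D (fun x => f N x - g x).
    by apply: (sfg N 1 N) => m Nm; exact/ltW/NP.
  by congr sqi; apply/funext => x; rewrite opprB addrC subrK.
exists g => // e e0; have e2 : 0 < e / 2 by lra.
have [N NP] := cf _ e2.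
exists N => n Nn; apply: (@le_lt_trans _ _ (e / 2)); last by lra.
have sng : sqi mu D (fun x => f n x - g x) by exact: sqiB.
rewrite -lee_fin -ip_fin//; under eq_integral do rewrite -expr2.
by apply: (key n _ N) => m Nm; exact/ltW/NP.
Unshelve. all: by end_near. Qed.

End Completeness.

(** * Riesz representation and the Lax-Milgram lemma *)

Section LaxMilgram.
Context {R : realType} {V : lmodType R}.
Variables (P : V -> Prop) (IP : V -> V -> R).
Implicit Types u v w : V.

(** The Hilbert space is a predicate [P] on an ambient module with a merely
    semidefinite form [IP]: functions are never identified almost everywhere. *)
Definition bilinear_on (B : V -> V -> R) :=
  (forall a u v w, P u -> P v -> P w -> B (a *: u + v) w = a * B u w + B v w) /\
  (forall a u v w, P u -> P v -> P w -> B w (a *: u + v) = a * B w u + B w v).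

Hypothesis P_lin : forall a u v, P u -> P v -> P (a *: u + v).
Hypothesis P_0 : P 0.
Hypothesis IP_lin : bilinear_on IP.
Hypothesis IP_sym : forall u v, IP u v = IP v u.
Hypothesis IP_ge0 : forall u, 0 <= IP u u.
Hypothesis P_complete : forall un : nat -> V, (forall n, P (un n)) ->
  (forall e : R, 0 < e -> exists N, forall m n, (N <= m)%N -> (N <= n)%N ->
     IP (un m - un n) (un m - un n) < e) ->
  exists2 u, P u & forall e : R, 0 < e -> exists N, forall n, (N <= n)%N ->
     IP (un n - u) (un n - u) < e.

Lemma le0_small (x K : R) : 0 <= K -> (forall e, 0 < e -> x <= e * K) -> x <= 0.
Proof.
move=> K0 H; rewrite leNgt; apply/negP => x0.
have K1 : 0 < 2 * (K + 1) by lra.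
have := H (x / (2 * (K + 1))) (divr_gt0 x0 K1).
rewrite mulrAC ler_pdivlMr//; nra.
Qed.

Lemma natSinv_small (e : R) : 0 < e -> exists N : nat, N.+1%:R^-1 < e.
Proof.
by move=> e0; have [N _ h] := near_infty_natSinv_lt (PosNum e0); exists N; exact: (h N (leqnn N)).
Qed.

Lemma discriminant_le (a b c : R) :
  (forall t, 0 <= a * t ^+ 2 + 2 * b * t + c) -> b ^+ 2 <= a * c.
Proof.
move=> H.
have a0 : 0 <= a.
  rewrite leNgt; apply/negP => a0.
  pose s := (2 * `|b| + `|c| + 1) / - a.
  have s0 : 0 < s.
    by rewrite divr_gt0 ?oppr_gt0//; have := normr_ge0 b; have := normr_ge0 c; lra.
  have as_ : a * s = - (2 * `|b| + `|c| + 1).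
    by rewrite /s invrN mulrN mulrN mulrCA divff ?mulr1// lt_eqF.
  have := H (1 + s).
  have := ler_norm b; have := ler_norm c; have := normr_ge0 b; have := normr_ge0 c.
  nra.
have [a1|an] := eqVneq a 0; last first.
  have a1 : 0 < a by rewrite lt_neqAle eq_sym an.
  have := H (- b / a).
  rewrite (_ : _ + c = (a * c - b ^+ 2) / a); last by field.
  by rewrite pmulr_lge0 ?invr_gt0// subr_ge0.
rewrite a1 mul0r; have [->|bn] := eqVneq b 0; first by rewrite expr2 mul0r.
have := H (- (c + 1) / (2 * b)).
rewrite (_ : _ + c = -1); last by rewrite a1; field.
by rewrite oppr_ge0 ler10.
Qed.

Lemma P_B u v : P u -> P v -> P (u - v).
Proof. by move=> pu pv; rewrite addrC -scaleN1r; exact: P_lin. Qed.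

Lemma P_D u v : P u -> P v -> P (u + v).
Proof. by move=> pu pv; rewrite -[u]scale1r; exact: P_lin. Qed.

Lemma P_Z a u : P u -> P (a *: u).
Proof. by move=> pu; rewrite -[_ *: _]addr0; exact: P_lin. Qed.

Lemma bilB B u v w : bilinear_on B -> P u -> P v -> P w ->
  B (u - v) w = B u w - B v w.
Proof.
move=> [Bl _] pu pv pw; have := Bl (-1) v u w pv pu pw.
by rewrite scaleN1r mulN1r addrC => ->; rewrite addrC.
Qed.

Lemma bilBr B u v w : bilinear_on B -> P u -> P v -> P w ->
  B w (u - v) = B w u - B w v.
Proof.
move=> [_ Bl] pu pv pw; have := Bl (-1) v u w pv pu pw.
by rewrite scaleN1r mulN1r addrC => ->; rewrite addrC.
Qed.

Lemma IP_expand a u v : P u -> P v ->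
  IP (u + a *: v) (u + a *: v) = IP v v * a ^+ 2 + 2 * IP u v * a + IP u u.
Proof.
move=> pu pv; case: IP_lin => L1 L2.
by rewrite addrC L1// ?L2//; [rewrite (IP_sym v u); ring|exact: P_lin].
Qed.

Lemma IP_CS u v : P u -> P v -> IP u v ^+ 2 <= IP u u * IP v v.
Proof.
move=> pu pv; rewrite mulrC; apply: discriminant_le => t.
by rewrite -IP_expand.
Qed.

(** The representer minimises [IP v v - 2 l v]: the parallelogram identity makes
    a minimising sequence Cauchy, and near-minimality along every line [u + t v]
    bounds [IP u v - l v] through the discriminant. *)
Lemma riesz (l : V -> R) (M : R) :
  (forall a u v, P u -> P v -> l (a *: u + v) = a * l u + l v) ->
  (forall v, P v -> l v ^+ 2 <= M * IP v v) ->
  exists2 u, P u & forall v, P v -> IP u v = l v.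
Proof.
move=> lL lM.
pose J v := IP v v - 2 * l v.
pose S := [set J v | v in P].
have J_ge v : P v -> - `|M| <= J v.
  move=> pv; have := lM v pv; have := IP_ge0 v; have := ler_norm M; rewrite /J.
  have := normr_ge0 M; set a := `|M|; set n := IP v v; set x := l v => a0 Ma n0 h.
  have : x ^+ 2 <= a * n by nra.
  move=> {}h; have : 0 <= (n - x) ^+ 2 by exact: sqr_ge0.
  have : 0 <= (n - a) ^+ 2 by exact: sqr_ge0.
  rewrite leNgt => h1 h2; apply/negP => h3.
  have : x > 0 by nra.
  nra.
have hS : has_inf S.
  split; first by exists (J 0), 0.
  by exists (- `|M|) => _ [v pv <-]; exact: J_ge.
pose m := inf S.
have m_le v : P v -> m <= J v by move=> pv; apply: ge_inf; [case: hS|exists v].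
have /choice[un unP] n : exists v, P v /\ J v < m + n.+1%:R^-1.
  have [|_ [v pv <-] h] := @inf_adherent _ S n.+1%:R^-1 _ hS; last by exists v.
  by rewrite invr_gt0.
have pun n : P (un n) by case: (unP n).
have Jun n : J (un n) - m < n.+1%:R^-1 by rewrite ltrBlDl; case: (unP n).
have l0 : l 0 = 0.
  by have := lL 1 0 0 P_0 P_0; rewrite scale1r addr0 mul1r; lra.
have JB u v : P u -> P v -> IP (u - v) (u - v) <= 2 * (J u - m) + 2 * (J v - m).
  move=> pu pv; have := m_le (2^-1 *: u + 2^-1 *: v) (P_lin _ pu (P_Z _ pv)).
  rewrite /J lL//; last exact: P_Z.
  have -> : l (2^-1 *: v) = 2^-1 * l v by rewrite -[_ *: v]addr0 lL// l0 addr0.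
  rewrite -[u - v]/(u + (- v)) -scaleN1r !IP_expand//; last exact: P_Z.
  case: IP_lin => L1 L2; have L0 w : P w -> IP w 0 = 0.
    by move=> pw; have := L2 1 0 0 w P_0 P_0 pw; rewrite scale1r addr0 mul1r; lra.
  have LZ a w z : P w -> P z -> IP w (a *: z) = a * IP w z.
    by move=> pw pz; rewrite -[_ *: z]addr0 L2// L0// addr0.
  have LZl a w z : P w -> P z -> IP (a *: z) w = a * IP z w.
    by move=> pw pz; rewrite IP_sym LZ// IP_sym.
  rewrite !LZl ?LZ//; last exact: P_Z.
  lra.
have cau (e : R) : 0 < e -> exists N, forall m n, (N <= m)%N -> (N <= n)%N ->
     IP (un m - un n) (un m - un n) < e.
  move=> e0; have [N Ne] : exists N : nat, N.+1%:R^-1 < e / 4.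
    by apply: natSinv_small; lra.
  exists N => i j Ni Nj; apply: le_lt_trans (JB _ _ _ _) _ => //.
  have h k : (N <= k)%N -> J (un k) - m < e / 4.
    move=> Nk; apply: lt_le_trans (Jun k) _; apply: le_trans (ltW Ne).
    by rewrite lef_pV2 ?posrE// ler_nat.
  have := h i Ni; have := h j Nj; lra.
have [u pu uP] := P_complete pun cau.
exists u => // v pv.
apply/eqP; rewrite -subr_eq0 -sqrf_eq0 eq_le sqr_ge0 andbT.
apply: (@le0_small _ (4 * IP v v)); first by rewrite mulr_ge0.
move=> e e0; have [N Ne] := natSinv_small e0.
have [N' N'P] := uP e e0; pose n := maxn N N'.
(* [J] at [un n + t v] stays above the infimum for every [t]. *)
have h1 : (IP (un n) v - l v) ^+ 2 <= IP v v * (J (un n) - m).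
  apply: discriminant_le => t.
  have := m_le _ (P_D (pun n) (P_Z t pv)).
  by rewrite /J IP_expand// [un n + _]addrC lL// => ?; lra.
have h2 : J (un n) - m <= e.
  apply/ltW/(lt_trans (Jun n)); apply: le_lt_trans Ne.
  by rewrite lef_pV2 ?posrE// ler_nat ltnS leq_maxl.
have h3 := N'P n (leq_maxr _ _).
have h4 := IP_CS (P_B (pun n) pu) pv.
have h5 : IP u v - l v = (IP (un n) v - l v) - IP (un n - u) v.
  by rewrite bilB//; ring.
rewrite h5; have := IP_ge0 v; move: h1 h2 h3 h4.
set z := IP v v; set a := _ - l v; set b := IP (_ - u) v; set c := J _ - m; set q := IP _ _.
move=> h1 h2 h3 h4 z0.
have : 0 <= (a + b) ^+ 2 by exact: sqr_ge0.
have : z * c <= z * e by rewrite ler_wpM2l.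
have : q * z <= e * z by rewrite ler_wpM2r// ltW.
nra.
Qed.

Lemma IP_young s u v : 0 < s -> P u -> P v ->
  IP (u + v) (u + v) <= (1 + s) * IP u u + (1 + s^-1) * IP v v.
Proof.
move=> s0 pu pv; have := IP_ge0 (v + (- s) *: u).
rewrite -[v in IP (u + v) _]scale1r -[v in IP _ (u + v)]scale1r !IP_expand//.
rewrite (IP_sym v u) => h.
have : 0 <= s^-1 * (IP u u * (- s) ^+ 2 + 2 * IP u v * - s + IP v v).
  by rewrite mulr_ge0// invr_ge0 ltW.
rewrite (_ : s^-1 * _ = s * IP u u - 2 * IP u v + s^-1 * IP v v); last by field; rewrite gt_eqF.
move=> {}h; lra.
Qed.

Lemma IP_0l u : P u -> IP 0 u = 0.
Proof.
move=> pu; case: IP_lin => L1 _; have := L1 1 0 0 u P_0 P_0 pu.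
by rewrite scale1r addr0 mul1r; lra.
Qed.

Lemma IP_Z a u : P u -> IP (a *: u) (a *: u) = a ^+ 2 * IP u u.
Proof.
move=> pu; have := IP_expand a P_0 pu; rewrite add0r => ->.
by rewrite !IP_0l//; ring.
Qed.

Lemma IP_distC u v : P u -> P v -> IP (u - v) (u - v) = IP (v - u) (v - u).
Proof.
move=> pu pv; have := IP_Z (-1) (P_B pv pu).
by rewrite scaleN1r opprB sqrrN expr1n mul1r.
Qed.

Lemma IP_triangle u v : P u -> P v ->
  IP (u + v) (u + v) <= 2 * IP u u + 2 * IP v v.
Proof. by move=> pu pv; have := IP_young ltr01 pu pv; rewrite invr1. Qed.

Lemma IP_distD u v w : P u -> P v -> P w ->
  IP (u - w) (u - w) <= 2 * IP (u - v) (u - v) + 2 * IP (v - w) (v - w).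
Proof.
move=> pu pv pw; have -> : u - w = (u - v) + (v - w) by rewrite addrA subrK.
by apply: IP_triangle; exact: P_B.
Qed.

Lemma IP_dist_lin a u u' v v' : P u -> P u' -> P v -> P v' ->
  IP (a *: u + v - (a *: u' + v')) (a *: u + v - (a *: u' + v'))
  <= 2 * a ^+ 2 * IP (u - u') (u - u') + 2 * IP (v - v') (v - v').
Proof.
move=> pu pu' pv pv'.
have -> : a *: u + v - (a *: u' + v') = a *: (u - u') + (v - v').
  by rewrite opprD addrACA -scalerBr.
apply: le_trans (IP_triangle (P_Z a (P_B pu pu')) (P_B pv pv')) _.
by rewrite IP_Z ?mulrA//; exact: P_B.
Qed.

Section Closure.
Variable S : V -> Prop.
Hypothesis S_P : forall u, S u -> P u.
Hypothesis S_lin : forall a u v, S u -> S v -> S (a *: u + v).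
Hypothesis S_0 : S 0.

Definition closure_of u := P u /\ forall e : R, 0 < e -> exists2 s, S s & IP (u - s) (u - s) < e.

Lemma closure_of_sub u : S u -> closure_of u.
Proof.
move=> su; split; first exact: S_P.
by move=> e e0; exists u => //; rewrite subrr IP_0l.
Qed.

Lemma closure_of_lin a u v : closure_of u -> closure_of v -> closure_of (a *: u + v).
Proof.
move=> [pu hu] [pv hv]; split; first exact: P_lin.
move=> e e0; pose d : R := e / (4 * (a ^+ 2 + 1)).
have a0 := sqr_ge0 a.
have a1 : 0 < 4 * (a ^+ 2 + 1) by lra.
have d0 : 0 < d by exact: divr_gt0.
have dE : d * (4 * (a ^+ 2 + 1)) = e by rewrite /d divfK// gt_eqF.
have [f sf fd] := hu d d0; have [g sg gd] := hv d d0.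
exists (a *: f + g); first exact: S_lin.
apply: le_lt_trans (IP_dist_lin a pu (S_P sf) pv (S_P sg)) _.
have := IP_ge0 (u - f); have := IP_ge0 (v - g); nra.
Qed.

Lemma closure_of_complete (un : nat -> V) : (forall n, closure_of (un n)) ->
  (forall e : R, 0 < e -> exists N, forall m n, (N <= m)%N -> (N <= n)%N ->
     IP (un m - un n) (un m - un n) < e) ->
  exists2 u, closure_of u & forall e : R, 0 < e -> exists N, forall n, (N <= n)%N ->
     IP (un n - u) (un n - u) < e.
Proof.
move=> hu cu; have [u pu uP] := P_complete (fun n => proj1 (hu n)) cu.
exists u => //; split=> // e e0; have e5 : 0 < e / 5 by lra.
have [N NP] := uP _ e5; have [s ss hs] := proj2 (hu N) _ e5.
exists s => //; have := NP N (leqnn N) => h.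
have pN := proj1 (hu N).
apply: le_lt_trans (IP_distD pu pN (S_P ss)) _.
by rewrite (IP_distC pu pN); lra.
Qed.

Lemma closure_of_ortho u w : closure_of u -> P w -> (forall s, S s -> IP s w = 0) ->
  IP u w = 0.
Proof.
move=> [pu hu] pw H; apply/eqP; rewrite -sqrf_eq0 eq_le sqr_ge0 andbT.
apply: (@le0_small _ (IP w w)) => // e e0.
have [s ss hs] := hu e e0.
have -> : IP u w = IP (u - s) w.
  by rewrite (bilB IP_lin pu (S_P ss) pw) (H s ss) subr0.
apply: le_trans (IP_CS (P_B pu (S_P ss)) pw) _.
by rewrite ler_wpM2r// ltW.
Qed.

End Closure.

(** Riesz turns the equation into [T u = F]; the map [u - rho (T u - F)] is a
    contraction when [rho] is the ratio of the coercivity constant to the bound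
    of the form, and its iterates converge to the solution. *)
Lemma lax_milgram (B : V -> V -> R) (M c : R) (l : V -> R) (L : R) :
  bilinear_on B -> 0 < c -> 0 < M ->
  (forall u v, P u -> P v -> B u v ^+ 2 <= M * IP u u * IP v v) ->
  (forall u, P u -> c * IP u u <= B u u) ->
  (forall a u v, P u -> P v -> l (a *: u + v) = a * l u + l v) ->
  (forall v, P v -> l v ^+ 2 <= L * IP v v) ->
  exists2 u, P u & forall v, P v -> B u v = l v.
Proof.
move=> BL c0 M0 BM Bc lL lb.
have [F pF FP] := riesz lL lb.
have /choice[T TP] u : exists t, P u -> P t /\ forall v, P v -> IP t v = B u v.
  have [pu|npu] := pselect (P u); last by exists 0.
  have [||t pt tP] := @riesz (B u) (M * IP u u); last by exists t.
  - by move=> a v w pv pw; case: BL => _ ->.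
  - by move=> v pv; exact: BM.
pose rho := c / M.
have rho0 : 0 < rho by exact: divr_gt0.
pose K u := u - rho *: (T u - F).
have pK u : P u -> P (K u).
  by move=> pu; apply: P_B => //; apply/P_Z/P_B => //; have [] := TP u pu.
pose q := 1 - c ^+ 2 / M.
have q1 : q < 1.
  by rewrite /q gtrBl divr_gt0// exprn_gt0.
have Kcontr u v : P u -> P v -> IP (K u - K v) (K u - K v) <= q * IP (u - v) (u - v).
  move=> pu pv; have [pTu Tu] := TP u pu; have [pTv Tv] := TP v pv.
  have -> : K u - K v = (u - v) + (- rho) *: (T u - T v).
    rewrite /K scaleNr opprB [rho *: _ - v]addrC addrACA [- _ + rho *: _]addrC -scalerBr.
    by rewrite opprB addrA subrK -scalerN opprB.
  set w := u - v; set z := T u - T v.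
  have pw : P w by exact: P_B. have pz : P z by exact: P_B.
  have zB x : P x -> IP z x = B w x.
    by move=> px; rewrite /z /w !bilB// Tu// Tv.
  rewrite IP_expand// (IP_sym w z) (zB w pw).
  have zz : IP z z <= M * IP w w.
    have := BM w z pw pz; rewrite -(zB z pz) expr2; have := IP_ge0 z; have := IP_ge0 w.
    have [->|zn] := eqVneq (IP z z) 0; first by move=> *; rewrite mulr_ge0// ltW.
    by move=> w0 z0; rewrite ler_pM2r// lt_neqAle eq_sym zn.
  have := Bc w pw.
  have e1 : rho ^+ 2 * M = c ^+ 2 / M by rewrite /rho; field; rewrite gt_eqF.
  have e2 : rho * c = c ^+ 2 / M by rewrite /rho; field; rewrite gt_eqF.
  have : rho ^+ 2 * IP z z <= rho ^+ 2 * (M * IP w w) by rewrite ler_wpM2l// sqr_ge0.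
  rewrite mulrA e1 => h1 h2.
  have : c ^+ 2 / M * IP w w <= rho * B w w by rewrite -e2 -mulrA ler_wpM2l// ltW.
  move: h1; rewrite sqrrN /q; lra.
(* [q] may be negative; [q'] is a contraction factor in [0, 1). *)
pose q' : R := Num.max q 0.
have q'1 : q' < 1 by rewrite /q' gt_max q1 ltr01.
have q'0 : 0 <= q' by rewrite /q' le_max lexx orbT.
have Kc u v : P u -> P v -> IP (K u - K v) (K u - K v) <= q' * IP (u - v) (u - v).
  move=> pu pv; apply: le_trans (Kcontr u v pu pv) _.
  by rewrite ler_wpM2r// /q' le_max lexx.
pose un n := iter n K 0.
have pun n : P (un n) by elim: n => //= n IH; exact: pK.
have [C C0 CP] : exists2 C, 0 <= C & forall k, IP (un k - un 0) (un k - un 0) <= C.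
  (* Weight in Young's inequality for which (1 + s) q' is still below 1: the
     distance of the iterates to the origin then stays bounded. *)
  pose s := (1 - q') / (2 * (q' + 1)).
  have s0 : 0 < s by apply: divr_gt0; lra.
  have sq : (1 + s) * q' <= (1 + q') / 2.
    have : s * (2 * (q' + 1)) = 1 - q' by rewrite /s divfK// gt_eqF//; lra.
    nra.
  pose a := (1 + s^-1) * IP (un 1 - un 0) (un 1 - un 0).
  have a0 : 0 <= a by rewrite mulr_ge0// addr_ge0// invr_ge0 ltW.
  have k0 : 0 < 1 - q' by lra.
  pose C := 2 * a / (1 - q').
  have CE : C * (1 - q') = 2 * a by rewrite /C divfK// gt_eqF.
  have C0 : 0 <= C by apply: divr_ge0 (ltW k0); exact: mulr_ge0.
  exists C => //; elim=> [|k IH].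
    rewrite subrr; have -> // : IP 0 0 = 0.
    by case: IP_lin => L1 _; have := L1 1 0 0 0 P_0 P_0 P_0; rewrite scale1r addr0 mul1r; lra.
  have -> : un k.+1 - un 0 = (un k.+1 - un 1) + (un 1 - un 0).
    by rewrite addrA subrK.
  apply: le_trans (IP_young s0 _ _) _; [exact: P_B..|].
  apply: (@le_trans _ _ ((1 + s) * q' * C + a)); last by nra.
  rewrite lerD2r -mulrA ler_wpM2l ?addr_ge0 ?(ltW s0)//.
  by apply: le_trans (Kc _ _ (pun k) P_0) _; rewrite ler_wpM2l.
have geo n k : IP (un (n + k)%N - un n) (un (n + k)%N - un n) <= q' ^+ n * C.
  elim: n => [|n IH]; first by rewrite mul1r.
  apply: le_trans (Kc _ _ (pun _) (pun _)) _.
  by rewrite exprS -mulrA ler_wpM2l.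
have qN (e : R) : 0 < e -> exists N, forall n, (N <= n)%N -> q' ^+ n * C < e.
  move=> e0; have : (fun n => q' ^+ n * C) @ \oo --> (0 * C : R).
    by apply: cvgMl; apply: cvg_expr; rewrite ger0_norm.
  rewrite mul0r => /cvgr0Pnorm_lt /(_ e e0)[N _ NP]; exists N => n Nn.
  by have := NP n Nn; rewrite /= ger0_norm// mulr_ge0// exprn_ge0.
have cau (e : R) : 0 < e -> exists N, forall m n, (N <= m)%N -> (N <= n)%N ->
     IP (un m - un n) (un m - un n) < e.
  move=> e0; have [N NP] := qN e e0; exists N.
  have sym u v : P u -> P v -> IP (u - v) (u - v) = IP (v - u) (v - u).
    move=> pu pv; rewrite -scaleN1r IP_expand// -[v - u]/(v + (- u)) -scaleN1r IP_expand// (IP_sym v u).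
    ring.
  have wl i j : (i <= j)%N -> (N <= i)%N -> IP (un j - un i) (un j - un i) < e.
    by move=> ij Ni; rewrite -(subnKC ij); apply: le_lt_trans (geo _ _) (NP _ Ni).
  move=> i j Ni Nj; case: (leqP i j) => [ij|/ltnW ij]; last exact: wl.
  by rewrite sym//; exact: wl.
have [u pu uP] := P_complete pun cau.
exists u => // v pv.
apply/eqP; rewrite -subr_eq0 -sqrf_eq0 eq_le sqr_ge0 andbT.
apply: (@le0_small _ (2 * (M + rho^-1 ^+ 2) * IP v v)).
  by rewrite !mulr_ge0// addr_ge0// ?sqr_ge0// ltW.
move=> e e0; have [N NP] := qN e e0; have [N' N'P] := uP e e0; pose n := maxn N N'.
have h1 : IP (un n.+1 - un n) (un n.+1 - un n) <= e.
  rewrite -addn1; apply: le_trans (geo _ _) _; apply/ltW/NP; exact: leq_maxl.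
have h2 := ltW (N'P n (leq_maxr _ _)).
have [pTn Tn] := TP _ (pun n).
have h3 : B u v - l v = - rho^-1 * IP (un n.+1 - un n) v - B (un n - u) v.
  have -> : un n.+1 - un n = - rho *: (T (un n) - F) + 0.
    by rewrite addr0 /= /K addrAC subrr add0r scaleNr.
  case: IP_lin => L1 L2; rewrite L1//; last exact: P_B.
  have -> : IP 0 v = 0 by have := L1 1 0 0 v P_0 P_0 pv; rewrite scale1r addr0 mul1r; lra.
  rewrite bilB// Tn// FP// bilB//.
  by field; rewrite gt_eqF.
have h4 := IP_CS (P_B (pun n.+1) (pun n)) pv.
have h5 := BM _ _ (P_B (pun n) pu) pv.
rewrite h3; move: h1 h2 h4 h5; set z := IP v v; set a := IP _ v; set b := B _ v; set x := IP (_ - _) _.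
set y := IP (_ - u) _; set r := rho^-1 => h1 h2 h4 h5.
have z0 : 0 <= z by exact: IP_ge0.
have k1 : a ^+ 2 <= e * z by apply: le_trans h4 _; rewrite ler_wpM2r.
have k2 : b ^+ 2 <= M * e * z by apply: le_trans h5 _; rewrite ler_wpM2r// ler_wpM2l// ltW.
have k3 : r ^+ 2 * a ^+ 2 <= r ^+ 2 * (e * z) by rewrite ler_wpM2l// sqr_ge0.
have : 0 <= (r * a - b) ^+ 2 by exact: sqr_ge0.
nra.
Qed.

End LaxMilgram.

(** * Integration over the plane *)

Section Plane.
Context {R : realType}.
Implicit Types (f F : R * R -> R) (g : R -> R) (x y : R * R).

Let MR2 := (measurableTypeR R * measurableTypeR R)%type.

(** The product sigma-algebra contains the open sets because the plane has a
    countable base of boxes. *)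
Lemma open_measurable2 (U : set (R * R)) : open U -> measurable (U : set MR2).
Proof.
move=> oU.
pose box (p q : rat) (n : nat) : set MR2 :=
  ball (ratr p : R) n.+1%:R^-1 `*` ball (ratr q : R) n.+1%:R^-1.
have mbox p q n : measurable (box p q n).
  by apply: measurableX; apply: measurable_realfun.open_measurable; exact: ball_open.
have -> : U = \bigcup_(p : rat) \bigcup_(q : rat) \bigcup_(n : nat)
   (if `[< box p q n `<=` U >] then box p q n else set0).
  apply/seteqP; split=> [x Ux|x [p _ [q _ [n _]]]]; last first.
    by case: asboolP => // h /h.
  have /nbhs_ballP[e /= e0 eU] : nbhs x U by rewrite nbhsE; exists U.
  have e2 : 0 < e / 2 by lra.
  have [n ne] := natSinv_small e2.
  have n0 : 0 < n.+1%:R^-1 :> R by rewrite invr_gt0.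
  have dr (z : R) : exists p : rat, ball z n.+1%:R^-1 (ratr p : R).
    have [||w [h [p _ ph]]] := @dense_rat R (ball z n.+1%:R^-1); last by exists p; rewrite ph.
    - by exists z; exact: ballxx.
    - exact: ball_open.
  have [p hp] := dr x.1; have [q hq] := dr x.2.
  exists p => //; exists q => //; exists n => //.
  rewrite asboolT; first by split; exact: ball_sym.
  have hh : n.+1%:R^-1 + n.+1%:R^-1 <= e by move: ne; set r := _^-1 => ne; lra.
  move=> y [yp yq]; apply: eU; split=> /=.
    apply: (le_ball hh).
    exact: ball_triangle hp yp.
  apply: (le_ball hh).
  exact: ball_triangle hq yq.
apply: bigcupT_measurable_rat => p; apply: bigcupT_measurable_rat => q.
by apply: bigcupT_measurable => n; case: ifP.
Qed.

Lemma continuous_measurable2 f : continuous f -> measurable_fun setT (f : MR2 -> R).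
Proof.
move=> /continuousP cf; apply: (measurability _ (RGenOpens.measurableE R)).
move=> _ [_ [a [b ->] <-]]; rewrite setTI; apply: open_measurable2.
exact/cf/interval_open.
Qed.

Lemma pair_continuous1 (b : R) : continuous (fun t : R => (t, b)).
Proof. by move=> t; apply: (@cvg_pair _ _ _ _ (nbhs t) (nbhs b)) => //=; exact: cvg_cst. Qed.

Lemma pair_continuous2 (a : R) : continuous (fun t : R => (a, t)).
Proof. by move=> t; apply: (@cvg_pair _ _ _ _ (nbhs a) (nbhs t)) => //=; exact: cvg_cst. Qed.

(** Continuous functions of bounded support, on the line and on the plane: a
    class on which integrability, Fubini and partial integration hold without
    further hypotheses. *)
Definition cc1 (g : R -> R) :=
  continuous g /\ exists M : R, forall t, M < `|t| -> g t = 0.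

Definition cc f :=
  continuous f /\ exists M : R, forall x, M < `|x.1| \/ M < `|x.2| -> f x = 0.

Lemma cc_line1 f b : cc f -> cc1 (fun t => f (t, b)).
Proof.
move=> [cf [M fM]]; split; last by exists M => t Mt; apply: fM; left.
by move=> t; apply: (@continuous_comp _ _ _ (fun t => (t, b)) f); [exact: pair_continuous1|exact: cf].
Qed.

Lemma cc_line2 f a : cc f -> cc1 (fun t => f (a, t)).
Proof.
move=> [cf [M fM]]; split; last by exists M => t Mt; apply: fM; right.
by move=> t; apply: (@continuous_comp _ _ _ (fun t => (a, t)) f); [exact: pair_continuous2|exact: cf].
Qed.

Lemma cc1_bounded g : cc1 g -> exists2 B : R, 0 <= B & forall t, `|g t| <= B.
Proof.
move=> [cg [M gM]].
have M0 : - `|M| <= `|M| by have := normr_ge0 M; lra.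
have [|||c _ cmax] := @compact_EVT_max _ R (fun t => `|g t|) `[- `|M|, `|M|].
- by exists `|M|; rewrite /= in_itv /= lexx M0.
- exact: segment_compact.
- apply: continuous_subspaceT => t; apply: continuous_comp; [exact: cg|exact: norm_continuous].
exists `|g c| => // t; have [tM|tM] := leP `|t| `|M|.
  by apply: cmax; rewrite inE /= in_itv /= -ler_norml.
by rewrite gM ?normr0//; apply: le_lt_trans tM; exact: ler_norm.
Qed.

Lemma cc_bounded f : cc f -> exists2 B : R, 0 <= B & forall x, `|f x| <= B.
Proof.
move=> [cf [M fM]].
have M0 : - `|M| <= `|M| by have := normr_ge0 M; lra.
have [|||c _ cmax] := @compact_EVT_max _ R (fun x => `|f x|) (`[- `|M|, `|M|] `*` `[- `|M|, `|M|]).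
- by exists (`|M|, `|M|); split; rewrite /= in_itv /= lexx M0.
- by apply: compact_setX; exact: segment_compact.
- apply: continuous_subspaceT => t; apply: continuous_comp; [exact: cf|exact: norm_continuous].
exists `|f c| => // x.
have [xM1|xM] := leP `|x.1| `|M|; last first.
  by rewrite fM ?normr0//; left; apply: le_lt_trans xM; exact: ler_norm.
have [xM2|xM] := leP `|x.2| `|M|; last first.
  by rewrite fM ?normr0//; right; apply: le_lt_trans xM; exact: ler_norm.
by apply: cmax; rewrite inE; split; rewrite /= in_itv /= -ler_norml.
Qed.

Lemma cc1_integrable g : cc1 g ->
  (@lebesgue_measure R).-integrable setT (EFin \o g).
Proof.
move=> hg; have [B B0 gB] := cc1_bounded hg; have [cg [M gM]] := hg.
apply: (@integrable_le _ (measurableTypeR R) R lebesgue_measure setT measurableT g (fun t => B * \1_(`[- M, M]) t + 0 * \1_(`[- M, M]) t)).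
- exact: continuous_measurable_fun.
- by apply: integrable_lin => //; exact: integrable_indic_itv.
- move=> t _; rewrite mul0r addr0 indicE.
  have [tM|tM] := boolP (t \in _); first by rewrite mulr1.
  rewrite gM ?normr0 ?mulr0// ltNge ler_norml; apply: contra tM.
  by rewrite inE /= in_itv.
Qed.

Lemma area_box (i j : interval R) :
  area ([set` i] `*` [set` j] : set MR2) = (lebesgue_measure [set` i] * lebesgue_measure [set` j])%E.
Proof.
by apply: (@product_measure1E _ _ (measurableTypeR R) (measurableTypeR R)); exact: measurable_itv.
Qed.

Lemma lebesgue_bounded_itv (a b : R) (b0 b1 : bool) : a <= b ->
  lebesgue_measure [set` Interval (BSide b0 a) (BSide b1 b)] = (b - a)%:E.
Proof.
move=> ab; rewrite lebesgue_measure_itv /=; case: ifPn => // h.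
have -> : b = a; last by rewrite subrr.
by apply/eqP; rewrite eq_le ab andbT leNgt -lte_fin.
Qed.

Lemma cc_integrable f : cc f -> area.-integrable setT (EFin \o f).
Proof.
move=> hf; have [B B0 gB] := cc_bounded hf; have [cg [M gM]] := hf.
pose A : set MR2 := `[- `|M|, `|M|] `*` `[- `|M|, `|M|].
have mA : measurable A by exact: measurableX.
have iA : area.-integrable setT (EFin \o (\1_A : MR2 -> R)).
  apply/integrableP; split; first exact/measurable_EFinP/measurable_indic.
  rewrite (eq_integral (fun x : MR2 => (\1_A x)%:E)); last first.
    by move=> x _ /=; rewrite ger0_norm// indicE ler0n.
  rewrite integral_indic// setIT area_box !lebesgue_bounded_itv ?ltry//;
  by have := normr_ge0 M; lra.
apply: (@integrable_le _ MR2 R area setT measurableT f (fun t => B * \1_A t + 0 * \1_A t)).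
- exact: continuous_measurable2.
- exact: integrable_lin.
- move=> t _; rewrite mul0r addr0 indicE.
  have [tM|tM] := boolP (t \in _); first by rewrite mulr1.
  rewrite gM ?normr0 ?mulr0//.
  apply: contrapT => /not_orP[/negP h1 /negP h2]; move/negP: tM; apply.
  move: h1 h2; rewrite -!leNgt => h1 h2.
  rewrite inE; split; rewrite /= in_itv /= -ler_norml; [apply: le_trans h1 _|apply: le_trans h2 _]; exact: ler_norm.
Qed.

Lemma cc_fubini1 f : cc f ->
  \int[area]_x f x
  = \int[@lebesgue_measure R]_a \int[@lebesgue_measure R]_b f (a, b).
Proof.
move=> hf; rewrite /Rintegral; congr fine.
rewrite -(integral12_prod_meas1 (cc_integrable hf)); apply: eq_integral => a _.
rewrite /fubini_F /= fineK//.
exact: (integrable_fin_num measurableT (cc1_integrable (cc_line2 a hf))).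
Qed.

Lemma cc_fubini2 f : cc f ->
  \int[area]_x f x
  = \int[@lebesgue_measure R]_b \int[@lebesgue_measure R]_a f (a, b).
Proof.
move=> hf; rewrite /Rintegral; congr fine.
rewrite -(integral21_prod_meas1 (cc_integrable hf)); apply: eq_integral => b _.
rewrite /fubini_G /= fineK//.
exact: (integrable_fin_num measurableT (cc1_integrable (cc_line1 b hf))).
Qed.

(** The fundamental theorem of calculus on an interval containing the support. *)
Lemma int_derive_cc1 (G g : R -> R) :
  (forall t : R, is_derive t 1 G (g t)) -> cc1 G -> cc1 g ->
  \int[@lebesgue_measure R]_t g t = 0.
Proof.
move=> dG [cG [M1 GM]] hg; have [cg [M2 gM]] := hg.
pose M : R := `|M1| + `|M2| + 1.
have [M01 M02] : `|M1| < M /\ `|M2| < M.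
  by have := normr_ge0 M1; have := normr_ge0 M2; rewrite /M; lra.
have M0 : 0 < M by have := normr_ge0 M1; lra.
have -> : \int[@lebesgue_measure R]_t g t = \int[@lebesgue_measure R]_(t in `[- M, M]) g t.
  rewrite [RHS]Rintegral_mkcond; congr Rintegral; apply/funext => t.
  rewrite patchE; case: ifPn => // tM; apply: gM; rewrite ltNge; apply: contra tM => tM.
  rewrite inE /= in_itv /= -ler_norml; apply: le_trans tM _; apply: ltW; apply: le_lt_trans M02; exact: ler_norm.
rewrite /Rintegral (@continuous_FTC2 _ g G).
- have h : M1 < `|M| by rewrite gtr0_norm//; apply: le_lt_trans M01; exact: ler_norm.
  by rewrite !GM ?normrN// -EFinB subrr.
- lra.
- exact: continuous_subspaceT.
- split.
  + by move=> t _; have [] := dG t.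
  + by apply: cvg_at_right_filter; exact: cG.
  + by apply: cvg_at_left_filter; exact: cG.
- by move=> t _; rewrite derive1E; apply: derive_val.
Qed.

Lemma is_derive_line1 F (b t d : R) :
  is_derive (t, b) e1 F d -> is_derive t 1 (fun s : R => F (s, b)) d.
Proof.
move=> [dF <-].
have E : (fun h : R => h^-1 *: (F (h *: e1 + (t, b)) - F (t, b)))
  = (fun h : R => h^-1 *: (F (h *: 1 + t, b) - F (t, b))).
  by apply/funext => h; congr (_ *: (F _ - _)); congr pair; rewrite /= scaler0 add0r.
by split; [move: dF; rewrite /derivable E|rewrite /derive E].
Qed.

Lemma is_derive_line2 F (a t d : R) :
  is_derive (a, t) e2 F d -> is_derive t 1 (fun s : R => F (a, s)) d.
Proof.
move=> [dF <-].
have E : (fun h : R => h^-1 *: (F (h *: e2 + (a, t)) - F (a, t)))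
  = (fun h : R => h^-1 *: (F (a, h *: 1 + t) - F (a, t))).
  by apply/funext => h; congr (_ *: (F _ - _)); congr pair; rewrite /= scaler0 add0r.
by split; [move: dF; rewrite /derivable E|rewrite /derive E].
Qed.

Lemma int_partial1 F (dF : R * R -> R) : (forall x, is_derive x e1 F (dF x)) ->
  cc F -> cc dF -> \int[area]_x dF x = 0.
Proof.
move=> hd cF cd; rewrite cc_fubini2// (_ : (fun b => _) = fun=> 0).
  by rewrite Rintegral_cst// mul0r.
apply/funext => b; apply: (@int_derive_cc1 (fun t => F (t, b))); last 2 first.
- exact: cc_line1.
- exact: (cc_line1 b cd).
- by move=> t; apply: is_derive_line1; exact: hd.
Qed.

Lemma int_partial2 F (dF : R * R -> R) : (forall x, is_derive x e2 F (dF x)) ->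
  cc F -> cc dF -> \int[area]_x dF x = 0.
Proof.
move=> hd cF cd; rewrite cc_fubini1// (_ : (fun b => _) = fun=> 0).
  by rewrite Rintegral_cst// mul0r.
apply/funext => a; apply: (@int_derive_cc1 (fun t => F (a, t))); last 2 first.
- exact: cc_line2.
- exact: (cc_line2 a cd).
- by move=> t; apply: is_derive_line2; exact: hd.
Qed.

End Plane.

(** * Real test functions *)

Section TestFunctions.
Context {R : realType}.
Variable D : set (R * R).
Implicit Types (f g h : R * R -> R) (phi psi : R * R -> R[i]) (x v : R * R).

Definition rsmooth f :=
  forall (vs : seq (R * R)) x, differentiable (foldr (fun v h => 'D_v h) f vs) x.

(** Real test functions.  Asking for some compact set that carries the function,
    instead of a compact closure of the support, makes linear combinations and
    derivatives immediate. *)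
Definition rtest f :=
  rsmooth f /\ exists K, [/\ compact K, K `<=` D & forall x, ~ K x -> f x = 0].

Lemma derive_lin a b f g v x : differentiable f x -> differentiable g x ->
  'D_v (fun y => a * f y + b * g y) x = a * 'D_v f x + b * 'D_v g x.
Proof.
move=> df dg.
have hf := @diff_derivable _ _ _ f x v df; have hg := @diff_derivable _ _ _ g x v dg.
have h := deriveD (derivableZ (k:=a) hf) (derivableZ (k:=b) hg).
by rewrite (deriveZ a hf) (deriveZ b hg) in h; exact: h.
Qed.

Lemma differentiable_lin a b f g x : differentiable f x -> differentiable g x ->
  differentiable (fun y => a * f y + b * g y) x.
Proof.
by move=> df dg; exact: (differentiableD (differentiableZ a df) (differentiableZ b dg)).
Qed.

Lemma rsmooth_lin a b f g : rsmooth f -> rsmooth g ->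
  rsmooth (fun x => a * f x + b * g x).
Proof.
move=> sf sg vs x.
have -> : foldr (fun v h => 'D_v h) (fun y => a * f y + b * g y) vs =
  (fun y => a * foldr (fun v h => 'D_v h) f vs y + b * foldr (fun v h => 'D_v h) g vs y).
  elim: vs => //= v vs ->; apply/funext => y; apply: derive_lin; [exact: sf|exact: sg].
by apply: differentiable_lin; [exact: sf|exact: sg].
Qed.

Lemma rsmoothD v f : rsmooth f -> rsmooth ('D_v f).
Proof. by move=> sf vs x; have := sf (rcons vs v) x; rewrite foldr_rcons. Qed.

Lemma plane_hausdorff : hausdorff_space (R * R)%type.
Proof. exact: norm_hausdorff. Qed.

Lemma derive_out K f v x : compact K -> (forall y, ~ K y -> f y = 0) ->
  ~ K x -> 'D_v f x = 0.
Proof.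
move=> cK fK nKx; have oK : open (~` K) by apply: closed_openC; exact: compact_closed plane_hausdorff cK.
have := @near_eq_derive _ _ _ f (cst 0) x v.
have [->|v0] := eqVneq v 0; first by rewrite derive0.
move=> H; rewrite H ?derive_cst//.
have : nbhs x (~` K) by rewrite nbhsE; exists (~` K).
by apply: filterS => y /fK.
Qed.

Lemma rtestD v f : rtest f -> rtest ('D_v f).
Proof.
move=> [sf [K [cK KD fK]]]; split; first exact: rsmoothD.
by exists K; split=> // x; exact: derive_out.
Qed.

Lemma rtest_lin a b f g : rtest f -> rtest g -> rtest (fun x => a * f x + b * g x).
Proof.
move=> [sf [K [cK KD fK]]] [sg [L [cL LD gL]]]; split; first exact: rsmooth_lin.
exists (K `|` L); split=> [||x /not_orP[/fK -> /gL ->]].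
- exact: compactU.
- by rewrite subUset.
- by rewrite !mulr0 addr0.
Qed.

Lemma rtest_derive f v x : rtest f -> is_derive x v f ('D_v f x).
Proof. by move=> [sf _]; apply/derivableP/diff_derivable; exact: (sf [::]). Qed.

Lemma rtest_continuous f : rtest f -> continuous f.
Proof. by move=> [sf _] x; apply: differentiable_continuous; exact: (sf [::]). Qed.

Lemma compact_box (K : set (R * R)) : compact K ->
  exists M : R, forall x, M < `|x.1| \/ M < `|x.2| -> ~ K x.
Proof.
move=> cK; have [K0|/set0P K0] := eqVneq K set0; first by exists 0 => x _; rewrite K0.
have [|c _ cmax] := @compact_EVT_max _ R (fun x => `|x.1| + `|x.2|) K K0 cK.
  apply: continuous_subspaceT => x; apply: cvgD; apply: cvg_norm; [exact: cvg_fst|exact: cvg_snd].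
exists (`|c.1| + `|c.2|) => x h Kx; have := cmax x; rewrite inE => /(_ Kx).
by have := normr_ge0 x.1; have := normr_ge0 x.2; case: h; lra.
Qed.

Lemma rtest_cc f : rtest f -> cc f.
Proof.
move=> tf; split; first exact: rtest_continuous.
have [_ [K [cK _ fK]]] := tf; have [M MP] := compact_box cK.
by exists M => x /MP /fK.
Qed.

Lemma rtest_out f x : rtest f -> ~ D x -> f x = 0.
Proof. by move=> [_ [K [_ KD fK]]] nD; apply: fK => /KD. Qed.

Lemma foldr_Cderive phi vs : foldr Cderive phi vs =
  (fun x => foldr (fun v h => 'D_v h) (fun y => complex.Re (phi y)) vs x
   +i* foldr (fun v h => 'D_v h) (fun y => complex.Im (phi y)) vs x).
Proof.
elim: vs => /= [|v vs ->]; first by apply/funext => x; case: (phi x).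
by apply/funext.
Qed.

Lemma smoothP phi : smooth phi <->
  rsmooth (fun x => complex.Re (phi x)) /\ rsmooth (fun x => complex.Im (phi x)).
Proof.
split=> [s|[s1 s2] vs x]; last by rewrite foldr_Cderive /=; split; [exact: s1|exact: s2].
by split=> vs x; have [] := s vs x; rewrite foldr_Cderive.
Qed.

(** Real and imaginary parts of a test function are again test functions; this
    reduces everything below to real-valued analysis. *)
Lemma test_functionP phi : test_function D phi <->
  rtest (fun x => complex.Re (phi x)) /\ rtest (fun x => complex.Im (phi x)).
Proof.
split=> [[/smoothP[s1 s2] cK KD]|[[s1 [K [cK KD fK]]] [s2 [L [cL LD fL]]]]].
  have h x : ~ closure [set x | phi x != 0] x -> phi x = 0.
    move=> nx; apply/eqP; rewrite -[_ == _]negbK; apply/negP => px; apply: nx.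
    exact: subset_closure.
  by split; split=> //; eexists; split; [exact: cK|exact: KD|move=> x /h ->|exact: cK|exact: KD|move=> x /h ->].
have cKL : compact (K `|` L) by exact: compactU.
have sub : closure [set x | phi x != 0] `<=` K `|` L.
  have -> : K `|` L = closure (K `|` L) by apply/closure_id; exact: compact_closed plane_hausdorff cKL.
  apply: closure_subset => x /= px; apply: contrapT => /not_orP[/fK h1 /fL h2].
  by move: px h1 h2; case: (phi x) => a b /= + a0 b0; rewrite a0 b0 eqxx.
split; first exact/smoothP.
- apply: subclosed_compact cKL sub; exact: closed_closure.
- by apply: subset_trans sub _; rewrite subUset.
Qed.

Lemma rtest_test f : rtest f -> test_function D (fun x => (f x)%:C).
Proof.
move=> tf; apply/test_functionP; split => //=.
by have := rtest_lin 0 0 tf tf; congr rtest; apply/funext => x; rewrite !mul0r addr0.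
Qed.

End TestFunctions.

(** * The form domain *)

Section FormDomain.
Context {R : realType}.
Variable D : set (R * R).

Let MR2 := (measurableTypeR R * measurableTypeR R)%type.
Hypothesis mD : measurable (D : set MR2).

Local Notation ipD := (inner_product (@area R) (D : set MR2)).
Local Notation sqA := (sqi (@area R) (D : set MR2)).

(** A function together with candidates for its two partial derivatives. *)
Definition jet : Type := ((R * R -> R^o) * (R * R -> R^o) * (R * R -> R^o))%type.
HB.instance Definition _ := GRing.Lmodule.on jet.
Implicit Types (U W : jet) (f g eta : R * R -> R).

Definition jet_of eta : jet := (eta : R * R -> R^o, 'D_e1 eta : R * R -> R^o, 'D_e2 eta : R * R -> R^o).

Definition sqj U := [/\ sqA U.1.1, sqA U.1.2 & sqA U.2].

Definition ipj U W := ipD U.1.1 W.1.1 + ipD U.1.2 W.1.2 + ipD U.2 W.2.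

Definition test_jet U := exists2 eta, rtest D eta & U = jet_of eta.

(** The real form domain H^1_0: limits of jets of real test functions. *)
Definition form_dom := closure_of sqj ipj test_jet.

Lemma sqi_lin1 a f g : sqA f -> sqA g -> sqA (fun x => a * f x + g x).
Proof.
move=> sf sg; have := sqi_lin mD a 1 sf sg; congr sqi.
by apply/funext => x; rewrite mul1r.
Qed.

Lemma ip_lin1 a f g h : sqA f -> sqA g -> sqA h ->
  ipD (fun x => a * f x + g x) h = a * ipD f h + ipD g h.
Proof.
move=> sf sg sh; rewrite -[ipD g h]mul1r -ip_linl//; congr inner_product.
by apply/funext => x; rewrite mul1r.
Qed.

Lemma sqj_lin a U W : sqj U -> sqj W -> sqj (a *: U + W).
Proof.
by move=> [u0 u1 u2] [w0 w1 w2]; split; [exact: sqi_lin1 u0 w0|exact: sqi_lin1 u1 w1|exact: sqi_lin1 u2 w2].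
Qed.

Lemma sqj0 : sqj 0. Proof. by split; exact: sqi0. Qed.

Lemma ipj_sym U W : ipj U W = ipj W U.
Proof. by rewrite /ipj; congr (_ + _ + _); exact: ipC. Qed.

Lemma ipj_bilinear : bilinear_on sqj ipj.
Proof.
have L a U W X : sqj U -> sqj W -> sqj X -> ipj (a *: U + W) X = a * ipj U X + ipj W X.
  move=> [u0 u1 u2] [w0 w1 w2] [x0 x1 x2]; rewrite /ipj.
  have -> := ip_lin1 a u0 w0 x0; have -> := ip_lin1 a u1 w1 x1.
  have -> := ip_lin1 a u2 w2 x2; ring.
split=> // a U W X sU sW sX; rewrite ipj_sym L// !(ipj_sym X)//.
Qed.

Lemma ipj_ge0 U : 0 <= ipj U U.
Proof. by rewrite /ipj !addr_ge0// ip_ge0. Qed.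

Lemma sqj_complete (Un : nat -> jet) : (forall n, sqj (Un n)) ->
  (forall e : R, 0 < e -> exists N, forall m n, (N <= m)%N -> (N <= n)%N ->
     ipj (Un m - Un n) (Un m - Un n) < e) ->
  exists2 U, sqj U & forall e : R, 0 < e -> exists N, forall n, (N <= n)%N ->
     ipj (Un n - U) (Un n - U) < e.
Proof.
move=> sU cU.
have aux (pr : jet -> R * R -> R) : (forall n, sqA (pr (Un n))) ->
  (forall m n, ipD (fun x => pr (Un m) x - pr (Un n) x) (fun x => pr (Un m) x - pr (Un n) x)
     <= ipj (Un m - Un n) (Un m - Un n)) ->
  exists2 g, sqA g & forall e : R, 0 < e -> exists N, forall n, (N <= n)%N ->
     ipD (fun x => pr (Un n) x - g x) (fun x => pr (Un n) x - g x) < e.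
  move=> spr le; apply: (L2_complete mD) => // e e0; have [N NP] := cU e e0.
  by exists N => m n Nm Nn; apply: le_lt_trans (le m n) (NP _ _ Nm Nn).
have [|m n|g0 sg0 g0P] := aux (fun U => U.1.1).
- by move=> n; case: (sU n).
- rewrite /ipj -addrA lerDl addr_ge0//; exact: ip_ge0.
have [|m n|g1 sg1 g1P] := aux (fun U => U.1.2).
- by move=> n; case: (sU n).
- rewrite /ipj addrAC lerDr addr_ge0//; exact: ip_ge0.
have [|m n|g2 sg2 g2P] := aux (fun U => U.2).
- by move=> n; case: (sU n).
- rewrite /ipj lerDr addr_ge0//; exact: ip_ge0.
exists ((g0 : R * R -> R^o, g1 : R * R -> R^o, g2 : R * R -> R^o) : jet); first by split.
move=> e e0; have e3 : 0 < e / 3 by lra.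
have [N0 h0] := g0P _ e3; have [N1 h1] := g1P _ e3; have [N2 h2] := g2P _ e3.
exists (maxn N0 (maxn N1 N2)) => n; rewrite !geq_max => /andP[n0 /andP[n1 n2]].
have := h0 n n0; have := h1 n n1; have := h2 n n2.
rewrite -[ipj _ _]/(ipD (fun x => (Un n).1.1 x - g0 x) (fun x => (Un n).1.1 x - g0 x)
  + ipD (fun x => (Un n).1.2 x - g1 x) (fun x => (Un n).1.2 x - g1 x)
  + ipD (fun x => (Un n).2 x - g2 x) (fun x => (Un n).2 x - g2 x)); lra.
Qed.

Lemma jet_lin a b f g : rtest D f -> rtest D g ->
  jet_of (fun x => a * f x + b * g x) = a *: jet_of f + b *: jet_of g.
Proof.
move=> [sf _] [sg _]; congr (_, _, _); apply/funext => x.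
- exact: (derive_lin _ _ _ (sf [::] x) (sg [::] x)).
- exact: (derive_lin _ _ _ (sf [::] x) (sg [::] x)).
Qed.

Lemma cc_mul f g : cc f -> continuous g -> cc (fun x => f x * g x).
Proof.
move=> [cf [M fM]] cg; split; first by move=> x; apply: cvgM; [exact: cf|exact: cg].
by exists M => x /fM ->; rewrite mul0r.
Qed.

Lemma cc_add f g : cc f -> cc g -> cc (fun x => f x + g x).
Proof.
move=> [cf [M fM]] [cg [L gL]]; split; first by move=> x; apply: cvgD; [exact: cf|exact: cg].
exists (`|M| + `|L|) => x h.
have := ler_norm M; have := ler_norm L; have := normr_ge0 M; have := normr_ge0 L => h1 h2 h3 h4.
by rewrite fM ?gL ?addr0//; case: h => h; [left|right|left|right]; lra.
Qed.

Lemma cc_sqi f : cc f -> sqA f.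
Proof.
move=> hf; split.
  by apply: measurable_funTS; apply: continuous_measurable2; case: hf.
have : area.-integrable setT (EFin \o (fun x => f x ^+ 2)).
  apply: cc_integrable; have := cc_mul hf (proj1 hf).
  by congr cc; apply/funext => x; rewrite expr2.
by apply: integrableS.
Qed.

Lemma sqj_test eta : rtest D eta -> sqj (jet_of eta).
Proof.
by move=> te; split; [exact: (cc_sqi (rtest_cc te))|exact: (cc_sqi (rtest_cc (rtestD e1 te)))|
  exact: (cc_sqi (rtest_cc (rtestD e2 te)))].
Qed.

Lemma test_jet_sqj U : test_jet U -> sqj U.
Proof. by move=> [eta te ->]; exact: sqj_test. Qed.

Lemma test_jet_lin a U W : test_jet U -> test_jet W -> test_jet (a *: U + W).
Proof.
move=> [f tf ->] [g tg ->]; exists (fun x => a * f x + 1 * g x); first exact: rtest_lin.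
by rewrite jet_lin// scale1r.
Qed.

Lemma rtest0 : rtest D (fun=> 0).
Proof.
split; last by exists set0; split=> //; exact: compact0.
move=> vs x; have -> : foldr (fun v h => 'D_v h) (fun=> 0 : R) vs = cst 0.
  by elim: vs => //= v vs ->; apply/funext => y; rewrite derive_cst.
exact: differentiable_cst.
Qed.

Lemma test_jet0 : test_jet 0.
Proof.
exists (fun=> 0); first exact: rtest0.
by congr (_, _, _); apply/funext => x; rewrite derive_cst.
Qed.

Lemma form_dom_test eta : rtest D eta -> form_dom (jet_of eta).
Proof.
move=> te; apply: (closure_of_sub sqj0 ipj_bilinear test_jet_sqj).
by exists eta.
Qed.

Lemma form_dom_sqj U : form_dom U -> sqj U. Proof. by case. Qed.

Lemma form_dom_lin a U W : form_dom U -> form_dom W -> form_dom (a *: U + W).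
Proof.
exact: (closure_of_lin sqj_lin sqj0 ipj_bilinear ipj_sym ipj_ge0 test_jet_sqj test_jet_lin).
Qed.

Lemma form_dom0 : form_dom 0.
Proof. exact: (closure_of_sub sqj0 ipj_bilinear test_jet_sqj test_jet0). Qed.

Lemma form_dom_complete (Un : nat -> jet) : (forall n, form_dom (Un n)) ->
  (forall e : R, 0 < e -> exists N, forall m n, (N <= m)%N -> (N <= n)%N ->
     ipj (Un m - Un n) (Un m - Un n) < e) ->
  exists2 U, form_dom U & forall e : R, 0 < e -> exists N, forall n, (N <= n)%N ->
     ipj (Un n - U) (Un n - U) < e.
Proof.
exact: (closure_of_complete sqj_lin sqj0 ipj_bilinear ipj_sym ipj_ge0 sqj_complete test_jet_sqj).
Qed.

Lemma int_test_domain f g : rtest D f -> ipD f g = \int[area]_x (f x * g x).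
Proof.
move=> tf; rewrite ipE Rintegral_mkcond; congr Rintegral; apply/funext => x.
rewrite patchE; case: ifPn => // /negP xD; rewrite (rtest_out tf) ?mul0r// => Dx.
by apply: xD; rewrite inE.
Qed.

Lemma ibp_test v f g : v = e1 \/ v = e2 -> rtest D f -> rtest D g ->
  ipD f ('D_v g) = - ipD g ('D_v f).
Proof.
move=> ve tf tg; rewrite !int_test_domain//; apply/eqP; rewrite -subr_eq0 opprK.
have cf := rtest_cc tf; have cg := rtest_cc tg.
have cdf := rtest_cc (rtestD v tf); have cdg := rtest_cc (rtestD v tg).
have c1 := cc_mul cf (proj1 cdg); have c2 := cc_mul cg (proj1 cdf).
rewrite -RintegralD//; [|exact: cc_integrable..].
have dfg x : is_derive x v (fun y => f y * g y) (f x * 'D_v g x + g x * 'D_v f x).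
  have := is_deriveM (rtest_derive v x tf) (rtest_derive v x tg); exact.
have cfg := cc_mul cf (proj1 cg).
by case: ve => ve; subst v; rewrite ?(int_partial1 dfg)// ?(int_partial2 dfg)//; exact: cc_add.
Qed.

(** A linear identity between L^2 pairings that holds for all test functions holds
    on the form domain: it says that a fixed jet is orthogonal to test jets. *)
Lemma ip_density (U : jet) (f0 f1 f2 : R * R -> R) : form_dom U ->
  sqA f0 -> sqA f1 -> sqA f2 ->
  (forall eta, rtest D eta -> ipD eta f0 + ipD ('D_e1 eta) f1 + ipD ('D_e2 eta) f2 = 0) ->
  ipD U.1.1 f0 + ipD U.1.2 f1 + ipD U.2 f2 = 0.
Proof.
move=> hU s0 s1 s2 H.
pose F : jet := (f0 : R * R -> R^o, f1 : R * R -> R^o, f2 : R * R -> R^o).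
have sF : sqj F by split.
apply: (closure_of_ortho sqj_lin ipj_bilinear ipj_sym ipj_ge0 test_jet_sqj hU sF).
by move=> _ [eta te ->]; exact: H.
Qed.

(** The last two components of an element of the form domain are the weak partial
    derivatives of the first one: this identity between test functions passes to
    the limit. *)
Lemma ibp_form_dom U f : form_dom U -> rtest D f ->
  ipD U.1.1 ('D_e1 f) = - ipD U.1.2 f /\ ipD U.1.1 ('D_e2 f) = - ipD U.2 f.
Proof.
move=> hU tf; have z := sqi0 (@area R) mD.
have sf := cc_sqi (rtest_cc tf).
have sd v : sqA ('D_v f) by exact: (cc_sqi (rtest_cc (rtestD v tf))).
have z0 g : ipD g (fun=> 0) = 0.
  by rewrite ipE (_ : (fun x => _) = fun=> 0) ?Rintegral_cst ?mul0r//; apply/funext => x; rewrite mulr0.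
split; apply/eqP; rewrite -subr_eq0 opprK; apply/eqP.
  have := ip_density hU (sd e1) sf z; rewrite z0 addr0; apply=> eta te.
  have -> := ibp_test (or_introl (erefl e1)) te tf.
  by rewrite z0 addr0 (_ : ipD ('D_e1 eta) f = ipD f ('D_e1 eta)) ?addNr//; exact: ipC.
have := ip_density hU (sd e2) z sf; rewrite z0 addr0; apply=> eta te.
have -> := ibp_test (or_intror (erefl e2)) te tf.
  by rewrite z0 addr0 (_ : ipD ('D_e2 eta) f = ipD f ('D_e2 eta)) ?addNr//; exact: ipC.
Qed.

End FormDomain.

(** * Weak solutions and the Dirichlet Laplacian *)

Definition re {R : realType} {T : Type} (u : T -> R[i]) : T -> R := fun x => complex.Re (u x).
Definition im {R : realType} {T : Type} (u : T -> R[i]) : T -> R := fun x => complex.Im (u x).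

Section ComplexL2.
Context {d : measure_display} {T : measurableType d} {R : realType}.
Variables (mu : {measure set T -> \bar R}) (D : set T).
Hypothesis mD : measurable D.
Implicit Types u w : T -> R[i].

Lemma normc_sqr (z : R[i]) :
  ComplexField.Normc.normc z ^+ 2 = complex.Re z ^+ 2 + complex.Im z ^+ 2.
Proof. by case: z => a b /=; rewrite sqr_sqrtr// addr_ge0// sqr_ge0. Qed.

Lemma L2normsqE u : sqi mu D (re u) -> sqi mu D (im u) ->
  L2normsq mu D u = (inner_product mu D (re u) (re u) + inner_product mu D (im u) (im u))%:E.
Proof.
move=> s1 s2; rewrite EFinD -!ip_fin// -ge0_integralD//.
- by apply: eq_integral => x _; rewrite normc_sqr !expr2 EFinD.
- by move=> x _; rewrite lee_fin -expr2 sqr_ge0.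
- by apply/measurable_EFinP; apply: measurable_funM; case: s1.
- by move=> x _; rewrite lee_fin -expr2 sqr_ge0.
- by apply/measurable_EFinP; apply: measurable_funM; case: s2.
Qed.

Lemma L2P u : L2 mu D u <-> sqi mu D (re u) /\ sqi mu D (im u).
Proof.
split=> [[m1 m2 fin]|[s1 s2]]; last first.
  by split; [case: s1|case: s2|rewrite L2normsqE// ltry].
have msq (g : T -> R) : measurable_fun D g -> measurable_fun D (fun x => g x ^+ 2).
  by move=> mg; under eq_fun do rewrite expr2; exact: measurable_funM.
have mn : measurable_fun D (fun x => (ComplexField.Normc.normc (u x) ^+ 2)%:E).
  apply/measurable_EFinP; under eq_fun do rewrite normc_sqr.
  by apply: measurable_funD; exact: msq.
split; apply: sqi_of_lty => //; apply: le_lt_trans fin; apply: ge0_le_integral => //=.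
- by move=> x _; rewrite lee_fin sqr_ge0.
- by apply/measurable_EFinP; exact: msq.
- by move=> x _; rewrite lee_fin normc_sqr lerDl sqr_ge0.
- by move=> x _; rewrite lee_fin sqr_ge0.
- by apply/measurable_EFinP; exact: msq.
- by move=> x _; rewrite lee_fin normc_sqr lerDr sqr_ge0.
Qed.

Lemma Cintegral_mul u w : sqi mu D (re u) -> sqi mu D (im u) ->
  sqi mu D (re w) -> sqi mu D (im w) ->
  Cintegral mu D (fun x => u x * w x)
  = (inner_product mu D (re u) (re w) - inner_product mu D (im u) (im w))
    +i* (inner_product mu D (re u) (im w) + inner_product mu D (im u) (re w)).
Proof.
move=> u1 u2 w1 w2; rewrite !ipE /Cintegral -RintegralB -?RintegralD//; [|exact: sqiM..].
congr (_ +i* _); congr Rintegral; apply/funext => x; rewrite /re /im;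
  by case: (u x) (w x) => a b [a' b'].
Qed.

Lemma re_sub u w : re (fun x => u x - w x) = (fun x => re u x - re w x).
Proof. by apply/funext => x; rewrite /re; case: (u x) (w x) => a b [a' b']. Qed.

Lemma im_sub u w : im (fun x => u x - w x) = (fun x => im u x - im w x).
Proof. by apply/funext => x; rewrite /im; case: (u x) (w x) => a b [a' b']. Qed.

End ComplexL2.

Section WeakSolutions.
Context {R : realType}.
Variable D : set (R * R).

Let MR2 := (measurableTypeR R * measurableTypeR R)%type.
Hypothesis mD : measurable (D : set MR2).

Local Notation ipD := (inner_product (@area R) (D : set MR2)).
Local Notation sqA := (sqi (@area R) (D : set MR2)).
Implicit Types (U W : @jet R) (f g eta : R * R -> R) (u h phi : R * R -> R[i]).

(** [U] carries the first derivatives of a weak solution of - Delta w = f. *)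
Definition weak_sol U f := form_dom D U /\ forall eta, rtest D eta ->
  ipD U.1.2 ('D_e1 eta) + ipD U.2 ('D_e2 eta) = ipD f eta.

Lemma laplacian_test eta x : rtest D eta -> 
  laplacian (fun y => (eta y)%:C) x = ('D_e1 ('D_e1 eta) x + 'D_e2 ('D_e2 eta) x)%:C.
Proof.
move=> te; rewrite /laplacian /Cderive /=.
have z (v w : R * R) : 'D_v ('D_w (fun y => 0 : R)) x = 0.
  rewrite (_ : 'D_w _ = fun=> 0); first exact: derive_cst.
  by apply/funext => y; exact: derive_cst.
congr (_ +i* _).
by transitivity (0 + 0 : R); [congr (_ + _); exact: z|exact: addr0].
Qed.

Lemma form_dom_laplace U eta : form_dom D U -> rtest D eta ->
  ipD U.1.1 (fun x => 'D_e1 ('D_e1 eta) x + 'D_e2 ('D_e2 eta) x)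
  = - (ipD U.1.2 ('D_e1 eta) + ipD U.2 ('D_e2 eta)).
Proof.
move=> hU te; rewrite opprD.
have t1 := rtestD e1 te; have t2 := rtestD e2 te.
have s0 : sqA U.1.1 by case: (form_dom_sqj hU).
have s1 := cc_sqi mD (rtest_cc (rtestD e1 t1)).
have s2 := cc_sqi mD (rtest_cc (rtestD e2 t2)).
have [<- _] := ibp_form_dom mD hU t1; have [_ <-] := ibp_form_dom mD hU t2.
have -> : ipD U.1.1 (fun x => 'D_e1 ('D_e1 eta) x + 'D_e2 ('D_e2 eta) x)
  = ipD (fun x => 'D_e1 ('D_e1 eta) x + 'D_e2 ('D_e2 eta) x) U.1.1 by exact: ipC.
have -> := ipDl mD s1 s2 s0.
by congr (_ + _); exact: ipC.
Qed.

Lemma sq_test eta : rtest D eta ->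
  [/\ sqA eta, sqA ('D_e1 eta) & sqA ('D_e2 eta)].
Proof.
by move=> te; split; [exact: (cc_sqi mD (rtest_cc te))|exact: (cc_sqi mD (rtest_cc (rtestD e1 te)))|
  exact: (cc_sqi mD (rtest_cc (rtestD e2 te)))].
Qed.

Lemma weak_derivative_of U1 U2 u v : form_dom D U1 -> form_dom D U2 ->
  U1.1.1 = re u -> U2.1.1 = im u -> v = e1 \/ v = e2 ->
  weak_derivative D v u (fun x => (if v == e1 then U1.1.2 x else U1.2 x)
    +i* (if v == e1 then U2.1.2 x else U2.2 x)).
Proof.
move=> h1 h2 E1 E2 ve phi /test_functionP[t1 t2].
have [a0 a1 a2] := form_dom_sqj h1; have [b0 b1 b2] := form_dom_sqj h2.
rewrite E1 in a0; rewrite E2 in b0.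
have [p0 p1 p2] := sq_test t1; have [q0 q1 q2] := sq_test t2.
have [A1 A2] := ibp_form_dom mD h1 t1; have [A3 A4] := ibp_form_dom mD h1 t2.
have [B1 B2] := ibp_form_dom mD h2 t1; have [B3 B4] := ibp_form_dom mD h2 t2.
have ne : (e2 == e1 :> R * R) = false.
  by apply/negbTE/eqP => -[] /eqP; rewrite eq_sym oner_eq0.
rewrite E1 in A1 A2 A3 A4; rewrite E2 in B1 B2 B3 B4.
case: ve => -> {v}; rewrite ?eqxx ?ne.
- have -> := Cintegral_mul mD (u := u) (w := Cderive e1 phi) a0 b0 p1 q1.
  have -> := Cintegral_mul mD (u := fun x => U1.1.2 x +i* U2.1.2 x) (w := phi) a1 b1 p0 q0.
  rewrite -[LHS]/((_ - _) +i* (_ + _)).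
  have -> : inner_product area D (re u) (re (Cderive e1 phi)) = _ := A1.
  have -> : inner_product area D (re u) (im (Cderive e1 phi)) = _ := A3.
  have -> : inner_product area D (im u) (re (Cderive e1 phi)) = _ := B1.
  have -> : inner_product area D (im u) (im (Cderive e1 phi)) = _ := B3.
  by rewrite -[RHS]/(- (_ - _) +i* - (_ + _)); congr (_ +i* _); rewrite ?opprB ?opprD ?opprK addrC.
- have -> := Cintegral_mul mD (u := u) (w := Cderive e2 phi) a0 b0 p2 q2.
  have -> := Cintegral_mul mD (u := fun x => U1.2 x +i* U2.2 x) (w := phi) a2 b2 p0 q0.
  rewrite -[LHS]/((_ - _) +i* (_ + _)).
  have -> : inner_product area D (re u) (re (Cderive e2 phi)) = _ := A2.
  have -> : inner_product area D (re u) (im (Cderive e2 phi)) = _ := A4.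
  have -> : inner_product area D (im u) (re (Cderive e2 phi)) = _ := B2.
  have -> : inner_product area D (im u) (im (Cderive e2 phi)) = _ := B4.
  by rewrite -[RHS]/(- (_ - _) +i* - (_ + _)); congr (_ +i* _); rewrite ?opprB ?opprD ?opprK addrC.
Qed.

Lemma ipj_distE U eta : ipj D (U - jet_of eta) (U - jet_of eta)
  = ipD (fun x => U.1.1 x - eta x) (fun x => U.1.1 x - eta x)
  + ipD (fun x => U.1.2 x - 'D_e1 eta x) (fun x => U.1.2 x - 'D_e1 eta x)
  + ipD (fun x => U.2 x - 'D_e2 eta x) (fun x => U.2 x - 'D_e2 eta x).
Proof. by []. Qed.

Lemma L2normsq_dist u phi : L2 area D u -> L2 area D phi ->
  L2normsq area D (fun x => u x - phi x)
  = (ipD (fun x => re u x - re phi x) (fun x => re u x - re phi x)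
   + ipD (fun x => im u x - im phi x) (fun x => im u x - im phi x))%:E.
Proof.
move=> /(L2P _ mD)[u1 u2] /(L2P _ mD)[p1 p2].
have h := @L2normsqE _ _ _ (@area R) (D : set MR2) mD (fun x => u x - phi x).
rewrite re_sub im_sub in h; apply: h; exact: sqiB.
Qed.

Lemma Cintegral_real u eta : Cintegral (@area R) (D : set MR2) (fun x => u x * (eta x)%:C)
  = ipD (re u) eta +i* ipD (im u) eta.
Proof.
rewrite !ipE /Cintegral; congr (_ +i* _); congr Rintegral; apply/funext => x; rewrite /re /im;
  by case: (u x) => a b /=; rewrite ?mulr0 ?subr0 ?add0r.
Qed.

Lemma ipNl f g : sqA f -> sqA g -> ipD (fun x => - f x) g = - ipD f g.
Proof.
move=> sf sg; rewrite -mulN1r -ipZl//.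
by congr inner_product; apply/funext => x; rewrite mulN1r.
Qed.

Lemma re_opp u : re (fun x => - u x) = (fun x => - re u x).
Proof. by apply/funext => x; rewrite /re; case: (u x). Qed.

Lemma im_opp u : im (fun x => - u x) = (fun x => - im u x).
Proof. by apply/funext => x; rewrite /im; case: (u x). Qed.

Local Notation lap eta := (fun x => 'D_e1 ('D_e1 eta) x + 'D_e2 ('D_e2 eta) x).

Lemma sqi_lap eta : rtest D eta -> sqA (lap eta).
Proof.
move=> te; apply: (sqiD mD).
  exact: (cc_sqi mD (rtest_cc (rtestD e1 (rtestD e1 te)))).
exact: (cc_sqi mD (rtest_cc (rtestD e2 (rtestD e2 te)))).
Qed.

Lemma L2_test phi : test_function D phi ->
  [/\ L2 area D phi, L2 area D (Cderive e1 phi) & L2 area D (Cderive e2 phi)].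
Proof.
move=> /test_functionP[/sq_test[p0 p1 p2] /sq_test[q0 q1 q2]].
split; [exact: (L2P _ mD phi).2 (conj p0 q0)|exact: (L2P _ mD (Cderive e1 phi)).2 (conj p1 q1)|
  exact: (L2P _ mD (Cderive e2 phi)).2 (conj p2 q2)].
Qed.

Definition re_jet (u g1 g2 : R * R -> R[i]) : jet :=
  (re u : R * R -> R^o, re g1 : R * R -> R^o, re g2 : R * R -> R^o).

Definition im_jet (u g1 g2 : R * R -> R[i]) : jet :=
  (im u : R * R -> R^o, im g1 : R * R -> R^o, im g2 : R * R -> R^o).

Lemma H1_distE u (g1 g2 : R * R -> R[i]) phi : L2 area D u -> L2 area D g1 -> L2 area D g2 ->
  test_function D phi ->
  (L2normsq area D (fun x => (u x - phi x)%R)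
   + L2normsq area D (fun x => (g1 x - Cderive e1 phi x)%R)
   + L2normsq area D (fun x => (g2 x - Cderive e2 phi x)%R))%E
  = (ipj D (re_jet u g1 g2 - jet_of (re phi)) (re_jet u g1 g2 - jet_of (re phi))
     + ipj D (im_jet u g1 g2 - jet_of (im phi)) (im_jet u g1 g2 - jet_of (im phi)))%:E.
Proof.
move=> Lu Lg1 Lg2 /L2_test[L0 L1 L2'].
rewrite (L2normsq_dist Lu L0) (L2normsq_dist Lg1 L1) (L2normsq_dist Lg2 L2').
rewrite -!EFinD !ipj_distE; congr EFin.
by rewrite [RHS]addrACA; congr (_ + _); rewrite [RHS]addrACA.
Qed.

(** [dirichlet_forward] and [dirichlet_backward] translate the complex graph of the
    operator into two real weak equations in the form domain.  The jets consist of
    the function and of the gradient that witnesses membership in H^1_0; the weak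
    Laplacian becomes the Dirichlet form by one integration by parts. *)
Lemma dirichlet_forward u (f : R * R -> R[i]) : dirichlet_laplacian D u f ->
  L2 area D f /\ exists U1 U2, [/\ weak_sol U1 (re f), weak_sol U2 (im f),
    U1.1.1 = re u & U2.1.1 = im u].
Proof.
move=> [[Lu [g1 [g2 [[Lg1 _] [Lg2 _] apx]]]] Lf wl]; split=> //.
have [u1 u2] := (L2P _ mD u).1 Lu; have [f1 f2] := (L2P _ mD f).1 Lf.
have [g11 g12] := (L2P _ mD g1).1 Lg1; have [g21 g22] := (L2P _ mD g2).1 Lg2.
pose U1 := re_jet u g1 g2; pose U2 := im_jet u g1 g2.
have apx2 e : 0 < e -> exists2 phi, test_function D phi &
    ipj D (U1 - jet_of (re phi)) (U1 - jet_of (re phi))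
    + ipj D (U2 - jet_of (im phi)) (U2 - jet_of (im phi)) < e.
  move=> e0; have [phi tphi h] := apx e e0.
  by exists phi => //; rewrite -lte_fin -(H1_distE Lu Lg1 Lg2 tphi).
have H1 : form_dom D U1.
  split; first by split.
  move=> e e0; have [phi tphi h] := apx2 e e0.
  have [t1 t2] := (test_functionP D phi).1 tphi.
  exists (jet_of (re phi)); first by exists (re phi).
  by apply: le_lt_trans h; rewrite lerDl; exact: ipj_ge0.
have H2 : form_dom D U2.
  split; first by split.
  move=> e e0; have [phi tphi h] := apx2 e e0.
  have [t1 t2] := (test_functionP D phi).1 tphi.
  exists (jet_of (im phi)); first by exists (im phi).
  by apply: le_lt_trans h; rewrite lerDr; exact: ipj_ge0.
have key eta : rtest D eta ->
    ipD U1.1.1 (lap eta) = - ipD (re f) eta /\ ipD U2.1.1 (lap eta) = - ipD (im f) eta.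
  move=> te; have s0 : sqA eta := cc_sqi mD (rtest_cc te).
  have := wl _ (rtest_test te).
  rewrite (_ : (fun x => u x * _) = fun x => u x * (lap eta x)%:C); last first.
    by apply/funext => x; congr (_ * _); exact: (laplacian_test x te).
  have -> := Cintegral_real u (lap eta).
  have -> := Cintegral_real (fun x => - f x) eta.
  by rewrite re_opp im_opp (ipNl f1 s0) (ipNl f2 s0) => -[].
exists U1, U2; split=> //; split=> // eta te.
- have [+ _] := key eta te; have -> := form_dom_laplace H1 te.
  by move/oppr_inj.
- have [_] := key eta te; have -> := form_dom_laplace H2 te.
  by move/oppr_inj.
Qed.

Lemma dirichlet_backward u (f : R * R -> R[i]) U1 U2 : L2 area D f ->
  weak_sol U1 (re f) -> weak_sol U2 (im f) -> U1.1.1 = re u -> U2.1.1 = im u ->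
  dirichlet_laplacian D u f.
Proof.
move=> Lf [H1 W1] [H2 W2] E1 E2.
have [f1 f2] := (L2P _ mD f).1 Lf.
have [a0 a1 a2] := form_dom_sqj H1; have [b0 b1 b2] := form_dom_sqj H2.
have Lu : L2 area D u.
  by apply/(L2P _ mD); split; [rewrite -[re _]E1|rewrite -[im _]E2].
have ne : (e2 == e1 :> R * R) = false.
  by apply/negbTE/eqP => -[] /eqP; rewrite eq_sym oner_eq0.
split=> //.
- split=> //.
  exists (fun x => U1.1.2 x +i* U2.1.2 x), (fun x => U1.2 x +i* U2.2 x).
  have Lg1 : L2 area D (fun x => U1.1.2 x +i* U2.1.2 x) by apply/(L2P _ mD); split.
  have Lg2 : L2 area D (fun x => U1.2 x +i* U2.2 x) by apply/(L2P _ mD); split.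
  split.
  + split=> //; have := @weak_derivative_of U1 U2 u e1 H1 H2 E1 E2 (or_introl erefl).
    by rewrite eqxx.
  + split=> //; have := @weak_derivative_of U1 U2 u e2 H1 H2 E1 E2 (or_intror erefl).
    by rewrite ne.
  + move=> e e0; have e2' : 0 < e / 2 by lra.
    have [_ [eta1 t1 ->] h1] := proj2 H1 _ e2'.
    have [_ [eta2 t2 ->] h2] := proj2 H2 _ e2'.
    pose phi x := eta1 x +i* eta2 x.
    have tphi : test_function D phi by apply/test_functionP; split.
    exists phi => //.
    have -> := H1_distE Lu Lg1 Lg2 tphi.
    rewrite lte_fin; apply: (@le_lt_trans _ _
      (ipj D (U1 - jet_of eta1) (U1 - jet_of eta1) + ipj D (U2 - jet_of eta2) (U2 - jet_of eta2))); last by lra.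
    by rewrite !ipj_distE E1 E2.
- move=> phi /test_functionP[t1 t2].
  have [p0 p1 p2] := sq_test t1; have [q0 q1 q2] := sq_test t2.
  rewrite E1 in a0; rewrite E2 in b0.
  have -> := Cintegral_mul mD (u := u) (w := laplacian phi) a0 b0 (sqi_lap t1) (sqi_lap t2).
  have sNN g : sqA g -> sqA (fun x => - g x).
    by move=> sg; have := sqiZ mD (-1) sg; congr sqi; apply/funext => x; rewrite mulN1r.
  have fN1 : sqA (re (fun x => - f x)) by rewrite re_opp; exact: sNN.
  have fN2 : sqA (im (fun x => - f x)) by rewrite im_opp; exact: sNN.
  have -> := Cintegral_mul (mu := @area R) mD (u := fun x => - f x) (w := phi) fN1 fN2 p0 q0.
  rewrite re_opp im_opp.
  have -> := ipNl f1 p0; have -> := ipNl f1 q0; have -> := ipNl f2 p0; have -> := ipNl f2 q0.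
  have K1 eta : rtest D eta -> ipD (re u) (lap eta) = - ipD (re f) eta.
    by move=> te; rewrite -W1// -form_dom_laplace// E1.
  have K2 eta : rtest D eta -> ipD (im u) (lap eta) = - ipD (im f) eta.
    by move=> te; rewrite -W2// -form_dom_laplace// E2.
  congr (_ +i* _); congr (_ + _); [exact: K1|congr (- _); exact: K2|exact: K1|exact: K2].
Qed.

End WeakSolutions.

(** * Smooth cut-off functions *)

Section Flat.
Context {R : realType}.
Implicit Types (p q : {poly R}) (t x : R).

Lemma pow_le_expR (n : nat) : exists2 C : R, 0 <= C & forall x, 0 <= x -> x ^+ n <= C * expR x.
Proof.
case: n => [|n]; first by exists 1 => // x x0; rewrite mul1r expr0; have := expR_ge1Dx x; lra.
have n0 : (0 : R) < n.+1%:R by rewrite ltr0n.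
exists (n.+1%:R ^+ n.+1) => [|x x0]; first by rewrite exprn_ge0// ltW.
have -> : expR x = expR (x / n.+1%:R) ^+ n.+1 by rewrite -expRM_natl mulrC divfK// gt_eqF.
rewrite -exprMn; apply: lerXn2r; rewrite ?nnegrE ?mulr_ge0 ?expR_ge0 ?(ltW n0)//.
have h := expR_ge1Dx (x / n.+1%:R).
have : n.+1%:R * (1 + x / n.+1%:R) <= n.+1%:R * expR (x / n.+1%:R) by rewrite ler_wpM2l// ltW.
apply: le_trans; rewrite mulrDr mulr1 mulrC divfK ?gt_eqF// lerDr ltW//.
Qed.

Lemma poly_le_expR p : exists2 C : R, 0 <= C & forall x, 0 <= x -> `|p.[x]| <= C * expR x.
Proof.
have /choice[C CP] n : exists C : R, 0 <= C /\ forall x, 0 <= x -> x ^+ n <= C * expR x.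
  by have [C C0 CP] := pow_le_expR n; exists C.
exists (\sum_(i < size p) `|p`_i| * C i).
  by apply: sumr_ge0 => i _; rewrite mulr_ge0//; case: (CP i).
move=> x x0; rewrite horner_coef mulr_suml; apply: le_trans (ler_norm_sum _ _ _) _.
apply: ler_sum => i _; rewrite normrM -mulrA ler_wpM2l//.
by rewrite ger0_norm ?exprn_ge0//; case: (CP i) => _; apply.
Qed.

(** The functions p(1/t) exp(-1/t) for t > 0, extended by 0: they form a family
    closed under differentiation, so each of them is smooth. *)
Definition flat p t : R := if 0 < t then p.[t^-1] * expR (- t^-1) else 0.

Definition flat_next p : {poly R} := 'X ^+ 2 * (p - p^`()).

(** Used where the two branches of [flat] meet. *)
Lemma is_derive_quadratic (f : R -> R) x (C : R) :
  (forall h, `|f (h + x) - f x| <= C * h ^+ 2) -> is_derive x 1 f 0.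
Proof.
move=> H.
have K (c : R) : (fun h : R => c * `|h|) @ 0^' --> (0 : R).
  have : (fun h : R => c * `|h|) @ nbhs (0 : R) --> c * `|0 : R|.
    by apply: cvgMr; exact: norm_continuous.
  by rewrite normr0 mulr0 => /cvg_within_filter; apply.
have : (fun h : R => h^-1 *: (f (h *: 1 + x) - f x)) @ 0^' --> (0 : R).
  apply: (@squeeze_cvgr _ _ _ _ (fun h => - C * `|h|) (fun h => C * `|h|)); [|exact: K..].
  near=> h; have h0 : h != 0 by near: h; exact: nbhs_dnbhs_neq.
  rewrite mulNr -ler_norml [_ *: _]mulrC normrM normfV ler_pdivrMr ?normr_gt0//.
  rewrite [h *: 1]mulr1; apply: le_trans (H h) _.
  by rewrite -mulrA -expr2 real_normK ?num_real.
move=> L; split; first by apply/cvg_ex; exists 0.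
exact/cvg_lim.
Unshelve. all: by end_near. Qed.

Lemma is_derive_flat p t : is_derive t 1 (flat p) (flat (flat_next p) t).
Proof.
have [t0|t0|<-] := ltgtP 0 t.
- pose g s : R := p.[s^-1] * expR (- s^-1).
  have tn : t != 0 by rewrite gt_eqF.
  have dinv : is_derive t 1 (fun s : R => s^-1) (- t ^- 2 *: 1) by exact: is_deriveV.
  have dp : is_derive t 1 (horner p \o (fun s => s^-1)) (p^`().[t^-1] * (- t ^- 2 *: 1)).
    exact: is_derive1_comp.
  have de : is_derive t 1 (expR \o (fun s => - s^-1)) (expR (- t^-1) * - (- t ^- 2 *: 1)).
    exact: is_derive1_comp.
  have dg : is_derive t 1 g (flat (flat_next p) t).
    apply: (is_derive_eq (is_deriveM dp de)).
    rewrite /flat t0 /flat_next !hornerE /= -[X in X + _]mulrC /GRing.scale /= exprVn.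
    by ring.
  apply: near_eq_is_derive dg; near=> s; rewrite /flat /g ifT//.
  by near: s; exact: lt_nbhsr.
- have -> : flat (flat_next p) t = 0 by rewrite /flat ltNge (ltW t0).
  have d0 : is_derive t 1 (cst 0 : R -> R) (0 : R) by exact: is_derive_cst.
  apply: near_eq_is_derive d0; near=> s; rewrite /flat ltNge ltW//.
  by near: s; exact: lt_nbhsl.
- have -> : flat (flat_next p) 0 = 0 by rewrite /flat ltxx.
  have [C C0 CP] := poly_le_expR ('X ^+ 2 * p).
  apply: (@is_derive_quadratic _ _ C) => h; rewrite addr0 /flat ltxx subr0.
  case: ifPn => [h0|_]; last by rewrite normr0 mulr_ge0// sqr_ge0.
  have hi0 : 0 <= h^-1 by rewrite invr_ge0 ltW.
  have := CP _ hi0; rewrite !hornerE normrM normrX (ger0_norm hi0) normrM.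
  rewrite (ger0_norm (expR_ge0 _)) expRN => H.
  rewrite ler_pdivrMr ?expR_gt0//.
  have := ler_wpM2l (sqr_ge0 h) H.
  rewrite mulrA exprVn divff ?mul1r; last by rewrite gt_eqF ?exprn_gt0.
  by rewrite mulrCA expr2 !mulrA.
Unshelve. all: by end_near. Qed.

End Flat.

Section SmoothFunctions.
Context {R : realType} {V : normedModType R}.
Implicit Types (f g : V -> R) (x v : V).

(** A class of explicit functions that is visibly stable under directional
    derivatives, so that membership gives smoothness. *)
Inductive elem_smooth : (V -> R) -> Prop :=
| es_affine f (c : V -> R) : (forall x, differentiable f x) ->
    (forall v x, 'D_v f x = c v) -> elem_smooth f
| es_add f g : elem_smooth f -> elem_smooth g -> elem_smooth (fun x => f x + g x)
| es_mul f g : elem_smooth f -> elem_smooth g -> elem_smooth (fun x => f x * g x)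
| es_flat p f : elem_smooth f -> elem_smooth (fun x => flat p (f x))
| es_sin f : elem_smooth f -> elem_smooth (fun x => sin (f x))
| es_cos f : elem_smooth f -> elem_smooth (fun x => cos (f x))
| es_inv f : (forall x, f x != 0) -> elem_smooth f -> elem_smooth (fun x => (f x)^-1).

Lemma es_cst (c : R) : elem_smooth (fun=> c).
Proof.
by apply: (@es_affine _ (fun=> 0)) => [x|v x]; [exact: differentiable_cst|exact: derive_cst].
Qed.

Lemma derive_comp (h : R -> R) (d : R) f v x : is_derive (f x) 1 h d ->
  differentiable f x ->
  differentiable (fun y => h (f y)) x /\ 'D_v (fun y => h (f y)) x = d * 'D_v f x.
Proof.
move=> [dh hd] df.
have dh' : differentiable h (f x) by exact/derivable1_diffP.
have dc : differentiable (h \o f) x by exact: differentiable_comp.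
split=> //; rewrite (deriveE v dc) (diff_comp df dh') /= (diff1E dh') (deriveE v df).
by rewrite derive1E hd mulrC.
Qed.

Lemma elem_smooth_derive f : elem_smooth f ->
  (forall x, differentiable f x) /\ (forall v, elem_smooth ('D_v f)).
Proof.
elim=> {f} [f c df dc|f g _ [df ef] _ [dg eg]|f g sf [df ef] sg [dg eg]|p f sf [df ef]|f sf [df ef]|f sf [df ef]|f f0 sf [df ef]].
- split=> // v; have -> : 'D_v f = fun=> c v by apply/funext => x; exact: dc.
  exact: es_cst.
- split=> [x|v]; first exact: (differentiableD (df x) (dg x)).
  have -> : 'D_v (fun x => f x + g x) = fun x => 'D_v f x + 'D_v g x.
    by apply/funext => x; exact: (deriveD (@diff_derivable _ _ _ f x v (df x)) (@diff_derivable _ _ _ g x v (dg x))).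
  exact: es_add.
- split=> [x|v]; first exact: (differentiableM (df x) (dg x)).
  have -> : 'D_v (fun x => f x * g x) = fun x => f x * 'D_v g x + g x * 'D_v f x.
    by apply/funext => x; exact: (deriveM (@diff_derivable _ _ _ f x v (df x)) (@diff_derivable _ _ _ g x v (dg x))).
  by apply: es_add; exact: es_mul.
- have H v x := derive_comp v (is_derive_flat p (f x)) (df x).
  split=> [x|v]; first by case: (H 0 x).
  have -> : 'D_v (fun x => flat p (f x)) = fun x => flat (flat_next p) (f x) * 'D_v f x.
    by apply/funext => x; case: (H v x).
  by apply: es_mul => //; exact: es_flat.
- have H v x := derive_comp v (is_derive_sin (f x)) (df x).
  split=> [x|v]; first by case: (H 0 x).
  have -> : 'D_v (fun x => sin (f x)) = fun x => cos (f x) * 'D_v f x.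
    by apply/funext => x; case: (H v x).
  by apply: es_mul => //; exact: es_cos.
- have H v x := derive_comp v (is_derive_cos (f x)) (df x).
  split=> [x|v]; first by case: (H 0 x).
  have -> : 'D_v (fun x => cos (f x)) = fun x => (-1 * sin (f x)) * 'D_v f x.
    by apply/funext => x; case: (H v x) => _ ->; rewrite mulN1r.
  by apply: es_mul => //; apply: es_mul; [exact: es_cst|exact: es_sin].
- have di (y : R) : y != 0 -> is_derive y 1 (fun s : R => s^-1) (- y ^- 2).
    move=> y0; have dy : is_derive y 1 (fun s : R => s^-1) (- y ^- 2 *: 1) by exact: is_deriveV.
    by apply: (is_derive_eq dy); rewrite [_ *: _]mulr1.
  have H v x := derive_comp v (di (f x) (f0 x)) (df x).
  split=> [x|v]; first by case: (H 0 x).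
  have -> : 'D_v (fun x => (f x)^-1) = fun x => (-1 * ((f x)^-1 * (f x)^-1)) * 'D_v f x.
    by apply/funext => x; case: (H v x) => _ ->; rewrite mulN1r -invfM -expr2.
  by apply: es_mul => //; apply: es_mul; [exact: es_cst|apply: es_mul; exact: es_inv].
Qed.

Lemma elem_smooth_all f (vs : seq V) x : elem_smooth f ->
  differentiable (foldr (fun v h => 'D_v h) f vs) x.
Proof.
move=> sf; suff : elem_smooth (foldr (fun v h => 'D_v h) f vs).
  by case/elem_smooth_derive.
by elim: vs => //= v vs /elem_smooth_derive[].
Qed.

Lemma elem_smooth_continuous f : elem_smooth f -> continuous f.
Proof. by move=> /elem_smooth_derive[df _] x; exact: differentiable_continuous. Qed.

End SmoothFunctions.

Section Step.
Context {R : realType}.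
Implicit Types t : R.

(** A smooth step from 0 on the negative axis to 1 beyond 1. *)
Definition step t : R := flat 1 t * (flat 1 t + flat 1 (1 - t))^-1.

Lemma flat1_ge0 t : 0 <= flat 1 t.
Proof. by rewrite /flat; case: ifP => // _; rewrite hornerC mul1r expR_ge0. Qed.

Lemma step_den_gt0 t : 0 < flat 1 t + flat 1 (1 - t).
Proof.
have [t0|t0] := ltP 0 t.
  by apply: ltr_wpDr; [exact: flat1_ge0|rewrite /flat t0 hornerC mul1r expR_gt0].
apply: ltr_wpDl; first exact: flat1_ge0.
by rewrite /flat ifT ?hornerC ?mul1r ?expR_gt0// subr_gt0; lra.
Qed.

Lemma step_eq0 t : t <= 0 -> step t = 0.
Proof. by move=> t0; rewrite /step /flat ltNge t0 mul0r. Qed.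

Lemma step_eq1 t : 1 <= t -> step t = 1.
Proof.
move=> t1; rewrite /step; have := step_den_gt0 t.
have -> : flat 1 (1 - t) = 0 by rewrite /flat subr_gt0 ltNge t1.
by rewrite addr0 => h; rewrite divff// gt_eqF.
Qed.

Lemma step_ge0 t : 0 <= step t.
Proof. by rewrite mulr_ge0 ?flat1_ge0// invr_ge0 ltW// step_den_gt0. Qed.

Lemma step_le1 t : step t <= 1.
Proof. by rewrite /step ler_pdivrMr ?step_den_gt0// mul1r lerDl flat1_ge0. Qed.

Lemma elem_smooth_step (V : normedModType R) (f : V -> R) :
  elem_smooth f -> elem_smooth (fun x => step (f x)).
Proof.
move=> sf; apply: es_mul; first exact: es_flat.
apply: es_inv => [x|]; first by rewrite gt_eqF ?step_den_gt0.
apply: es_add; first exact: es_flat.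
apply: es_flat; apply: es_add; first exact: es_cst.
have -> : (fun x => - f x) = fun x => -1 * f x by apply/funext => x; rewrite mulN1r.
by apply: es_mul => //; exact: es_cst.
Qed.

Lemma elem_smooth_id : elem_smooth (id : R -> R).
Proof.
apply: (@es_affine _ _ _ id) => [x|v x]; last exact: derive_id.
by apply/derivable1_diffP; exact: derivable_id.
Qed.

Lemma step_smooth : elem_smooth step.
Proof. exact: elem_smooth_step elem_smooth_id. Qed.

Definition dstep t : R := 'D_1 step t.

Lemma is_derive_step t : is_derive t 1 step (dstep t).
Proof.
by have [ds _] := elem_smooth_derive step_smooth; apply/derivableP/diff_derivable.
Qed.

Lemma dstep_smooth : elem_smooth dstep.
Proof. by have [_ ds] := elem_smooth_derive step_smooth; exact: ds. Qed.

Lemma near_eq_cst_derive0 (f : R -> R) (c t : R) :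
  (\forall s \near t, f s = c) -> 'D_1 f t = 0.
Proof.
move=> H; have d0 : is_derive t 1 (cst c : R -> R) (0 : R) by exact: is_derive_cst.
have : is_derive t 1 f 0 by apply: near_eq_is_derive d0; apply: filterS H => s ->.
by move=> [].
Qed.

Lemma dstep_out t : t < 0 \/ 1 < t -> dstep t = 0.
Proof.
move=> [t0|t1].
  apply: (near_eq_cst_derive0 (c := 0)); near=> s; apply: step_eq0; apply: ltW.
  by near: s; exact: lt_nbhsl.
apply: (near_eq_cst_derive0 (c := 1)); near=> s; apply: step_eq1; apply: ltW.
by near: s; exact: lt_nbhsr.
Unshelve. all: by end_near. Qed.

Lemma dstep_bounded : exists2 C : R, 0 <= C & forall t, `|dstep t| <= C.
Proof.
apply: cc1_bounded; split; first exact: elem_smooth_continuous dstep_smooth.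
exists 1 => t t1; apply: dstep_out; have [t0|t0] := ltP t 0; [by left|right].
by rewrite ger0_norm in t1.
Qed.

End Step.

(** * The energy of a function in the arms of the guide *)

Section Guide.
Context {R : realType}.
Variable theta : R.
Hypothesis theta_gt0 : 0 < theta.
Hypothesis theta_lt : theta < pi / 2.
Implicit Types (x y v : R * R) (sg : R).

Local Notation c := (cos theta).
Local Notation s := (sin theta).

Lemma guide_cos_gt0 : 0 < c.
Proof.
apply: cos_gt0_pihalf; rewrite theta_lt andbT; apply: lt_trans theta_gt0.
by rewrite oppr_lt0 divr_gt0// pi_gt0.
Qed.

Lemma guide_sin_gt0 : 0 < s.
Proof.
apply: sin_gt0_pi; rewrite theta_gt0 /=; apply: lt_trans theta_lt _.
by rewrite ltr_pdivrMr// ltr_pMr ?pi_gt0// ltr1n.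
Qed.

Lemma guideP x : broken_guide theta x <-> 0 < - x.1 * s + `|x.2| * c < pi.
Proof.
have c0 := guide_cos_gt0; have s0 := guide_sin_gt0.
rewrite /broken_guide /= /tan.
have -> : x.1 * (s / c) = x.1 * s / c by rewrite mulrA.
have -> : (x.1 + pi / s) * (s / c) = (x.1 * s + pi) / c by field; rewrite !gt_eqF.
rewrite ltr_pdivrMr// ltr_pdivlMr//.
by split=> /andP[h1 h2]; apply/andP; split; lra.
Qed.

Lemma guide_bounds x : broken_guide theta x -> 0 < - x.1 * s + `|x.2| * c /\ - x.1 * s + `|x.2| * c < pi.
Proof. by move=> /guideP/andP. Qed.

Lemma guide_open : open (broken_guide theta).
Proof.
have -> : broken_guide theta = (fun x : R * R => - x.1 * s + `|x.2| * c) @^-1` `]0, pi[.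
  by apply/seteqP; split=> x; [move/guideP|move=> h; apply/guideP; move: h]; rewrite /= in_itv.
apply: open_comp; last exact: interval_open.
move=> x _; apply: cvgD; apply: cvgMl; last first.
  by apply: cvg_norm; exact: cvg_snd.
by apply: cvgN; exact: cvg_fst.
Qed.

Lemma fst_differentiable x : differentiable (fst : R * R -> R) x.
Proof.
by apply: (@linear_differentiable R (R * R)%type R (fst : {linear (R * R)%type -> R})) => y; exact: cvg_fst.
Qed.

Lemma snd_differentiable x : differentiable (snd : R * R -> R) x.
Proof.
by apply: (@linear_differentiable R (R * R)%type R (snd : {linear (R * R)%type -> R})) => y; exact: cvg_snd.
Qed.

Lemma derive_fst v x : 'D_v (fst : R * R -> R) x = v.1.
Proof.
rewrite (deriveE v (fst_differentiable x)).
rewrite (@diff_lin R (R * R)%type R (fst : {linear (R * R)%type -> R}))// => y; exact: cvg_fst.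
Qed.

Lemma derive_snd v x : 'D_v (snd : R * R -> R) x = v.2.
Proof.
rewrite (deriveE v (snd_differentiable x)).
rewrite (@diff_lin R (R * R)%type R (snd : {linear (R * R)%type -> R}))// => y; exact: cvg_snd.
Qed.

Lemma linear_form_derive (a b : R) v x :
  differentiable (fun y : R * R => a * y.1 + b * y.2) x /\
  'D_v (fun y : R * R => a * y.1 + b * y.2) x = a * v.1 + b * v.2.
Proof.
split; first exact: (differentiable_lin a b (fst_differentiable x) (snd_differentiable x)).
have := derive_lin a b v (fst_differentiable x) (snd_differentiable x).
by rewrite derive_fst derive_snd.
Qed.

(** Signed rotated coordinates: along the upper ([sg] = 1) or lower ([sg] = -1)
    arm, and across it. *)
Definition along sg x : R := c * x.1 + sg * s * x.2.
Definition across sg x : R := - s * x.1 + sg * c * x.2.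

(** The field is a cut-off of the logarithmic gradient of sin(across), the
    transversal ground state; [arm_slope a b] is its derivative in a direction
    along which [along] and [across] grow at the rates [a] and [b]. *)
Definition arm_field sg x : R :=
  if 0 < sg * x.2 then step (along sg x) * (cos (across sg x) / sin (across sg x)) else 0.

Definition arm_slope sg (a b : R) x : R :=
  if 0 < sg * x.2 then dstep (along sg x) * a * (cos (across sg x) / sin (across sg x))
     - step (along sg x) * b / sin (across sg x) ^+ 2
  else 0.

Lemma sign_norm sg x : sg = 1 \/ sg = -1 -> 0 < sg * x.2 -> `|x.2| = sg * x.2.
Proof.
by case=> ->; rewrite ?mul1r ?mulN1r => h; [rewrite gtr0_norm|rewrite ltr0_norm// -oppr_gt0].
Qed.

Lemma continuous_linear (a b : R) : continuous (fun y : R * R => a * y.1 + b * y.2).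
Proof. by move=> x; apply: differentiable_continuous; case: (linear_form_derive a b 0 x). Qed.

Lemma cot_derive (y : R) : sin y != 0 ->
  is_derive y 1 (fun z : R => cos z / sin z) (- (sin y ^+ 2)^-1).
Proof.
move=> sy.
have dv : is_derive y 1 (fun z : R => (sin z)^-1) (- sin y ^- 2 *: cos y) by exact: is_deriveV.
apply: (is_derive_eq (is_deriveM (is_derive_cos y) dv)).
rewrite /GRing.scale /=; have := cos2Dsin2 y => E.
have -> : cos y * (- sin y ^- 2 * cos y) + (sin y)^-1 * - sin y
   = - ((cos y ^+ 2 + sin y ^+ 2) / sin y ^+ 2) by field.
by rewrite E mul1r.
Qed.

Lemma arm_field_local sg v x : sg = 1 \/ sg = -1 -> broken_guide theta x ->
  [/\ is_derive x v (arm_field sg) (arm_slope sg (along sg v) (across sg v) x),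
     {for x, continuous (arm_field sg)} &
     {for x, continuous (arm_slope sg (along sg v) (across sg v))}].
Proof.
move=> sgP xD.
have c0 := guide_cos_gt0; have s0 := guide_sin_gt0.
have [t0 t1] := guide_bounds xD.
have csg : continuous (fun y : R * R => sg * y.2).
  by move=> y; apply: cvgMr; exact: cvg_snd.
have cal : continuous (along sg) by exact: continuous_linear.
have cac : continuous (across sg) by exact: continuous_linear.
have [sx|sx] := ltP 0 (sg * x.2).
- have xn := sign_norm sgP sx.
  have sin0 : sin (across sg x) != 0.
    rewrite gt_eqF// sin_gt0_pi// /across; apply/andP; split; move: t0 t1; rewrite xn; lra.
  have nearp : \forall y \near x, 0 < sg * y.2.
    exact: (cvgr_gt _ (csg x) _ sx).
  have [dal eal] : differentiable (along sg) x /\ 'D_v (along sg) x = along sg v := linear_form_derive c (sg * s) v x.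
  have [dac eac] : differentiable (across sg) x /\ 'D_v (across sg) x = across sg v := linear_form_derive (- s) (sg * c) v x.
  have [d1 D1] := derive_comp v (is_derive_step (along sg x)) dal.
  have [d2 D2] := derive_comp v (cot_derive sin0) dac.
  have d3 := differentiableM d1 d2.
  have e1' : \forall y \near x, step (along sg y) * (cos (across sg y) / sin (across sg y)) = arm_field sg y.
    by near=> y; rewrite /arm_field ifT//; near: y.
  split.
  + apply: (near_eq_is_derive e1').
    have := is_deriveM (derivableP (@diff_derivable _ _ _ _ x v d1)) (derivableP (@diff_derivable _ _ _ _ x v d2)).
    move=> H; apply: (is_derive_eq H); rewrite D1 D2 /arm_slope sx eal eac /GRing.scale /=.
    by field.
  + rewrite /prop_for /continuous_at /arm_field sx.
    have := differentiable_continuous d3; apply: cvg_trans; apply: near_eq_cvg.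
    by near=> y; rewrite /= ifT//; near: y.
  + rewrite /prop_for /continuous_at {2}/arm_slope sx.
    have cdst : {for x, continuous (fun y => dstep (along sg y))}.
      by apply: continuous_comp; [exact: cal|exact: (elem_smooth_continuous dstep_smooth)].
    have cst_ : {for x, continuous (fun y => step (along sg y))}.
      by apply: continuous_comp; [exact: cal|exact: (elem_smooth_continuous step_smooth)].
    have csin : {for x, continuous (fun y => sin (across sg y))}.
      by apply: continuous_comp; [exact: cac|exact: continuous_sin].
    have ccos : {for x, continuous (fun y => cos (across sg y))}.
      by apply: continuous_comp; [exact: cac|exact: continuous_cos].
    have L : (fun y => dstep (along sg y) * along sg v * (cos (across sg y) / sin (across sg y))
     - step (along sg y) * across sg v / sin (across sg y) ^+ 2) @ x -->
     dstep (along sg x) * along sg v * (cos (across sg x) / sin (across sg x))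
     - step (along sg x) * across sg v / sin (across sg x) ^+ 2.
      apply: cvgB; apply: cvgM.
      * by apply: cvgMl; exact: cdst.
      * by apply: cvgM => //; exact: cvgV.
      * by apply: cvgMl; exact: cst_.
      * apply: cvgV; first by rewrite sqrf_eq0.
        rewrite (_ : (fun y => _) = fun y => sin (across sg y) * sin (across sg y)); last first.
          by apply/funext => y; rewrite expr2.
        by rewrite expr2; apply: cvgM.
    apply: cvg_trans L; apply: near_eq_cvg.
    by near=> y; rewrite /arm_slope ifT//; near: y.
- have z0 : \forall y \near x, arm_field sg y = 0 /\ arm_slope sg (along sg v) (across sg v) y = 0.
    have [sx'|sx'] := ltP (sg * x.2) 0.
      near=> y; have sy : sg * y.2 < 0 by near: y; exact: (cvgr_lt _ (csg x) _ sx').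
      by rewrite /arm_field /arm_slope ltNge ltW.
    have x20 : x.2 = 0.
      by have : sg * x.2 = 0 by [lra]; case: sgP => ->; lra.
    have al0 : along sg x < 0.
      rewrite /along x20; move: t0; rewrite x20 normr0; nra.
    near=> y; rewrite /arm_field /arm_slope.
    have yl : along sg y < 0 by near: y; exact: (cvgr_lt _ (cal x) _ al0).
    rewrite (step_eq0 (ltW yl)) (dstep_out (or_introl yl)) !mul0r subr0.
    by case: ifP.
  have zx := nbhs_singleton z0.
  have d0 : is_derive x v (cst 0 : R * R -> R) (0 : R) by exact: is_derive_cst.
  split.
  + rewrite zx.2; apply: near_eq_is_derive d0.
    by apply: filterS z0 => y [-> _].
  + rewrite /prop_for /continuous_at zx.1.
    have L : (fun _ : R * R => 0 : R) @ x --> (0 : R) by exact: cvg_cst.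
    apply: cvg_trans L; apply: near_eq_cvg.
    by apply: filterS z0 => y [-> _].
  + rewrite /prop_for /continuous_at zx.2.
    have L : (fun _ : R * R => 0 : R) @ x --> (0 : R) by exact: cvg_cst.
    apply: cvg_trans L; apply: near_eq_cvg.
    by apply: filterS z0 => y [_ ->].
Unshelve. all: by end_near. Qed.

Let D := broken_guide theta.
Let MR2 := (measurableTypeR R * measurableTypeR R)%type.

Lemma guide_measurable : measurable (D : set MR2).
Proof. exact: open_measurable2 guide_open. Qed.

(** The arm field is singular at the walls, so it is regular only inside the guide;
    [f ^ 2 Y] nevertheless extends smoothly by 0, because [f] vanishes near the
    walls. *)
Lemma rtest_mul_local (f : R * R -> R) v (Y dY : R * R -> R) : rtest D f ->
  (forall x, D x -> [/\ is_derive x v Y (dY x), {for x, continuous Y} & {for x, continuous dY}]) ->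
  [/\ forall x, is_derive x v (fun y => f y ^+ 2 * Y y) (2 * f x * 'D_v f x * Y x + f x ^+ 2 * dY x),
     cc (fun x => f x ^+ 2 * Y x) &
     cc (fun x => 2 * f x * 'D_v f x * Y x + f x ^+ 2 * dY x)].
Proof.
move=> tf HY; have [sf [K [cK KD fK]]] := tf.
have [cf [M fM]] := rtest_cc tf.
have cdf := rtest_continuous (rtestD v tf).
have nearK x : ~ K x -> \forall y \near x, f y = 0.
  move=> nKx; have oK : open (~` K) by apply: closed_openC; exact: compact_closed plane_hausdorff cK.
  have : nbhs x (~` K) by rewrite nbhsE; exists (~` K).
  by apply: filterS => y /fK.
have loc (g : R * R -> R) : (forall x, D x -> {for x, continuous g}) ->
    (forall x, f x = 0 -> g x = 0) -> cc g.
  move=> gD g0; split; last by exists M => x /fM /g0.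
  move=> x; have [Kx|nKx] := pselect (K x); first exact/gD/KD.
  rewrite /continuous_at (g0 x (fK x nKx)).
  have L : (fun _ : R * R => 0 : R) @ x --> (0 : R) by exact: cvg_cst.
  apply: cvg_trans L; apply: near_eq_cvg.
  by apply: filterS (nearK x nKx) => y /g0.
have E : (fun y => f y ^+ 2 * Y y) = (fun y => f y * f y * Y y) by apply/funext => y; rewrite expr2.
split.
- move=> x; have [Kx|nKx] := pselect (K x).
    have [dYx _ _] := HY x (KD x Kx); have dfx := rtest_derive v x tf.
    rewrite E; apply: (is_derive_eq (is_deriveM (is_deriveM dfx dfx) dYx)).
    by rewrite -[(f * f) x]/(f x * f x) /GRing.scale /=; ring.
  rewrite (fK x nKx) mulr0 !mul0r expr2 !mul0r addr0.
  have d0 : is_derive x v (cst 0 : R * R -> R) (0 : R) by exact: is_derive_cst.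
  apply: near_eq_is_derive d0; apply: filterS (nearK x nKx) => y /= ->.
  by rewrite expr2 !mul0r.
- apply: loc => [x /HY[_ cY _]|x ->]; last by rewrite expr2 !mul0r.
  by rewrite E; apply: cvgM => //; apply: cvgM; exact: cf.
- apply: loc => [x /HY[_ cY cdY]|x ->]; last by rewrite mulr0 expr2 !mul0r addr0.
  rewrite (_ : (fun x => _) = fun x => 2 * f x * 'D_v f x * Y x + f x * f x * dY x); last first.
    by apply/funext => y; rewrite expr2.
  apply: cvgD; apply: cvgM => //.
  + by apply: cvgM; [apply: cvgMr; exact: cf|exact: cdf].
  + by apply: cvgM; exact: cf.
Qed.

(** The divergence of [f ^ 2] times the arm field, directed across the arm. *)
Definition arm_flux sg (f : R * R -> R) x : R :=
  (2 * f x * 'D_e1 f x * arm_field sg x + f x ^+ 2 * arm_slope sg (along sg e1) (across sg e1) x) * - s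
  + (2 * f x * 'D_e2 f x * arm_field sg x + f x ^+ 2 * arm_slope sg (along sg e2) (across sg e2) x) * (sg * c).

Lemma arm_flux_int sg f : sg = 1 \/ sg = -1 -> rtest D f ->
  cc (arm_flux sg f) /\ \int[@area R]_x arm_flux sg f x = 0.
Proof.
move=> sgP tf.
have [d1 c1 c1'] := rtest_mul_local tf (fun x => arm_field_local e1 sgP (x := x)).
have [d2 c2 c2'] := rtest_mul_local tf (fun x => arm_field_local e2 sgP (x := x)).
have k (a : R) : continuous (fun _ : R * R => a) by move=> x; exact: cvg_cst.
have k1 := cc_mul c1' (k (- s)); have k2 := cc_mul c2' (k (sg * c)).
split; first exact: cc_add.
have -> := RintegralD measurableT (cc_integrable k1) (cc_integrable k2).
have -> := RintegralZr (- s) measurableT (cc_integrable c1').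
have -> := RintegralZr (sg * c) measurableT (cc_integrable c2').
by rewrite (int_partial1 d1 c1 c1') (int_partial2 d2 c2 c2') !mul0r addr0.
Qed.

(** With [k = cot (across)] the divergence contains [- (1 + k ^ 2) f ^ 2], and the
    term in [k] is absorbed by completing the square in the transversal derivative;
    what remains is the ground state energy 1 of the transversal problem. *)
Lemma arm_pointwise sg f x : sg = 1 \/ sg = -1 -> D x ->
  (if 0 < sg * x.2 then step (along sg x) * f x ^+ 2 else 0) + arm_flux sg f x
  <= (if 0 < sg * x.2 then 'D_e1 f x ^+ 2 + 'D_e2 f x ^+ 2 else 0).
Proof.
move=> sgP xD; rewrite /arm_flux /arm_field /arm_slope.
have sg2 : sg ^+ 2 = 1 by case: sgP => ->; rewrite ?sqrrN expr1n.
case: ifPn => sx; last by rewrite !(mulr0, addr0, mul0r).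
have [t0 t1] := guide_bounds xD.
have sin0 : sin (across sg x) != 0.
  rewrite gt_eqF// sin_gt0_pi// /across; apply/andP; split; move: t0 t1; rewrite (sign_norm sgP sx); lra.
have := cos2Dsin2 (across sg x); have := step_ge0 (along sg x); have := step_le1 (along sg x).
have := cos2Dsin2 theta.
have -> : along sg e1 = c by rewrite /along /e1 /= mulr1 mulr0 addr0.
have -> : across sg e1 = - s by rewrite /across /e1 /= mulr1 mulr0 addr0.
have -> : along sg e2 = sg * s by rewrite /along /e2 /= mulr1 mulr0 add0r.
have -> : across sg e2 = sg * c by rewrite /across /e2 /= mulr1 mulr0 add0r.
set ct := cos (across sg x); set st := sin (across sg x); set X := step _; set dX := dstep _.
set c' := cos theta; set s' := sin theta.
set f1 := 'D_e1 f x; set f2 := 'D_e2 f x; set u := f x.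
move=> cs X1 X0 ts.
pose k := ct / st.
have k2 : (st ^+ 2)^-1 = 1 + k ^+ 2.
  by rewrite /k expr_div_n -[X in X + _](@divff _ (st ^+ 2)) ?sqrf_eq0// -mulrDl addrC ts mul1r.
pose a := - s' * f1 + sg * c' * f2.
have aE : a ^+ 2 + (c' * f1 + sg * s' * f2) ^+ 2 = f1 ^+ 2 + f2 ^+ 2.
  have -> : a ^+ 2 + (c' * f1 + sg * s' * f2) ^+ 2 =
    (c' ^+ 2 + s' ^+ 2) * f1 ^+ 2 + sg ^+ 2 * (c' ^+ 2 + s' ^+ 2) * f2 ^+ 2 by rewrite /a; ring.
  by rewrite cs sg2 !mul1r.
rewrite -aE.
have -> : X * u ^+ 2 +
  ((2 * u * f1 * (X * (ct / st)) + u ^+ 2 * (dX * c' * (ct / st) - X * - s' / st ^+ 2)) * - s' +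
   (2 * u * f2 * (X * (ct / st)) + u ^+ 2 * (dX * (sg * s') * (ct / st) - X * (sg * c') / st ^+ 2)) * (sg * c'))
  = X * u ^+ 2 + 2 * u * a * X * k + u ^+ 2 * dX * k * s' * c' * (sg ^+ 2 - 1)
    - u ^+ 2 * X * (s' ^+ 2 + sg ^+ 2 * c' ^+ 2) * (st ^+ 2)^-1 by rewrite /a /k; ring.
rewrite sg2 subrr mulr0 addr0 mul1r [s' ^+ 2 + _]addrC cs mulr1 k2.
have : 0 <= (a - u * X * k) ^+ 2 by exact: sqr_ge0.
have : 0 <= (c' * f1 + sg * s' * f2) ^+ 2 by exact: sqr_ge0.
have : 0 <= (u * k) ^+ 2 * (X * (1 - X)) by rewrite mulr_ge0 ?sqr_ge0// mulr_ge0// subr_ge0.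
set b2 := (_ + _) ^+ 2; nra.
Qed.

Definition guide_box : set (R * R) :=
  let A := 1 + pi / s + pi in `[- A, A[ `*` `[- A, A[.

(** The transversal coordinate is bounded in the guide, so the points not yet far
    along an arm lie in a bounded box. *)
Lemma along_outside x sg : D x -> ~ guide_box x -> 0 < sg * x.2 -> sg = 1 \/ sg = -1 -> 1 <= along sg x.
Proof.
move=> xD nb sx sgP; have [t0 t1] := guide_bounds xD.
have c0 := guide_cos_gt0; have s0 := guide_sin_gt0.
have sg2 : sg * sg = 1 by case: sgP => ->; rewrite ?mulrNN mulr1.
move: t0 t1; rewrite (sign_norm sgP sx) => t0 t1.
rewrite leNgt; apply/negP => al; apply: nb.
have cs := cos2Dsin2 theta.
set t := - x.1 * s + sg * x.2 * c in t0 t1 *.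
have x1E : x.1 = c * along sg x - s * t.
  by rewrite /along /t -[LHS]mul1r -cs; ring.
have x2E : sg * x.2 = s * along sg x + c * t.
  rewrite /along /t -[LHS]mul1r -cs; ring.
have c1 : c <= 1 by exact: cos_le1.
have s1 : s <= 1 by exact: sin_le1.
have p0 := pi_gt0 R.
have ps : pi <= pi / s by rewrite ler_pdivlMr// ler_piMr// ltW.
have al2 : - (pi / s) < along sg x.
  rewrite ltNge; apply/negP => h.
  have : s * along sg x <= s * - (pi / s) by rewrite ler_wpM2l// ltW.
  have -> : s * - (pi / s) = - pi by field; rewrite gt_eqF.
  nra.
have q0 : 0 < pi / s by exact: divr_gt0.
have x2abs : `|x.2| < 1 + pi / s + pi by rewrite (sign_norm sgP sx) x2E; nra.
have x1abs : `|x.1| < 1 + pi / s + pi by rewrite ltr_norml x1E; apply/andP; split; nra.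
by split; rewrite /= in_itv /=; [move: x1abs|move: x2abs]; rewrite ltr_norml => /andP[/ltW -> ->].
Qed.

Lemma axis_in_box x : D x -> x.2 = 0 -> guide_box x.
Proof.
move=> xD x2; have [t0 t1] := guide_bounds xD; have s0 := guide_sin_gt0; have p0 := pi_gt0 R.
have q0 : 0 < pi / s by exact: divr_gt0.
move: t0 t1; rewrite x2 normr0 mul0r addr0 => t0 t1.
have h1 : - x.1 < pi / s by rewrite ltr_pdivlMr.
have h2 : x.1 < 0 by move: t0; rewrite mulNr oppr_gt0 pmulr_llt0.
by split; rewrite /= in_itv /= ?x2; apply/andP; split; lra.
Qed.

Lemma arm_pointwise_sum f x : rtest D f ->
  f x ^+ 2 <= 'D_e1 f x ^+ 2 + 'D_e2 f x ^+ 2 + ((fun x => f x ^+ 2) \_ (guide_box : set MR2)) x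
    - (arm_flux 1 f x + arm_flux (-1) f x).
Proof.
move=> tf; have [xD|xnD] := pselect (D x); last first.
  have fx0 := rtest_out tf xnD.
  rewrite /arm_flux fx0 (rtest_out (rtestD e1 tf) xnD) (rtest_out (rtestD e2 tf) xnD).
  have -> : ((fun x => f x ^+ 2) \_ (guide_box : set MR2)) x = 0.
    by rewrite patchE; case: ifP => // _; rewrite fx0 expr2 mul0r.
  by rewrite expr2 !(mulr0, mul0r, addr0, subr0).
have p1 := arm_pointwise f (or_introl erefl) xD.
have p2 := arm_pointwise f (or_intror erefl) xD.
have g0 : 0 <= 'D_e1 f x ^+ 2 + 'D_e2 f x ^+ 2 by rewrite addr_ge0// sqr_ge0.
have f0 := sqr_ge0 (f x).
have fb0 : 0 <= ((fun x => f x ^+ 2) \_ (guide_box : set MR2)) x by rewrite patchE; case: ifP.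
have box : guide_box x -> ((fun x => f x ^+ 2) \_ (guide_box : set MR2)) x = f x ^+ 2.
  by move=> xB; rewrite patchE ifT// inE.
have X1 := mulr_ge0 (step_ge0 (along 1 x)) f0.
have X2 := mulr_ge0 (step_ge0 (along (-1) x)) f0.
have out sg : ~ guide_box x -> 0 < sg * x.2 -> sg = 1 \/ sg = -1 -> step (along sg x) = 1.
  by move=> xB sx sgP; apply/step_eq1/along_outside.
have axis := axis_in_box xD.
have out1 : ~ guide_box x -> 0 < x.2 -> step (along 1 x) = 1.
  by move=> xB sx; apply: out => //; [rewrite mul1r|left].
have out2 : ~ guide_box x -> x.2 < 0 -> step (along (-1) x) = 1.
  by move=> xB sx; apply: out => //; [rewrite mulN1r oppr_gt0|right].
move: p1 p2 g0 f0 fb0 box X1 X2 axis out1 out2; rewrite mul1r mulN1r oppr_gt0; clear.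
move: (f x ^+ 2) ('D_e1 f x ^+ 2 + 'D_e2 f x ^+ 2) (arm_flux 1 f x) (arm_flux (-1) f x)
  (step (along 1 x)) (step (along (-1) x)) (_ x) x.2.
move=> u G F1 F2 s1 s2 fb y p1 p2 g0 f0 fb0 box X1 X2 axis out1 out2.
have [xB|xB] := pselect (guide_box x).
  by move: p1 p2; rewrite (box xB); case: (ltgtP 0 y) => _; lra.
move: p1 p2; case: (ltgtP 0 y) => y0.
- by rewrite (out1 xB y0); lra.
- by rewrite (out2 xB y0); lra.
- by case: xB; exact: axis.
Qed.

(** The flux integrates to 0, and outside the box the cut-off [step (along)] is 1. *)
Lemma arm_energy f : rtest D f ->
  \int[@area R]_x (f x ^+ 2) <= \int[@area R]_x ('D_e1 f x ^+ 2 + 'D_e2 f x ^+ 2)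
     + \int[@area R]_(x in guide_box) (f x ^+ 2).
Proof.
move=> tf.
have [c1 i1] := arm_flux_int (or_introl erefl) tf.
have [c2 i2] := arm_flux_int (or_intror erefl) tf.
have sqcc g : cc g -> cc (fun x : R * R => g x ^+ 2).
  by move=> cg; have := cc_mul cg (proj1 cg); congr cc; apply/funext => x; rewrite expr2.
have cf := sqcc _ (rtest_cc tf).
have cg := cc_add (sqcc _ (rtest_cc (rtestD e1 tf))) (sqcc _ (rtest_cc (rtestD e2 tf))).
have mB : measurable (guide_box : set MR2) by exact: measurableX.
rewrite [X in _ + X]Rintegral_mkcond.
have ib : area.-integrable setT (EFin \o ((fun x => f x ^+ 2) \_ (guide_box : set MR2))).
  have := integrableS measurableT mB (@subsetT _ _) (cc_integrable cf).
  by move=> /(integrable_mkcond _ mB); rewrite restrict_EFin.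
have ig := cc_integrable cg.
have i12 := cc_integrable (cc_add c1 c2).
have E : \int[@area R]_x (arm_flux 1 f x + arm_flux (-1) f x) = 0.
  have -> := RintegralD measurableT (cc_integrable c1) (cc_integrable c2).
  by rewrite i1 i2 addr0.
rewrite -[leRHS]subr0 -E.
have -> := esym (RintegralD measurableT ig ib).
have ig2 : area.-integrable setT (EFin \o (fun x => 'D_e1 f x ^+ 2 + 'D_e2 f x ^+ 2 + ((fun x => f x ^+ 2) \_ (guide_box : set MR2)) x)).
  by have := integrableD measurableT ig ib; apply: eq_integrable => // x _; rewrite /= EFinD.
have -> := esym (RintegralB measurableT ig2 i12).
apply: le_Rintegral => //.
- exact: (cc_integrable cf).
- by have := integrableB measurableT ig2 i12; apply: eq_integrable => // x _; rewrite /= EFinB.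
by move=> x _; exact: arm_pointwise_sum.
Qed.

End Guide.

(** * Poincare's inequality on a small square *)

Section OneDim.
Context {R : realType}.
Local Notation leb := (@lebesgue_measure R).
Implicit Types (g : R -> R) (A : set R).

(** A function whose oscillation on a set of measure [h] is at most [E] stays
    within [E] of its mean. *)
Lemma osc_poincare d (T : measurableType d) (mu : {measure set T -> \bar R}) (A : set T)
    (g : T -> R) (h E : R) : measurable A -> 0 < h ->
  mu A = h%:E -> mu.-integrable A (EFin \o g) ->
  mu.-integrable A (EFin \o (fun x => g x ^+ 2)) ->
  (forall x y, A x -> A y -> `|g x - g y| <= E) ->
  \int[mu]_(x in A) (g x ^+ 2) <= h^-1 * (\int[mu]_(x in A) g x) ^+ 2 + h * E ^+ 2.
Proof.
move=> mA h0 Ah ig ig2 osc.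
pose S := \int[mu]_(x in A) g x; pose m := h^-1 * S.
have icst (k : R) : mu.-integrable A (EFin \o (fun=> k)).
  apply/integrableP; split; first exact/measurable_EFinP/measurable_cst.
  by under eq_integral do rewrite /=; rewrite integral_cst// Ah -EFinM ltry.
have Rcst (k : R) : \int[mu]_(x in A) k = k * h by rewrite Rintegral_cst// Ah.
have dev x : A x -> `|g x - m| <= E.
  move=> Ax.
  have -> : g x - m = h^-1 * \int[mu]_(y in A) (g x - g y).
    rewrite RintegralB// Rcst mulrBr /m; congr (_ - _); field; by rewrite gt_eqF.
  rewrite normrM gtr0_norm ?invr_gt0// ler_pdivrMl//.
  have id : mu.-integrable A (EFin \o (fun y => g x - g y)).
    by have := integrableB mA (icst (g x)) ig; apply: eq_integrable => // y _; rewrite /= EFinB.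
  apply: le_trans (le_normr_Rintegral mA id) _; rewrite mulrC -Rcst.
  apply: le_Rintegral => //; first exact: integrable_norm.
  by move=> y Ay; exact: osc.
have E1 : \int[mu]_(x in A) ((g x - m) ^+ 2) = \int[mu]_(x in A) (g x ^+ 2) - 2 * m * S + m ^+ 2 * h.
  have -> : (fun x => (g x - m) ^+ 2) = (fun x => (1 * g x ^+ 2 + (- 2 * m) * g x) + m ^+ 2).
    by apply/funext => x; ring.
  rewrite RintegralD//; first by rewrite Rintegral_lin// Rcst; rewrite -/S; ring.
  exact: integrable_lin.
have E2 : \int[mu]_(x in A) ((g x - m) ^+ 2) <= h * E ^+ 2.
  rewrite mulrC -Rcst; apply: le_Rintegral => //.
    have -> : (fun x => (g x - m) ^+ 2) = (fun x => 1 * (1 * g x ^+ 2 + (- 2 * m) * g x) + 1 * m ^+ 2).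
      by apply/funext => x; ring.
    by apply: integrable_lin => //; exact: integrable_lin.
  move=> x Ax; have dx := dev x Ax; rewrite -[leLHS]real_normK ?num_real//.
  by rewrite lerXn2r ?nnegrE// (le_trans _ dx).
have E3 : m * S = h^-1 * S ^+ 2 by rewrite /m expr2 mulrA.
have E4 : m ^+ 2 * h = h^-1 * S ^+ 2 by rewrite /m; field; rewrite gt_eqF.
by move: E2; rewrite E1 E4 -mulrA E3 -/S; lra.
Qed.

Lemma cauchy_schwarz_cst d (T : measurableType d) (mu : {measure set T -> \bar R}) (A : set T) (g : T -> R) (h : R) :
  measurable A -> 0 <= h -> mu A = h%:E -> sqi mu A g ->
  (\int[mu]_(x in A) `|g x|) ^+ 2 <= h * (\int[mu]_(x in A) (g x ^+ 2)).
Proof.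
move=> mA h0 Ah [mg sg].
have s1 : sqi mu A (fun=> 1).
  split; first exact: measurable_cst.
  apply/integrableP; split; first exact/measurable_EFinP/measurable_cst.
  by under eq_integral do rewrite /=; rewrite integral_cst// Ah -EFinM ltry.
have sn : sqi mu A (fun x => `|g x|).
  split; first exact: measurableT_comp.
  by move: sg; apply: eq_integrable => // x _ /=; rewrite real_normK ?num_real.
have := ip_CS mA sn s1; rewrite !ipE mulrC.
have -> : \int[mu]_(x in A) (1 * 1) = h by rewrite mulr1 Rintegral_cst// Ah /= mul1r.
have -> : (fun x => `|g x| * 1) = (fun x => `|g x|) by apply/funext => x; rewrite mulr1.
by have -> : (fun x => `|g x| * `|g x|) = (fun x => g x ^+ 2) by apply/funext => x; rewrite -expr2 real_normK ?num_real.
Qed.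

Lemma cc1_integrable_on A g : cc1 g -> measurable (A : set (measurableTypeR R)) -> leb.-integrable A (EFin \o g).
Proof. by move=> cg mA; exact: integrableS measurableT mA (@subsetT _ _) (cc1_integrable cg). Qed.

Lemma FTC_bound g (dg : R -> R) (a b x y : R) : (forall t : R, is_derive t 1 g (dg t)) ->
  cc1 dg -> `[a, b[%classic x -> `[a, b[%classic y ->
  `|g x - g y| <= \int[leb]_(t in `[a, b[) `|dg t|.
Proof.
move=> dG cdg; wlog xy : x y / y <= x => [H hx hy|].
  by case: (leP y x) => [/H|/ltW /H h]; [exact|rewrite distrC; exact: h].
rewrite /= !in_itv /= => /andP[ax xb] /andP[ay yb].
have [->|yx] := eqVneq y x; first by rewrite subrr normr0; apply: Rintegral_ge0.
have {}xy : y < x by rewrite lt_neqAle yx.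
have cabs : cc1 (fun t => `|dg t|).
  case: cdg => cd [M dM]; split; last by exists M => t /dM ->; rewrite normr0.
  by move=> t; apply: cvg_norm; exact: cd.
have cg t : {for t, continuous g}.
  by apply: differentiable_continuous; apply/derivable1_diffP; case: (dG t).
have -> : g x - g y = \int[leb]_(t in `[y, x]) dg t.
  rewrite /Rintegral (@continuous_FTC2 _ dg g)//.
  - by apply: continuous_subspaceT; case: cdg.
  - split; [by move=> t _; have [] := dG t|by apply: cvg_at_right_filter; exact: cg|by apply: cvg_at_left_filter; exact: cg].
  - by move=> t _; rewrite derive1E; apply: derive_val.
apply: le_trans (le_normr_Rintegral _ (cc1_integrable_on cdg (measurable_itv _))) _ => //.
rewrite Rintegral_mkcond [leRHS]Rintegral_mkcond.
have i1 (i : interval R) : leb.-integrable setT (EFin \o ((fun t => `|dg t|) \_ [set` i])).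
  have mI : measurable ([set` i] : set (measurableTypeR R)) by exact: measurable_itv.
  by have := (integrable_mkcond _ mI).1 (cc1_integrable_on cabs mI); rewrite restrict_EFin.
apply: le_Rintegral => // t _; rewrite !patchE; case: ifPn => [|_]; last by case: ifP => _; [exact: normr_ge0|exact: lexx].
rewrite inE /= in_itv /= => /andP[yt tx]; rewrite ifT// inE /= in_itv /= (le_trans ay yt) /=.
exact: le_lt_trans tx xb.
Qed.

Let MR := measurableTypeR R.
Let MR2 := (measurableTypeR R * measurableTypeR R)%type.

Lemma cc_integrable_on (f : R * R -> R) (A : set MR2) : cc f -> measurable A -> area.-integrable A (EFin \o f).
Proof. by move=> cf mA; exact: integrableS measurableT mA (@subsetT _ _) (cc_integrable cf). Qed.

Lemma rect_fubini1 (f : R * R -> R) (I J : set MR) : cc f -> measurable I -> measurable J ->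
  leb.-integrable I (EFin \o (fun a => \int[leb]_(b in J) f (a, b))) /\
  \int[@area R]_(x in I `*` J) f x = \int[leb]_(a in I) \int[leb]_(b in J) f (a, b).
Proof.
move=> cf mI mJ.
have mIJ : measurable (I `*` J : set MR2) by exact: measurableX.
have iG := (integrable_mkcond _ mIJ).1 (cc_integrable_on cf mIJ).
have FE : fubini_F leb ((EFin \o f) \_ (I `*` J : set MR2))
    = (EFin \o (fun a => \int[leb]_(b in J) f (a, b))) \_ I.
  apply/funext => a; rewrite /fubini_F !patchE.
  transitivity (\int[leb]_b (if a \in I then ((EFin \o (fun b => f (a, b))) \_ J) b else 0%E))%E.
    apply: eq_integral => b _; rewrite !patchE in_setX /=.
    by case: (a \in I); case: (b \in J).
  case: ifPn => aI; last by rewrite integral0.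
  rewrite -integral_mkcond /= /Rintegral fineK//.
  apply: (integrable_fin_num mJ); exact: (cc1_integrable_on (cc_line2 a cf) mJ).
split.
  by apply/(integrable_mkcond _ mI); rewrite -FE; exact: (integrable_fubini_F iG).
rewrite /Rintegral; congr fine.
rewrite [LHS]integral_mkcond [RHS]integral_mkcond -(integral12_prod_meas1 iG) FE.
by [].
Qed.

Lemma cc_swap (f : R * R -> R) : cc f -> cc (fun x => f (x.2, x.1)).
Proof.
move=> [cf [M fM]]; split; last by exists M => x h; apply: fM; case: h; [right|left].
move=> x; apply: (@continuous_comp _ _ _ (fun x : R * R => (x.2, x.1)) f); last exact: cf.
by apply: (@cvg_pair _ _ _ _ (nbhs x.2) (nbhs x.1)); [exact: cvg_snd|exact: cvg_fst].
Qed.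

Lemma rect_fubini2 (f : R * R -> R) (I J : set MR) : cc f -> measurable I -> measurable J ->
  leb.-integrable J (EFin \o (fun b => \int[leb]_(a in I) f (a, b))) /\
  \int[@area R]_(x in I `*` J) f x = \int[leb]_(b in J) \int[leb]_(a in I) f (a, b).
Proof.
move=> cf mI mJ.
have mIJ : measurable (I `*` J : set MR2) by exact: measurableX.
have iG := (integrable_mkcond _ mIJ).1 (cc_integrable_on cf mIJ).
have FE : fubini_G leb ((EFin \o f) \_ (I `*` J : set MR2))
    = (EFin \o (fun b => \int[leb]_(a in I) f (a, b))) \_ J.
  apply/funext => b; rewrite /fubini_G !patchE.
  transitivity (\int[leb]_a (if b \in J then ((EFin \o (fun a => f (a, b))) \_ I) a else 0%E))%E.
    apply: eq_integral => a _; rewrite !patchE in_setX /=.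
    by case: (b \in J); case: (a \in I).
  case: ifPn => bJ; last by rewrite integral0.
  rewrite -integral_mkcond /= /Rintegral fineK//.
  apply: (integrable_fin_num mI); exact: (cc1_integrable_on (cc_line1 b cf) mI).
split.
  exact: (rect_fubini1 (cc_swap cf) mJ mI).1.
rewrite /Rintegral; congr fine.
rewrite [LHS]integral_mkcond [RHS]integral_mkcond -(integral21_prod_meas1 iG) FE.
by [].
Qed.

Lemma cc_sqr (f : R * R -> R) : cc f -> cc (fun x => f x ^+ 2).
Proof. by move=> cf; have := cc_mul cf (proj1 cf); congr cc; apply/funext => x; rewrite expr2. Qed.

Lemma cc_norm (f : R * R -> R) : cc f -> cc (fun x => `|f x|).
Proof.
move=> [cf [M fM]]; split; last by exists M => x /fM ->; rewrite normr0.
by move=> x; apply: cvg_norm; exact: cf.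
Qed.

Lemma cc1_sqr g : cc1 g -> cc1 (fun x => g x ^+ 2).
Proof.
move=> [cg [M gM]]; split; last by exists M => x /gM ->; rewrite expr2 mul0r.
rewrite (_ : (fun x => _) = fun x => g x * g x); last by apply/funext => x; rewrite expr2.
by move=> x; apply: cvgM; exact: cg.
Qed.

Definition square (a b h : R) : set MR2 := `[a, (a + h)[%classic `*` `[b, (b + h)[%classic.

Lemma square_area (a b h : R) : 0 < h -> area (square a b h) = (h ^+ 2)%:E.
Proof.
move=> h0; have E := @area_box R `[a, (a + h)[ `[b, (b + h)[; apply: (etrans E).
by rewrite !lebesgue_bounded_itv ?lerDl ?(ltW h0)// -EFinM; congr EFin; ring.
Qed.

(** The oscillation bound is used twice, on horizontal lines and for the horizontal
    means as functions of the height; the fundamental theorem of calculus and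
    Cauchy-Schwarz bound both oscillations by the derivatives. *)
Lemma small_square_poincare (f f1 f2 : R * R -> R) (a b h : R) : 0 < h ->
  cc f -> cc f1 -> cc f2 ->
  (forall x, is_derive x e1 f (f1 x)) -> (forall x, is_derive x e2 f (f2 x)) ->
  \int[@area R]_(x in square a b h) (f x ^+ 2) <=
    h ^+ 2 * (\int[@area R]_(x in square a b h) (f1 x ^+ 2 + f2 x ^+ 2))
    + (h ^+ 2)^-1 * (\int[@area R]_(x in square a b h) f x) ^+ 2.
Proof.
move=> h0 cf cf1 cf2 d1 d2.
pose I : set MR := `[a, (a + h)[%classic; pose J : set MR := `[b, (b + h)[%classic.
have mI : measurable I by exact: measurable_itv.
have mJ : measurable J by exact: measurable_itv.
have muI : leb I = h%:E by rewrite lebesgue_bounded_itv ?lerDl ?(ltW h0)// addrAC subrr add0r.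
have muJ : leb J = h%:E by rewrite lebesgue_bounded_itv ?lerDl ?(ltW h0)// addrAC subrr add0r.
have mQ : measurable (I `*` J : set MR2) by exact: measurableX.
rewrite -[square a b h]/(I `*` J).
pose F (y : R) := \int[leb]_(x in I) f (x, y).
have [iF QF] := rect_fubini2 cf mI mJ.
have [iF2 QF2] := rect_fubini2 (cc_sqr cf) mI mJ.
have [i11 Q11] := rect_fubini2 (cc_sqr cf1) mI mJ.
have [iN2 QN2] := rect_fubini1 (cc_norm cf2) mI mJ.
have line (y : R) : \int[leb]_(x in I) (f (x, y) ^+ 2) <=
    h^-1 * F y ^+ 2 + h ^+ 2 * (\int[leb]_(x in I) (f1 (x, y) ^+ 2)).
  have c1 := cc_line1 y cf; have c11 := cc_line1 y cf1.
  have := @osc_poincare _ MR leb I (fun x => f (x, y)) h (\int[leb]_(x in I) `|f1 (x, y)|) mI h0 muI.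
  move=> /(_ (cc1_integrable_on c1 mI) (cc1_integrable_on (cc1_sqr c1) mI)).
  have osc (x x' : R) : I x -> I x' -> `|f (x, y) - f (x', y)| <= \int[leb]_(x in I) `|f1 (x, y)|.
    by apply: (FTC_bound (g := fun x => f (x, y))) => // t; apply: is_derive_line1; exact: d1.
  move=> /(_ osc) H; apply: le_trans H _; rewrite lerD2l expr2 -mulrA ler_wpM2l ?(ltW h0)//.
  apply: cauchy_schwarz_cst => //; first exact: ltW.
  by split; [exact: (measurable_funTS (continuous_measurable_fun (proj1 c11)))|exact: (cc1_integrable_on (cc1_sqr c11) mI)].
pose E := \int[@area R]_(x in I `*` J) `|f2 x|.
have E2 : E ^+ 2 <= h ^+ 2 * (\int[@area R]_(x in I `*` J) (f2 x ^+ 2)).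
  apply: cauchy_schwarz_cst => //; first exact: sqr_ge0.
    exact: square_area.
  by split; [exact: (measurable_funTS (continuous_measurable2 (proj1 cf2)))|exact: (cc_integrable_on (cc_sqr cf2) mQ)].
have oscF (y y' : R) : J y -> J y' -> `|F y - F y'| <= E.
  move=> Jy Jy'.
  have iy := cc1_integrable_on (cc_line1 y cf) mI; have iy' := cc1_integrable_on (cc_line1 y' cf) mI.
  have -> : F y - F y' = \int[leb]_(x in I) (f (x, y) - f (x, y')) by rewrite RintegralB.
  have id : leb.-integrable I (EFin \o (fun x => f (x, y) - f (x, y'))).
    by have := integrableB mI iy iy'; apply: eq_integrable => // x _; rewrite /= EFinB.
  apply: le_trans (le_normr_Rintegral mI id) _; rewrite /E QN2.
  apply: le_Rintegral => //; first exact: integrable_norm.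
  move=> x _; apply: (FTC_bound (g := fun y => f (x, y))) => // [t|].
    by apply: is_derive_line2; exact: d2.
  exact: cc_line2 x cf2.
have [B B0 fB] := cc_bounded cf.
have FB y : `|F y| <= B * h.
  have iy := cc1_integrable_on (cc_line1 y cf) mI.
  apply: le_trans (le_normr_Rintegral mI iy) _.
  have -> : B * h = \int[leb]_(x in I) B by rewrite Rintegral_cst//; have := muI; rewrite /= => ->.
  apply: le_Rintegral => //; first exact: integrable_norm.
  have := muI => muI'; apply/integrableP; split; first exact/measurable_EFinP/measurable_cst.
  by under eq_integral do rewrite /=; rewrite integral_cst//; move: muI' => /= ->; rewrite -EFinM ltry.
have iFF : leb.-integrable J (EFin \o (fun y => F y ^+ 2)).
  apply: (@integrable_le _ MR R leb J mJ _ (fun y => (B * h) * `|F y|)).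
  - have mF : measurable_fun J F by apply/measurable_EFinP; exact: (measurable_int _ iF).
    by under eq_fun do rewrite expr2; exact: measurable_funM.
  - have := integrableZl mJ (B * h) (integrable_norm iF).
    by apply: eq_integrable => // y _; rewrite /= EFinM.
  - by move=> y _; rewrite normrX expr2 ler_wpM2r.
have stepF := osc_poincare mJ h0 muJ iF iFF oscF.
have QD : \int[@area R]_(x in I `*` J) (f1 x ^+ 2 + f2 x ^+ 2)
   = \int[@area R]_(x in I `*` J) (f1 x ^+ 2) + \int[@area R]_(x in I `*` J) (f2 x ^+ 2).
  by rewrite RintegralD//; exact: (cc_integrable_on (cc_sqr _) mQ).
rewrite QD QF2 Q11 QF.
have i1 : leb.-integrable J (EFin \o (fun y => h^-1 * F y ^+ 2 + h ^+ 2 * (\int[leb]_(x in I) (f1 (x, y) ^+ 2)))).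
  exact: integrable_lin.
apply: (le_trans (le_Rintegral mJ iF2 i1 (fun y _ => line y))).
rewrite Rintegral_lin//.
have hi0 : 0 < h^-1 by rewrite invr_gt0.
have := ler_wpM2l (ltW hi0) stepF.
have e1' : h^-1 * (h^-1 * (\int[leb]_(y in J) F y) ^+ 2 + h * E ^+ 2) = (h ^+ 2)^-1 * (\int[leb]_(y in J) F y) ^+ 2 + E ^+ 2.
  by field; rewrite gt_eqF.
rewrite e1' => H1; rewrite -/F; move: H1 E2.
set A1 := \int[leb]_(y in J) F y; set A2 := \int[leb]_(y in J) (F y ^+ 2); set A3 := \int[leb]_(b0 in J) _.
set A4 := \int[_]_(x in _) _; set A5 := E ^+ 2; set h2 := h ^+ 2; set h3 := h2^-1.
clearbody A1 A2 A3 A4 A5 h2 h3; clear; lra.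
Qed.

End OneDim.

(** * Coercivity below the threshold *)

Section Coercivity.
Context {R : realType}.
Let MR2 := (measurableTypeR R * measurableTypeR R)%type.
Implicit Types (f : R * R -> R).

Definition plane_C1 f := [/\ cc f, cc ('D_e1 f), cc ('D_e2 f),
  forall x, is_derive x e1 f ('D_e1 f x) & forall x, is_derive x e2 f ('D_e2 f x)].

(** On [Q], the square integral is controlled by [k] times the energy and by
    finitely many means; the point is that [k] can be small for a large [Q]. *)
Definition means_poincare (k : R) (Q : set MR2) :=
  measurable Q /\ exists (n : nat) (P : 'I_n -> set MR2) (C : R),
    [/\ 0 <= C, forall i, measurable (P i) /\ (area (P i) < +oo)%E &
      forall f, plane_C1 f -> \int[@area R]_(x in Q) (f x ^+ 2) <=
        k * (\int[@area R]_(x in Q) ('D_e1 f x ^+ 2 + 'D_e2 f x ^+ 2))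
        + C * \sum_(i < n) (\int[@area R]_(x in P i) f x) ^+ 2].

Lemma means_poincareU k Q1 Q2 : means_poincare k Q1 -> means_poincare k Q2 ->
  [disjoint Q1 & Q2] -> means_poincare k (Q1 `|` Q2).
Proof.
move=> [m1 [n1 [P1 [C1 [C10 mP1 H1]]]]] [m2 [n2 [P2 [C2 [C20 mP2 H2]]]]] dis.
split; first exact: measurableU.
pose P (i : 'I_(n1 + n2)) := match fintype.split i with inl j => P1 j | inr j => P2 j end.
exists (n1 + n2)%N, P, (C1 + C2); split; first exact: addr_ge0.
  by move=> i; rewrite /P; case: fintype.split.
move=> f cf; have [c0 c1 c2 d1 d2] := cf.
have mU : measurable (Q1 `|` Q2 : set MR2) by exact: measurableU.
have cs := cc_sqr c0.
have cg := cc_add (cc_sqr c1) (cc_sqr c2).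
rewrite (Rintegral_setU m1 m2 (cc_integrable_on cs mU) dis).
rewrite (Rintegral_setU m1 m2 (cc_integrable_on cg mU) dis).
have -> : \sum_(i < n1 + n2) (\int[@area R]_(x in P i) f x) ^+ 2
   = \sum_(i < n1) (\int[@area R]_(x in P1 i) f x) ^+ 2 + \sum_(i < n2) (\int[@area R]_(x in P2 i) f x) ^+ 2.
  rewrite big_split_ord /=; congr (_ + _); apply: eq_bigr => i _; rewrite /P.
    by case: split_ordP => j /eqP; rewrite ?eq_lshift ?eq_lrshift // => /eqP ->.
  by case: split_ordP => j /eqP; rewrite ?eq_rshift ?eq_rlshift // => /eqP ->.
have := H1 f cf; have := H2 f cf.
have : 0 <= \sum_(i < n1) (\int[@area R]_(x in P1 i) f x) ^+ 2 by apply: sumr_ge0 => i _; exact: sqr_ge0.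
have : 0 <= \sum_(i < n2) (\int[@area R]_(x in P2 i) f x) ^+ 2 by apply: sumr_ge0 => i _; exact: sqr_ge0.
set s1 := \sum_(i < n1) _; set s2 := \sum_(i < n2) _.
set a1 := \int[_]_(x in Q1) _; set a2 := \int[_]_(x in Q2) _.
set b1 := \int[_]_(x in Q1) _; set b2 := \int[_]_(x in Q2) _.
clearbody s1 s2 a1 a2 b1 b2; move: C10 C20; clear; nra.
Qed.

Lemma means_poincare0 k : means_poincare k set0.
Proof.
split; first exact: measurable0.
exists 0%N, (fun=> set0), 0; split=> //; first by case.
by move=> f _; rewrite !Rintegral_set0 mulr0 mul0r addr0.
Qed.

Definition rect (a b c d : R) : set MR2 := `[a, b[%classic `*` `[c, d[%classic.

Lemma means_poincare_square (a b h : R) : 0 < h ->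
  means_poincare (h ^+ 2) (rect a (a + h) b (b + h)).
Proof.
move=> h0; have mQ : measurable (rect a (a + h) b (b + h)) by apply: measurableX; exact: measurable_itv.
split=> //; exists 1%N, (fun=> rect a (a + h) b (b + h)), (h ^+ 2)^-1; split.
- by rewrite invr_ge0 sqr_ge0.
- by move=> _; split=> //; have := square_area a b h0; rewrite /square /rect => ->; rewrite ltry.
- move=> f [c0 c1 c2 d1 d2]; rewrite big_ord1.
  exact: (small_square_poincare a b h0 c0 c1 c2 d1 d2).
Qed.

Lemma means_poincare_row (a b h : R) (n : nat) : 0 < h ->
  means_poincare (h ^+ 2) (rect a (a + n%:R * h) b (b + h)).
Proof.
move=> h0; elim: n => [|n IH].
  have -> : rect a (a + 0%:R * h) b (b + h) = set0; last exact: means_poincare0.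
  apply/seteqP; split=> // x []; rewrite /= in_itv /= mul0r addr0 => /andP[h1 h2].
  by have := le_lt_trans h1 h2; rewrite ltxx.
have -> : rect a (a + n.+1%:R * h) b (b + h)
   = rect a (a + n%:R * h) b (b + h) `|` rect (a + n%:R * h) (a + n%:R * h + h) b (b + h).
  have nh : 0 <= n%:R * h by rewrite mulr_ge0// ltW.
  have E : a + n.+1%:R * h = a + n%:R * h + h by rewrite -natr1; ring.
  rewrite E; apply/seteqP; split=> [x [] /=|x [] [] /=]; rewrite !in_itv /=.
  - move=> /andP[h1 h2] h3; have [l|l] := ltP x.1 (a + n%:R * h); [left|right]; split => //=; rewrite in_itv /=.
      by rewrite h1.
    by rewrite l.
  - by move=> /andP[h1 h2] h3; split => //=; rewrite in_itv /= h1 /=; lra.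
  - by move=> /andP[h1 h2] h3; split => //=; rewrite in_itv /= h2 andbT; lra.
apply: means_poincareU => //; first exact: means_poincare_square.
apply/disj_setPS => x [[/= + _] [/= + _]]; rewrite !in_itv /= => /andP[_ h1] /andP[h2 _].
by have := lt_le_trans h1 h2; rewrite ltxx.
Qed.

Lemma means_poincare_grid (a b h : R) (n m : nat) : 0 < h ->
  means_poincare (h ^+ 2) (rect a (a + n%:R * h) b (b + m%:R * h)).
Proof.
move=> h0; elim: m => [|m IH].
  have -> : rect a (a + n%:R * h) b (b + 0%:R * h) = set0; last exact: means_poincare0.
  apply/seteqP; split=> // x [_]; rewrite /= in_itv /= mul0r addr0 => /andP[h1 h2].
  by have := le_lt_trans h1 h2; rewrite ltxx.
have -> : rect a (a + n%:R * h) b (b + m.+1%:R * h)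
   = rect a (a + n%:R * h) b (b + m%:R * h) `|` rect a (a + n%:R * h) (b + m%:R * h) (b + m%:R * h + h).
  have nh : 0 <= m%:R * h by rewrite mulr_ge0// ltW.
  have E : b + m.+1%:R * h = b + m%:R * h + h by rewrite -natr1; ring.
  rewrite E; apply/seteqP; split=> [x [] /=|x [] [] /=]; rewrite !in_itv /=.
  - move=> h3 /andP[h1 h2]; have [l|l] := ltP x.2 (b + m%:R * h); [left|right]; split => //=; rewrite in_itv /=.
      by rewrite h1.
    by rewrite l.
  - by move=> h3 /andP[h1 h2]; split => //=; rewrite in_itv /= h1 /=; lra.
  - by move=> h3 /andP[h1 h2]; split => //=; rewrite in_itv /= h2 andbT; lra.
apply: means_poincareU => //; first exact: means_poincare_row.
apply/disj_setPS => x [[/= _ +] [/= _ +]]; rewrite !in_itv /= => /andP[_ h1] /andP[h2 _].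
by have := lt_le_trans h1 h2; rewrite ltxx.
Qed.

(** Paving by squares of side [h] gives the constant [h ^ 2]. *)
Lemma means_poincare_box (A k : R) : 0 < A -> 0 < k ->
  exists2 k', k' <= k & means_poincare k' (rect (- A) A (- A) A).
Proof.
move=> A0 k0.
have k1 : 0 < k / (2 * A + k + 1) by apply: divr_gt0; lra.
pose e := (k / (2 * A + k + 1)) / (2 * A).
have e0 : 0 < e by apply: divr_gt0 k1 _; lra.
have [N NP] := natSinv_small e0.
have N0 : 0 < N.+1%:R :> R by rewrite ltr0n.
pose h := (2 * A) / N.+1%:R.
have h0 : 0 < h by apply: divr_gt0 => //; lra.
exists (h ^+ 2).
  have hk : h <= k / (2 * A + k + 1).
    have := ler_wpM2l (ltW (mulr_gt0 (ltr0Sn R 1) A0)) (ltW NP).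
    rewrite /h /e; move=> H; apply: le_trans H _.
    by rewrite mulrC divfK// gt_eqF// mulr_gt0.
  have h1 : h * (2 * A + k + 1) <= k by rewrite -ler_pdivlMr//; lra.
  have : h <= 1 by nra.
  nra.
have := @means_poincare_grid (- A) (- A) h N.+1 N.+1 h0.
have -> : - A + N.+1%:R * h = A; last by [].
by rewrite /h mulrC divfK ?gt_eqF//; lra.
Qed.

End Coercivity.

Section GuideCoercivity.
Context {R : realType}.
Variable theta : R.
Hypothesis theta_gt0 : 0 < theta.
Hypothesis theta_lt : theta < pi / 2.
Let D := broken_guide theta.
Let MR2 := (measurableTypeR R * measurableTypeR R)%type.
Let mD : measurable (D : set MR2) := guide_measurable theta_gt0 theta_lt.

Local Notation ipD := (inner_product (@area R) (D : set MR2)).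
Local Notation sqA := (sqi (@area R) (D : set MR2)).

Lemma rtest_plane_C1 f : rtest D f -> plane_C1 f.
Proof.
move=> tf; split; [exact: rtest_cc tf|exact: (rtest_cc (rtestD e1 tf))|exact: (rtest_cc (rtestD e2 tf))|
  by move=> x; exact: rtest_derive tf|by move=> x; exact: rtest_derive tf].
Qed.

Lemma sqi_indic (P : set MR2) : measurable P -> (area P < +oo)%E -> sqA (\1_P : R * R -> R).
Proof.
move=> mP Pfin; apply: (sqi_of_lty mD); first exact: measurable_indic.
apply: le_lt_trans Pfin; have -> : area P = (\int[@area R]_(x in setT) (\1_P x)%:E)%E.
  by rewrite integral_indic ?setIT.
apply: (@le_trans _ _ (\int[@area R]_(x in setT) (\1_P x ^+ 2)%:E)%E).
  apply: ge0_subset_integral => //.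
    apply/measurable_EFinP; under eq_fun do rewrite expr2.
    by apply: measurable_funM; exact: measurable_indic.
rewrite le_eqVlt; apply/orP; left; apply/eqP; apply: eq_integral => x _.
by rewrite indicE; case: (x \in P); rewrite ?expr1n ?expr2 ?mul0r.
Qed.

Lemma ip_indic (P : set MR2) f : rtest D f -> ipD f \1_P = \int[@area R]_(x in P) f x.
Proof.
move=> tf; rewrite (int_test_domain _ tf) [RHS]Rintegral_mkcond; congr Rintegral.
apply/funext => x; rewrite patchE indicE; case: (x \in P); by rewrite ?mulr1 ?mulr0.
Qed.

Lemma ip_sqr f : rtest D f -> ipD f f = \int[@area R]_x (f x ^+ 2).
Proof.
by move=> tf; rewrite (int_test_domain _ tf); congr Rintegral; apply/funext => x; rewrite expr2.
Qed.

(** Below the threshold 1 of the two arms, the energy controls the norm up to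
    finitely many linear functionals: only the bounded part of the guide,
    paved by small squares, can lower the energy. *)
Theorem guide_coercive (mu : R) : mu < 1 ->
  exists (n : nat) (w : 'I_n -> R * R -> R) (C : R), [/\ 0 <= C, forall i, sqA (w i) &
    forall f, rtest D f -> mu * ipD f f <=
      ipD ('D_e1 f) ('D_e1 f) + ipD ('D_e2 f) ('D_e2 f)
      + C * \sum_(i < n) (ipD f (w i)) ^+ 2].
Proof.
move=> mu1; (* Half the side of [guide_box]. *)
pose A : R := 1 + pi / sin theta + pi.
have A0 : 0 < A.
  have p0 := pi_gt0 R; have q0 : 0 < pi / sin theta by rewrite divr_gt0// guide_sin_gt0.
  by rewrite /A; lra.
have k0 : 0 < 1 - mu by lra.
have [k kle [mB [n [P [C [C0 mP HP]]]]]] := means_poincare_box A0 k0.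
exists n, (fun i => \1_(P i)), C; split=> //.
  by move=> i; have [mPi fPi] := mP i; exact: sqi_indic.
move=> f tf; have cf := rtest_plane_C1 tf; have [c0 c1 c2 _ _] := cf.
rewrite !ip_sqr//; [|exact: (rtestD e2 tf)|exact: (rtestD e1 tf)].
have -> : \sum_(i < n) ipD f \1_(P i) ^+ 2 = \sum_(i < n) (\int[@area R]_(x in P i) f x) ^+ 2.
  by apply: eq_bigr => i _; rewrite ip_indic.
have := HP f cf; have H := arm_energy theta_gt0 theta_lt tf.
have cg := cc_add (cc_sqr c1) (cc_sqr c2).
have -> : \int[@area R]_x ('D_e1 f x ^+ 2) + \int[@area R]_x ('D_e2 f x ^+ 2)
   = \int[@area R]_x ('D_e1 f x ^+ 2 + 'D_e2 f x ^+ 2).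
  by rewrite RintegralD//; [exact: (cc_integrable (cc_sqr c1))|exact: (cc_integrable (cc_sqr c2))].
have g0 x : 0 <= 'D_e1 f x ^+ 2 + 'D_e2 f x ^+ 2 by rewrite addr_ge0// sqr_ge0.
have le1 : \int[@area R]_(x in rect (- A) A (- A) A) ('D_e1 f x ^+ 2 + 'D_e2 f x ^+ 2)
    <= \int[@area R]_x ('D_e1 f x ^+ 2 + 'D_e2 f x ^+ 2).
  rewrite Rintegral_mkcond; apply: le_Rintegral => //.
  - have := (integrable_mkcond _ mB).1 (cc_integrable_on cg mB); by rewrite restrict_EFin.
  - exact: (cc_integrable cg).
  - by move=> x _; rewrite patchE; case: ifP => _ //; exact: lexx.
have ge0 : 0 <= \int[@area R]_(x in rect (- A) A (- A) A) ('D_e1 f x ^+ 2 + 'D_e2 f x ^+ 2).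
  exact: Rintegral_ge0.
have f0 : 0 <= \int[@area R]_x (f x ^+ 2) by apply: Rintegral_ge0 => x _; exact: sqr_ge0.
have S0 : 0 <= \sum_(i < n) (\int[@area R]_(x in P i) f x) ^+ 2 by apply: sumr_ge0 => i _; exact: sqr_ge0.
move: H le1 ge0 f0 S0; rewrite -[guide_box theta]/(rect (- A) A (- A) A).
set a := \int[_]_x _; set b := \int[_]_x _; set c := \int[_]_(x in rect _ _ _ _) _.
set d := \int[_]_(x in rect _ _ _ _) _; set S := \sum_(i < n) _.
clearbody a b c d S; move: kle k0 C0 mu1; clear => kle k0 C0 mu1 H le1 ge0 f0 S0 HP.
have CS : 0 <= C * S by exact: mulr_ge0.
have h1 : k * d <= (1 - mu) * b.
  by apply: (@le_trans _ _ ((1 - mu) * d)); [rewrite ler_wpM2r|rewrite ler_wpM2l// ltW].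
have h2 : a <= (2 - mu) * b + C * S by lra.
have b0 : 0 <= b by exact: le_trans ge0 le1.
have [m0|m0] := leP mu 0; first by nra.
have : mu * a <= mu * ((2 - mu) * b + C * S) by rewrite ler_wpM2l// ltW.
have : 0 <= (1 - mu) * (C * S) by rewrite mulr_ge0// ltW.
have : 0 <= (1 - mu) ^+ 2 * b by rewrite mulr_ge0// sqr_ge0.
nra.
Qed.

End GuideCoercivity.

(** * Coercive forms with a complex spectral parameter *)

Section Arithmetic.
Context {R : realFieldType}.
Implicit Types c mu s t x y z : R.

Lemma gap_arith c mu s x y z : c * (1 + mu + (mu - s)) = mu - s -> 0 <= c * (mu - s) * y ->
  c * x <= c * (y + z) -> (1 - c) * (mu * y) <= (1 - c) * z -> c * x <= z - s * y.
Proof.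
move=> h1 h2 h3 h4; have : c * (1 + mu + (mu - s)) * y = (mu - s) * y by rewrite h1.
move: h2 h3 h4; clear; lra.
Qed.

Lemma skew_sqr_le t x y z w : (x + w + t * (y - z)) ^+ 2
  <= 4 * (x ^+ 2 + w ^+ 2 + t ^+ 2 * (y ^+ 2 + z ^+ 2)).
Proof.
have := sqr_ge0 (x - w); have := sqr_ge0 (x - t * y); have := sqr_ge0 (x + t * z).
have := sqr_ge0 (w - t * y); have := sqr_ge0 (w + t * z); have := sqr_ge0 (t * y + t * z).
rewrite !expr2; lra.
Qed.

Lemma skew_functional_bound t L i j x y z w : 0 <= L -> 0 <= i -> 0 <= j ->
  x ^+ 2 <= L * i -> y ^+ 2 <= L * j -> z ^+ 2 <= L * i -> w ^+ 2 <= L * j ->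
  (x + w + t * (y - z)) ^+ 2 <= 4 * (1 + t ^+ 2) * L * (i + j).
Proof.
move=> L0 i0 j0 hx hy hz hw; apply: le_trans (skew_sqr_le t x y z w) _.
have : t ^+ 2 * (y ^+ 2 + z ^+ 2) <= t ^+ 2 * (L * j + L * i) by rewrite ler_wpM2l ?sqr_ge0//; lra.
lra.
Qed.

End Arithmetic.

Section BoundedForms.
Context {R : realType} {V : lmodType R}.
Variables (P : V -> Prop) (IP : V -> V -> R).
Hypothesis IP_ge0 : forall u, 0 <= IP u u.
Implicit Types (B : V -> V -> R) (u v : V).

Definition bounded_form B := bilinear_on P B /\
  exists2 M, 0 < M & forall u v, P u -> P v -> B u v ^+ 2 <= M * IP u u * IP v v.

Lemma bounded_form_lin a B B' : bounded_form B -> bounded_form B' ->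
  bounded_form (fun u v => a * B u v + B' u v).
Proof.
move=> [[L1 L2] [M M0 BM]] [[L1' L2'] [M' M'0 BM']]; split.
  by split=> x u v w pu pv pw; rewrite ?(L1, L2) ?(L1', L2')//; ring.
exists (2 * a ^+ 2 * M + 2 * M').
  by have := sqr_ge0 a => a0; have : 0 <= a ^+ 2 * M by [rewrite mulr_ge0// ltW|]; lra.
move=> u v pu pv; have := BM u v pu pv; have := BM' u v pu pv.
set x := B u v; set y := B' u v => hy hx.
have h : (a * x + y) ^+ 2 <= 2 * (a ^+ 2 * x ^+ 2) + 2 * y ^+ 2.
  by have := sqr_ge0 (a * x - y); rewrite -exprMn; nra.
apply: le_trans h _.
have : a ^+ 2 * x ^+ 2 <= a ^+ 2 * (M * IP u u * IP v v) by rewrite ler_wpM2l// sqr_ge0.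
rewrite (_ : (2 * a ^+ 2 * M + 2 * M') * IP u u * IP v v
  = 2 * (a ^+ 2 * (M * IP u u * IP v v)) + 2 * (M' * IP u u * IP v v)); last by ring.
lra.
Qed.

Lemma bounded_form0 : bounded_form (fun _ _ => 0).
Proof.
split; first by split=> *; rewrite mulr0 addr0.
by exists 1 => // u v _ _; rewrite expr2 mul0r mul1r mulr_ge0.
Qed.

Lemma bounded_form_sum n (B : 'I_n -> V -> V -> R) : (forall i, bounded_form (B i)) ->
  bounded_form (fun u v => \sum_(i < n) B i u v).
Proof.
elim: n B => [|n IH] B bB.
  rewrite (_ : (fun u v => _) = (fun _ _ => 0)); first exact: bounded_form0.
  by apply/funext => u; apply/funext => v; rewrite big_ord0.
have := bounded_form_lin 1 (IH (fun i => B (widen_ord (leqnSn n) i)) (fun i => bB _)) (bB ord_max).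
by congr bounded_form; apply/funext => u; apply/funext => v; rewrite big_ord_recr mul1r.
Qed.

Definition bounded_functional (l : V -> R) :=
  (forall a u v, P u -> P v -> l (a *: u + v) = a * l u + l v) /\
  exists2 L, 0 <= L & forall v, P v -> l v ^+ 2 <= L * IP v v.

Lemma bounded_formS (Q : V -> Prop) B : (forall u, Q u -> P u) -> bounded_form B ->
  bilinear_on Q B /\
  exists2 M, 0 < M & forall u v, Q u -> Q v -> B u v ^+ 2 <= M * IP u u * IP v v.
Proof.
move=> QP [[L1 L2] [M M0 BM]]; split; last by exists M => // u v /QP pu /QP pv; exact: BM.
by split=> a u v w /QP pu /QP pv /QP pw; [exact: L1|exact: L2].
Qed.

Lemma bounded_form_rank1 l : bounded_functional l -> bounded_form (fun u v => l u * l v).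
Proof.
move=> [lL [L L0 lb]]; split.
  by split=> a u v w pu pv pw; rewrite lL//; ring.
exists (L ^+ 2 + 1) => [|u v pu pv]; first by have := sqr_ge0 L; lra.
have := lb u pu; have := lb v pv; have := IP_ge0 u; have := IP_ge0 v.
rewrite exprMn => v0 u0 hv hu.
have : l u ^+ 2 * l v ^+ 2 <= (L * IP u u) * (L * IP v v) by apply: ler_pM; rewrite ?sqr_ge0.
have : 0 <= IP u u * IP v v by exact: mulr_ge0.
nra.
Qed.

End BoundedForms.

Section ComplexResolvent.
Context {R : realType} {V : lmodType R}.
Variables (P : V -> Prop) (IP : V -> V -> R).
Hypothesis P_lin : forall a u v, P u -> P v -> P (a *: u + v).
Hypothesis P_0 : P 0.
Hypothesis IP_lin : bilinear_on P IP.
Hypothesis IP_sym : forall u v, IP u v = IP v u.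
Hypothesis IP_ge0 : forall u, 0 <= IP u u.
Hypothesis P_complete : forall un : nat -> V, (forall n, P (un n)) ->
  (forall e : R, 0 < e -> exists N, forall m n, (N <= m)%N -> (N <= n)%N ->
     IP (un m - un n) (un m - un n) < e) ->
  exists2 u, P u & forall e : R, 0 < e -> exists N, forall n, (N <= n)%N ->
     IP (un n - u) (un n - u) < e.

Let P2 (U : (V * V)%type) := P U.1 /\ P U.2.
Let IP2 (U W : (V * V)%type) := IP U.1 W.1 + IP U.2 W.2.

Let P2_lin a U W : P2 U -> P2 W -> P2 (a *: U + W).
Proof. by move=> [h1 h2] [h3 h4]; split; exact: P_lin. Qed.

Let P2_0 : P2 0. Proof. by split; exact: P_0. Qed.

Let IP2_lin : bilinear_on P2 IP2.
Proof.
case: IP_lin => L1 L2.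
split=> a U W X [u1 u2] [w1 w2] [x1 x2]; rewrite /IP2 /= ?L1 ?L2//; ring.
Qed.

Let IP2_sym U W : IP2 U W = IP2 W U.
Proof. by rewrite /IP2 IP_sym (IP_sym U.2). Qed.

Let IP2_ge0 U : 0 <= IP2 U U.
Proof. by rewrite /IP2 addr_ge0. Qed.

Let P2_complete (un : nat -> V * V) : (forall n, P2 (un n)) ->
  (forall e : R, 0 < e -> exists N, forall m n, (N <= m)%N -> (N <= n)%N ->
     IP2 (un m - un n) (un m - un n) < e) ->
  exists2 u, P2 u & forall e : R, 0 < e -> exists N, forall n, (N <= n)%N ->
     IP2 (un n - u) (un n - u) < e.
Proof.
move=> pun cun.
have [e e0|u1 p1 h1] := P_complete (fun n => proj1 (pun n)).
  have [N NP] := cun e e0; exists N => m n Nm Nn.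
  by apply: le_lt_trans (NP m n Nm Nn); rewrite /IP2 /= lerDl.
have [e e0|u2 p2 h2] := P_complete (fun n => proj2 (pun n)).
  have [N NP] := cun e e0; exists N => m n Nm Nn.
  by apply: le_lt_trans (NP m n Nm Nn); rewrite /IP2 /= lerDr.
exists (u1, u2) => // e e0; have e2 : 0 < e / 2 by lra.
have [N1 H1] := h1 _ e2; have [N2 H2] := h2 _ e2.
exists (maxn N1 N2) => n; rewrite geq_max => /andP[n1 n2].
by rewrite /IP2 /=; have := H1 n n1; have := H2 n n2; lra.
Qed.

Variables (E G : V -> V -> R) (a b t mu : R).
Hypothesis bE : bounded_form P IP E.
Hypothesis bG : bounded_form P IP G.
Hypothesis E_sym : forall u v, E u v = E v u.
Hypothesis G_sym : forall u v, G u v = G v u.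
Hypothesis G_ge0 : forall u, 0 <= G u u.
Hypothesis G_le : forall u, P u -> G u u <= IP u u.
Hypothesis IP_le : forall u, P u -> IP u u <= G u u + E u u.
Hypothesis E_ge : forall u, P u -> mu * G u u <= E u u.
Hypothesis mu_ge0 : 0 <= mu.
Hypothesis ab_lt : a - t * b < mu.

(** Real and imaginary part of the form [E - (a + i b) G] applied to [u1 + i u2]
    and to a real [v]. *)
Let F1 u1 u2 v := E u1 v - a * G u1 v + b * G u2 v.
Let F2 u1 u2 v := E u2 v - a * G u2 v - b * G u1 v.

Let B (U W : V * V) := F1 U.1 U.2 W.1 + F2 U.1 U.2 W.2
  + t * (F1 U.1 U.2 W.2 - F2 U.1 U.2 W.1).

Let BE U W : B U W = E U.1 W.1 + E U.2 W.2 - (a - t * b) * (G U.1 W.1 + G U.2 W.2)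
  + b * (G U.2 W.1 - G U.1 W.2) + t * (E U.1 W.2 - E U.2 W.1 - a * (G U.1 W.2 - G U.2 W.1))
  + t * b * (G U.2 W.2 - G U.2 W.2).
Proof. by rewrite /B /F1 /F2; ring. Qed.

Let gap_gt0 : 0 < mu - (a - t * b). Proof. by rewrite subr_gt0. Qed.

Let denom_gt0 : 0 < 1 + mu + (mu - (a - t * b)).
Proof. by rewrite addr_gt0// ltr_wpDr. Qed.

(** Coercivity constant: the gap [mu - (a - t b)] controls [G], and the fraction
    [c] of [E] that is spent on [IP] leaves enough of [E] to pay for [mu G]. *)
Let c := (mu - (a - t * b)) / (1 + mu + (mu - (a - t * b))).

Let c_gt0 : 0 < c.
Proof. exact: divr_gt0. Qed.

Let B_coercive U : P2 U -> c * IP2 U U <= B U U.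
Proof.
have c1 : c * (1 + mu + (mu - (a - t * b))) = mu - (a - t * b).
  by rewrite /c divfK// gt_eqF.
have cl1 : c < 1 by rewrite /c ltr_pdivrMr// mul1r ltrDr ltr_wpDr.
have H u : P u -> c * IP u u <= E u u - (a - t * b) * G u u.
  move=> pu; have := IP_le pu; have := E_ge pu; have := G_ge0 u.
  set x := IP u u; set y := G u u; set z := E u u; set s := a - t * b => y0 h1 h2.
  have h3 : c * x <= c * (y + z) by rewrite ler_wpM2l// ltW.
  have h4 : (1 - c) * (mu * y) <= (1 - c) * z by rewrite ler_wpM2l//; lra.
  by apply: (gap_arith c1 _ h3 h4); apply: mulr_ge0 => //; apply: mulr_ge0; exact: ltW.
move=> [p1 p2]; have := H _ p1; have := H _ p2.
rewrite BE /IP2 (G_sym U.2 U.1) (E_sym U.2 U.1); move=> h1 h2; nra.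
Qed.

Let pull (Q : V -> V -> R) (k1 k2 : bool) : bounded_form P IP Q ->
  bounded_form P2 IP2 (fun U W => Q (if k1 then U.1 else U.2) (if k2 then W.1 else W.2)).
Proof.
move=> [[L1 L2] [M M0 QM]]; split.
  split=> x U W X [u1 u2] [w1 w2] [x1 x2]; case: k1; case: k2; by rewrite /= ?L1 ?L2.
exists M => // U W [u1 u2] [w1 w2].
set u := if k1 then _ else _; set w := if k2 then _ else _.
have hu : P u /\ IP u u <= IP2 U U.
  by rewrite /u /IP2; case: (k1); split; rewrite // ?lerDl ?lerDr.
have hw : P w /\ IP w w <= IP2 W W.
  by rewrite /w /IP2; case: (k2); split; rewrite // ?lerDl ?lerDr.
apply: le_trans (QM u w (proj1 hu) (proj1 hw)) _.
apply: ler_pM => //; first by rewrite mulr_ge0// ltW.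
- by rewrite ler_wpM2l ?(proj2 hu)// ltW.
- exact: (proj2 hw).
Qed.

Let B_bounded : bounded_form P2 IP2 B.
Proof.
have Z x Q Q' := bounded_form_lin x (P := P2) (IP := IP2) (B := Q) (B' := Q').
have G11 := pull true true bG; have G12 := pull true false bG.
have G21 := pull false true bG; have G22 := pull false false bG.
have E11 := pull true true bE; have E12 := pull true false bE.
have E21 := pull false true bE; have E22 := pull false false bE.
have := Z 1 _ _ E11 (Z 1 _ _ E22 (Z (- (a - t * b)) _ _ G11 (Z (- (a - t * b)) _ _ G22
  (Z (b + t * a) _ _ G21 (Z (- b - t * a) _ _ G12 (Z t _ _ E12 (Z (- t) _ _ E21
    (bounded_form0 P2 (IP := IP2) IP2_ge0)))))))).
congr bounded_form; apply/funext => U; apply/funext => W; rewrite BE /=; ring.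
Qed.

(** Lax-Milgram on pairs (real part, imaginary part).  The multiple [t] of the
    skew combination of the two equations trades the imaginary part [b] of the
    spectral parameter for coercivity. *)
Lemma complex_resolvent_exists (l1 l2 : V -> R) :
  bounded_functional P IP l1 -> bounded_functional P IP l2 ->
  exists u1 u2, [/\ P u1, P u2, forall v, P v -> F1 u1 u2 v = l1 v
    & forall v, P v -> F2 u1 u2 v = l2 v].
Proof.
move=> [lin1 [L1 L10 b1]] [lin2 [L2 L20 b2]].
have [BL [M M0 BM]] := B_bounded.
have [x U W pU pW|W [w1 w2]|[u1 u2] [/= p1 p2] H] := lax_milgram P2_lin P2_0 IP2_lin IP2_sym IP2_ge0 P2_complete
  (l := fun W => l1 W.1 + l2 W.2 + t * (l1 W.2 - l2 W.1))
  (L := 4 * (1 + t ^+ 2) * (L1 + L2)) BL c_gt0 M0 BM B_coercive.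
- by move: pU pW => [u1 u2] [w1 w2]; rewrite /= !lin1// !lin2//; ring.
- have H (l : V -> R) L w : 0 <= L -> L <= L1 + L2 -> l w ^+ 2 <= L * IP w w -> l w ^+ 2 <= (L1 + L2) * IP w w.
    by move=> L0 LL h; apply: le_trans h _; rewrite ler_wpM2r.
  have l1L : L1 <= L1 + L2 by rewrite lerDl.
  have l2L : L2 <= L1 + L2 by rewrite lerDr.
  by apply: skew_functional_bound; rewrite ?addr_ge0//; [exact: H (b1 _ w1)|exact: H (b1 _ w2)|
    exact: H (b2 _ w1)|exact: H (b2 _ w2)].
have BU W1 W2 : P W1 -> P W2 -> B (u1, u2) (W1, W2) = l1 W1 + l2 W2 + t * (l1 W2 - l2 W1).
  by move=> p1' p2'; rewrite H.
have z (l : V -> R) : (forall a u v, P u -> P v -> l (a *: u + v) = a * l u + l v) -> l 0 = 0.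
  by move=> lL; have := lL 1 0 0 P_0 P_0; rewrite scale1r addr0 mul1r; lra.
have G0 u : P u -> G u 0 = 0.
  by move=> pu; apply: z => x v w pv pw; case: bG => -[_ ->].
have E0 u : P u -> E u 0 = 0.
  by move=> pu; apply: z => x v w pv pw; case: bE => -[_ ->].
have key v : P v -> F1 u1 u2 v - l1 v - t * (F2 u1 u2 v - l2 v) = 0 /\
                    F2 u1 u2 v - l2 v + t * (F1 u1 u2 v - l1 v) = 0.
  move=> pv; have := BU v 0 pv P_0; have := BU 0 v P_0 pv.
  rewrite /B /= (z _ lin1) (z _ lin2).
  have -> : F1 u1 u2 0 = 0 by rewrite /F1 E0// !G0//; ring.
  have -> : F2 u1 u2 0 = 0 by rewrite /F2 E0// !G0//; ring.
  by move=> h1 h2; split; lra.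
have tz : 0 < 1 + t ^+ 2 by have := sqr_ge0 t; lra.
exists u1, u2; split=> // v pv; have [h1 h2] := key v pv; apply/eqP; rewrite -subr_eq0;
  apply/eqP/(mulfI (lt0r_neq0 tz)); rewrite mulr0.
- rewrite (_ : _ * _ = (F1 u1 u2 v - l1 v - t * (F2 u1 u2 v - l2 v))
    + t * (F2 u1 u2 v - l2 v + t * (F1 u1 u2 v - l1 v))); last by ring.
  by rewrite h1 h2 mulr0 addr0.
- rewrite (_ : _ * _ = (F2 u1 u2 v - l2 v + t * (F1 u1 u2 v - l1 v))
    - t * (F1 u1 u2 v - l1 v - t * (F2 u1 u2 v - l2 v))); last by ring.
  by rewrite h1 h2 mulr0 subr0.
Qed.

(** Coercivity tested on the solution itself; [L] bounds the right-hand sides in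
    the norm of [G], which yields a bound of the solution in that norm. *)
Lemma complex_resolvent_bound : exists2 K, 0 <= K & forall u1 u2 (l1 l2 : V -> R) L,
  0 <= L -> P u1 -> P u2 ->
  (forall v, P v -> l1 v ^+ 2 <= L * G v v) -> (forall v, P v -> l2 v ^+ 2 <= L * G v v) ->
  (forall v, P v -> F1 u1 u2 v = l1 v) -> (forall v, P v -> F2 u1 u2 v = l2 v) ->
  G u1 u1 + G u2 u2 <= K * L.
Proof.
exists (4 * (1 + t ^+ 2) / c ^+ 2).
  by rewrite divr_ge0 ?sqr_ge0// mulr_ge0//; have := sqr_ge0 t; lra.
move=> u1 u2 l1 l2 L L0 p1 p2 b1 b2 e1 e2.
have := B_coercive (conj p1 p2 : P2 (u1, u2)); rewrite /B /IP2 /= !e1// !e2//.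
have := G_le p1; have := G_le p2.
have := b1 _ p1; have := b1 _ p2; have := b2 _ p1; have := b2 _ p2.
have := G_ge0 u1; have := G_ge0 u2; have := c_gt0; have := sqr_ge0 t.
move: (IP u1 u1) (IP u2 u2) (G u1 u1) (G u2 u2) (l1 u1) (l1 u2) (l2 u1) (l2 u2) c.
move=> i j g h x y z w d t0 d0 h0 g0 hw hz hy hx hj hi H.
set r := x + w + t * (y - z) in H.
have hr2 : r ^+ 2 <= 4 * (1 + t ^+ 2) * L * (g + h) by exact: skew_functional_bound.
have hg : d * (g + h) <= r by apply: le_trans H; rewrite ler_wpM2l//; [exact: ltW|lra].
have [->|gn] := eqVneq (g + h) 0.
  by rewrite mulr_ge0// divr_ge0 ?sqr_ge0// mulr_ge0//; lra.
have gh0 : 0 < g + h by rewrite lt_neqAle eq_sym gn addr_ge0.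
have : (d * (g + h)) ^+ 2 <= r ^+ 2 by rewrite ler_sqr ?nnegrE// ?(le_trans _ hg)// mulr_ge0// ltW.
move=> /le_trans/(_ hr2) hh; rewrite mulrAC ler_pdivlMr ?exprn_gt0//.
rewrite -(ler_pM2r gh0); apply: le_trans hh; rewrite exprMn [(g + h) * d ^+ 2]mulrC -mulrA -expr2.
exact: lexx.
Qed.

End ComplexResolvent.

Section ClosurePositive.
Context {R : realType} {V : lmodType R}.
Variables (P : V -> Prop) (IP : V -> V -> R) (S : V -> Prop).
Hypothesis P_lin : forall a u v, P u -> P v -> P (a *: u + v).
Hypothesis IP_ge0 : forall u, 0 <= IP u u.
Hypothesis S_P : forall u, S u -> P u.

(** A negative value would persist nearby, by the Cauchy-Schwarz type bound. *)
Lemma closure_of_form_ge0 (Q : V -> V -> R) u : bounded_form P IP Q ->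
  (forall s, S s -> 0 <= Q s s) -> closure_of P IP S u -> 0 <= Q u u.
Proof.
move=> [QL [M M0 QM]] Q0 [pu hu]; rewrite leNgt; apply/negP => neg.
pose d : R := - Q u u / 4; have d0 : 0 < d by rewrite /d; lra.
pose e : R := Num.min 1 (d ^+ 2 / (M * (IP u u + 1))).
have Mu : 0 < M * (IP u u + 1) by rewrite mulr_gt0//; have := IP_ge0 u; lra.
have e0 : 0 < e by rewrite lt_min ltr01 divr_gt0// exprn_gt0.
have eM : e * (M * (IP u u + 1)) <= d ^+ 2.
  by rewrite -ler_pdivlMr// /e ge_min lexx orbT.
have e1 : e <= 1 by rewrite /e ge_min lexx.
have [s ss hs] := hu e e0; have ps := S_P ss.
have pw : P (u - s) by exact: (P_B P_lin).
set w := u - s in pw hs.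
have sE : s = u - w by rewrite /w opprB addrC subrK.
have := Q0 s ss; rewrite {1}sE (bilB QL pu pw ps) {1}sE (bilBr QL pu pw pu).
rewrite {1}sE (bilBr QL pu pw pw).
have small x y : P x -> P y -> IP x x * IP y y <= e * (IP u u + 1) -> `|Q x y| <= d.
  move=> px py h; rewrite -ler_sqr ?nnegrE ?normr_ge0 ?(ltW d0)// real_normK ?num_real//.
  apply: le_trans (QM x y px py) _; apply: le_trans eM; rewrite -mulrA [leRHS]mulrCA.
  by rewrite ler_wpM2l// ltW.
have w0 := IP_ge0 w; have u0 := IP_ge0 u.
have h1 : `|Q u w| <= d by apply: small => //; nra.
have h2 : `|Q w u| <= d by apply: small => //; nra.
have h3 : `|Q w w| <= d by apply: small => //; nra.
move: h1 h2 h3; rewrite !ler_norml => /andP[a1 a2] /andP[b1 b2] /andP[c1 c2].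
by rewrite /d in a1 a2 b1 b2 c1 c2; lra.
Qed.

End ClosurePositive.

(** * Finite-rank perturbations and the Fredholm property *)

Section Subspace.
Context {F : fieldType}.

(** A linear subspace given by a predicate is the row space of a matrix: take
    a matrix of maximal rank among those with all rows in the subspace. *)
Lemma subspace_matrix n (Q : 'rV[F]_n -> Prop) : Q 0 ->
  (forall a u v, Q u -> Q v -> Q (a *: u + v)) ->
  exists X : 'M[F]_n, forall c, Q c <-> (c <= X)%MS.
Proof.
move=> Q0 Qlin.
have Qsum (X : 'M[F]_n) (a : 'rV_n) : (forall i, Q (row i X)) -> Q (a *m X).
  move=> QX; rewrite mulmx_sum_row; elim/big_ind: _ => // [u v qu qv|i _].
    by rewrite -[u]scale1r; exact: Qlin.
  by rewrite -[_ *: _]addr0; exact: Qlin.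
pose p k := `[< exists X : 'M[F]_n, \rank X = k /\ forall i, Q (row i X) >].
have p0 : exists k, p k.
  by exists 0%N; apply/asboolP; exists 0; rewrite mxrank0; split=> // i; rewrite row0.
have pn k : p k -> (k <= n)%N by move=> /asboolP[X [<- _]]; exact: rank_leq_row.
case: (ex_maxnP p0 pn) => k /asboolP[X [rX QX]] kmax.
exists X => c; split=> [Qc|/submxP[a ->]]; last exact: Qsum.
have : p (\rank (X + c)%MS).
  apply/asboolP; exists (X + c)%MS; split=> // i.
  have /sub_addsmxP[[a b] /= ->] := row_sub i (X + c)%MS.
  rewrite -[a *m X]scale1r; apply: (Qlin 1 _ _ (Qsum _ _ QX)).
  by rewrite (mx11_scalar b) mul_scalar_mx -[_ *: _]addr0; exact: Qlin.
move=> /kmax; rewrite -rX => rle.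
have /mxrank_leqif_sup[_] := addsmxSl X c.
rewrite eqn_leq rle mxrankS ?addsmxSl// => /esym/idP.
by apply: submx_trans; exact: addsmxSr.
Qed.

End Subspace.

Section FiniteRankPerturbation.
Context {d : measure_display} {T : measurableType d} {R : realType}.
Variables (mu : {measure set T -> \bar R}) (D : set T).
Hypothesis mD : measurable D.
Implicit Types (u v f g : T -> R[i]) (c : R[i]).
Local Notation normc := (ComplexField.Normc.normc).

Lemma normc_ge0 c : 0 <= normc c.
Proof. by case: c => a b; exact: sqrtr_ge0. Qed.

Lemma L2_lin c u v : L2 mu D u -> L2 mu D v -> L2 mu D (fun x => c * u x + v x).
Proof.
move=> /(L2P _ mD)[u1 u2] /(L2P _ mD)[v1 v2]; apply/(L2P _ mD).
case: c => a b; split.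
- have := sqiD mD (sqi_lin mD a (- b) u1 u2) v1; congr sqi; apply/funext => x.
  by rewrite /re /im; case: (u x) (v x) => p q [p' q'] /=; rewrite mulNr.
- have := sqiD mD (sqi_lin mD a b u2 u1) v2; congr sqi; apply/funext => x.
  by rewrite /re /im; case: (u x) (v x) => p q [p' q'].
Qed.

Lemma sqi_comb k (a : 'I_k -> R) (v : 'I_k -> T -> R) : (forall i, sqi mu D (v i)) ->
  sqi mu D (fun x => \sum_(i < k) a i * v i x) /\ forall g : T -> R, sqi mu D g ->
  inner_product mu D (fun x => \sum_(i < k) a i * v i x) g
  = \sum_(i < k) a i * inner_product mu D (v i) g.
Proof.
elim: k a v => [|k IH] a v sv.
  have -> : (fun x => \sum_(i < 0) a i * v i x) = fun=> 0.
    by apply/funext => x; rewrite big_ord0.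
  split=> [|g sg]; first exact: sqi0.
  rewrite big_ord0; transitivity (inner_product mu D (fun x => 0 * g x) g).
    by congr inner_product; apply/funext => x; rewrite mul0r.
  by rewrite ipZl// mul0r.
have [s1 H1] := IH (fun i => a (widen_ord (leqnSn k) i)) _ (fun i => sv (widen_ord (leqnSn k) i)).
have -> : (fun x => \sum_(i < k.+1) a i * v i x) = fun x => a ord_max * v ord_max x
    + \sum_(i < k) a (widen_ord (leqnSn k) i) * v (widen_ord (leqnSn k) i) x.
  by apply/funext => x; rewrite big_ord_recr addrC.
have sz : sqi mu D (fun x => a ord_max * v ord_max x) by exact: sqiZ.
split=> [|g sg]; first exact: sqiD.
by rewrite ipDl// ipZl// H1// big_ord_recr addrC.
Qed.

Lemma L2_0 : L2 mu D (fun=> 0).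
Proof. by apply/(L2P _ mD); split; exact: sqi0. Qed.

Lemma L2normsq0_ae u : L2 mu D u -> L2normsq mu D u = 0 -> ae_eq mu D u (fun=> 0).
Proof.
move=> [m1 m2 _] u0.
have msq (g : T -> R) : measurable_fun D g -> measurable_fun D (fun x => g x ^+ 2).
  by move=> mg; under eq_fun do rewrite expr2; exact: measurable_funM.
have mn : measurable_fun D (fun x => (normc (u x) ^+ 2)%:E).
  apply/measurable_EFinP; under eq_fun do rewrite normc_sqr.
  by apply: measurable_funD; exact: msq.
have := (ae_eq_integral_abs mu mD mn).1; rewrite /L2normsq in u0.
have -> : (\int[mu]_(x in D) `|(normc (u x) ^+ 2)%:E|)%E = 0.
  rewrite -u0; apply: eq_integral => x _; rewrite abse_EFin; congr EFin; rewrite ger0_norm//.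
  exact: sqr_ge0.
move=> /(_ erefl); apply: filterS => x /[apply] /= -[] /eqP.
by rewrite sqrf_eq0 => /eqP/ComplexField.Normc.eq0_normc.
Qed.

Lemma L2normsq0 : L2normsq mu D (fun=> 0) = 0%E.
Proof.
rewrite /L2normsq (eq_integral (fun=> 0%E)) ?integral0// => x _.
by rewrite ComplexField.Normc.normc0 expr2 mul0r.
Qed.

Variable Op : (T -> R[i]) -> (T -> R[i]) -> Prop.
Hypothesis Op_L2 : forall u f, Op u f -> L2 mu D u /\ L2 mu D f.
Hypothesis Op_lin : forall c u f v g, Op u f -> Op v g ->
  Op (fun x => c * u x + v x) (fun x => c * f x + g x).
Variables (n : nat) (w : 'I_n -> T -> R[i]) (m : 'I_n -> (T -> R[i]) -> R[i]) (K : R).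
Hypothesis w_L2 : forall i, L2 mu D (w i).
Hypothesis m_lin : forall i c u v, L2 mu D u -> L2 mu D v ->
  m i (fun x => c * u x + v x) = c * m i u + m i v.
Hypothesis K_ge0 : 0 <= K.

Let pert u f : T -> R[i] := fun x => f x - \sum_(i < n) m i u * w i x.
Hypothesis solvable : forall f, L2 mu D f -> exists u, Op u (pert u f).
Hypothesis bound : forall u f, L2 mu D f -> Op u (pert u f) ->
  (L2normsq mu D u <= K%:E * L2normsq mu D f)%E /\
  forall i, ((normc (m i u) ^+ 2)%:E <= K%:E * L2normsq mu D f)%E.

Let m0 i : m i (fun=> 0) = 0.
Proof.
transitivity (m i (fun x => -1 * (fun=> 0 : R[i]) x + (fun=> 0) x)).
  by congr (m i _); apply/funext => x; rewrite mulr0 addr0.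
by rewrite m_lin ?mulN1r ?addNr//; exact: L2_0.
Qed.

Let Op0 : Op (fun=> 0) (fun=> 0).
Proof.
have [u Ou] := solvable L2_0; have := Op_lin (-1) Ou Ou; congr Op.
- by apply/funext => x; rewrite mulN1r addNr.
- by apply/funext => x; rewrite mulN1r addNr.
Qed.

Let Op_comb k (c : 'I_k -> R[i]) (u f : 'I_k -> T -> R[i]) : (forall i, Op (u i) (f i)) ->
  Op (fun x => \sum_(i < k) c i * u i x) (fun x => \sum_(i < k) c i * f i x)
  /\ forall j, m j (fun x => \sum_(i < k) c i * u i x) = \sum_(i < k) c i * m j (u i).
Proof.
elim: k c u f => [|k IH] c u f Ouf.
  have z (h : 'I_0 -> T -> R[i]) : (fun x => \sum_(i < 0) c i * h i x) = fun=> 0.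
    by apply/funext => x; rewrite big_ord0.
  by rewrite !z; split=> // j; rewrite big_ord0 m0.
have E (h : 'I_k.+1 -> T -> R[i]) : (fun x => \sum_(i < k.+1) c i * h i x)
   = fun x => c ord_max * h ord_max x
       + \sum_(i < k) c (widen_ord (leqnSn k) i) * h (widen_ord (leqnSn k) i) x.
  by apply/funext => x; rewrite big_ord_recr addrC.
have [Oi M1] := IH (fun i => c (widen_ord (leqnSn k) i)) _ _ (fun i => Ouf (widen_ord (leqnSn k) i)).
rewrite !E; split=> [|j]; first exact: Op_lin (Ouf _) Oi.
have [L1 _] := Op_L2 (Ouf ord_max); have [L3 _] := Op_L2 Oi.
by rewrite m_lin// M1 big_ord_recr addrC.
Qed.

Let pert_lin c u f v g x : L2 mu D u -> L2 mu D v ->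
  c * pert u f x + pert v g x = pert (fun y => c * u y + v y) (fun y => c * f y + g y) x.
Proof.
move=> Lu Lv; rewrite /pert mulrBr addrACA -opprD mulr_sumr -big_split /=.
by congr (_ - _); apply: eq_bigr => i _; rewrite m_lin// mulrDl mulrA.
Qed.

(** An element of the kernel solves the perturbed problem with datum
    [\sum_i m i u * w i], so up to null functions it is determined by its
    coefficient vector [m u]. *)
Let kernel_finite : finite_dim_kernel mu D Op.
Proof.
pose Q (c : 'rV[R[i]]_n) := exists2 u, Op u (fun=> 0) & forall i, c 0 i = m i u.
have [||X XP] := @subspace_matrix _ n Q.
- by exists (fun=> 0) => // i; rewrite mxE m0.
- move=> a c c' [u Ou cu] [v Ov cv]; exists (fun x => a * u x + v x).
    by have := Op_lin a Ou Ov; congr Op; apply/funext => x; rewrite mulr0 addr0.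
  by move=> i; rewrite !mxE cu cv m_lin//; [case: (Op_L2 Ou)|case: (Op_L2 Ov)].
have /choice[e eP] i : exists u, Op u (fun=> 0) /\ forall j, X i j = m j u.
  have [u Ou uP] := (XP (row i X)).2 (row_sub i X); exists u; split=> // j.
  by rewrite -uP mxE.
exists n, e; split=> [i|u Ou]; first by case: (eP i).
have [Lu _] := Op_L2 Ou.
have /submxP[a aE] : ((\row_j m j u) <= X)%MS.
  by apply/XP; exists u => // i; rewrite mxE.
exists (fun i => a 0 i).
have [Oc mc] := Op_comb (fun i => a 0 i) (fun i => proj1 (eP i)).
have [Lc _] := Op_L2 Oc.
pose v x := -1 * (\sum_(i < n) a 0 i * e i x) + u x.
have Lv : L2 mu D v by exact: L2_lin.
have mv j : m j v = 0.
  rewrite /v m_lin// mc; have := congr1 (fun M : 'rV_n => M 0 j) aE; rewrite !mxE => ->.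
  rewrite mulN1r addrC; apply/eqP; rewrite subr_eq0; apply/eqP/eq_bigr => i _.
  by case: (eP i) => _ ->.
have Ov : Op v (pert v (fun=> 0)).
  have := Op_lin (-1) Oc Ou; congr Op; apply/funext => x; rewrite /pert.
  rewrite addr0 sub0r big1 => [|i _]; last by rewrite mulr0.
  by rewrite mulr0 big1 ?oppr0// => i _; rewrite mv mul0r.
have [+ _] := bound L2_0 Ov; rewrite L2normsq0 mule0 => v0.
have : L2normsq mu D v = 0.
  apply/eqP; rewrite eq_le v0 andTb; apply: integral_ge0 => x _.
  by rewrite lee_fin sqr_ge0.
move=> /(L2normsq0_ae Lv); apply: filterS => x /[apply] /= h.
by apply/eqP; rewrite -subr_eq0 addrC -mulN1r; apply/eqP.
Qed.

Let codim_finite : finite_codim_range mu D Op.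
Proof.
exists n, w; split=> // f /solvable[u Ou]; exists (fun i => m i u).
by exists u.
Qed.

(** A datum is in the range iff the coefficients of its perturbed solution lie in
    the space of those [c] for which [\sum_i c i * w i] is in the range.  They
    depend continuously on the datum, and [cokermx] expresses membership in that
    finite-dimensional space by continuous equations. *)
Let range_closed : closed_range mu D Op.
Proof.
move=> f Lf clf; have [u Ou] := solvable Lf.
pose Q (c : 'rV[R[i]]_n) := op_range Op (fun x => \sum_(i < n) c 0 i * w i x).
have [||X XP] := @subspace_matrix _ n Q.
- exists (fun=> 0); move: Op0; congr Op; apply/funext => x; rewrite big1// => i _.
  by rewrite mxE mul0r.
- move=> a c c' [v Ov] [v' Ov']; exists (fun x => a * v x + v' x).
  have := Op_lin a Ov Ov'; congr Op; apply/funext => x.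
  rewrite mulr_sumr -big_split; apply: eq_bigr => i _.
  by rewrite !mxE mulrDl mulrA.
pose c : 'rV[R[i]]_n := \row_i m i u.
(* Both directions subtract the perturbation, which is itself in the range. *)
have QcE v g : Op v (pert v g) -> (op_range Op g <-> Q (\row_i m i v)).
  have E : (fun x => \sum_(i < n) (\row_i m i v : 'rV__) 0 i * w i x) = (fun x => \sum_(i < n) m i v * w i x).
    by apply/funext => x; apply: eq_bigr => i _; rewrite mxE.
  move=> Ov; split=> [[z Oz]|[z Oz]].
    exists (fun x => (-1) * v x + z x); rewrite E; have := Op_lin (-1) Ov Oz; congr Op.
    by apply/funext => x; rewrite /pert mulN1r opprB subrK.
  exists (fun x => 1 * v x + z x); rewrite E in Oz; have := Op_lin 1 Ov Oz; congr Op.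
  by apply/funext => x; rewrite /pert mul1r subrK.
apply/(QcE u f Ou)/XP; rewrite submxE; apply/eqP/rowP => j; rewrite [RHS]mxE.
set Y := cokermx X; set z := (X in X = 0).
pose S := \sum_(i < n) normc (Y i j).
have S0 : 0 <= S by apply: sumr_ge0 => i _; exact: normc_ge0.
apply: ComplexField.Normc.eq0_normc; apply/eqP; rewrite eq_le [X in _ && X]normc_ge0 andbT.
apply: (@le0_small R _ S) => // e e0.
have K1 : 0 < K + 1 by rewrite ltr_wpDl.
have [g rg gf] := clf (e ^+ 2 / (K + 1)) (divr_gt0 (exprn_gt0 2 e0) K1).
have Lg : L2 mu D g by case: rg => v /Op_L2[].
have [v Ov] := solvable Lg.
have [Lu _] := Op_L2 Ou; have [Lv _] := Op_L2 Ov.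
have zv : (\row_i m i v) *m Y = 0.
  by apply/eqP; rewrite -submxE; apply/XP/(QcE v g Ov).
have Od : Op (fun x => -1 * v x + u x) (pert (fun x => -1 * v x + u x) (fun x => -1 * g x + f x)).
  by have := Op_lin (-1) Ov Ou; congr Op; apply/funext => x; exact: pert_lin.
have [_ bd] := bound (L2_lin (-1) Lg Lf) Od.
have md i : normc (m i u - m i v) <= e.
  have := bd i; rewrite m_lin// mulN1r addrC => h.
  rewrite -ler_sqr ?nnegrE ?(ltW e0)//; last exact: normc_ge0.
  rewrite -lee_fin; apply: le_trans h _.
  apply: (@le_trans _ _ (K%:E * (e ^+ 2 / (K + 1))%:E)%E).
    apply: lee_wpmul2l; first by rewrite lee_fin.
    apply: le_trans (ltW gf); rewrite le_eqVlt; apply/orP; left; apply/eqP.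
    by congr L2normsq; apply/funext => x; rewrite mulN1r addrC.
  by rewrite lee_fin mulrA ler_pdivrMr// mulrC ler_wpM2l ?sqr_ge0// lerDl ler01.
have -> : z = \sum_(i < n) (m i u - m i v) * Y i j.
  have cE (y : T -> R[i]) : (\row_i m i y *m Y) 0 j = \sum_(i < n) m i y * Y i j.
    by rewrite mxE; apply: eq_bigr => i _; rewrite mxE.
  have := cE v; rewrite zv [LHS]mxE => zv'.
  transitivity (\sum_(i < n) m i u * Y i j - \sum_(i < n) m i v * Y i j).
    by rewrite -zv' subr0; exact: cE.
  by rewrite -sumrB; apply: eq_bigr => i _; rewrite mulrBl.
rewrite /S mulr_sumr; elim/big_ind2: _ => [|x1 x2 y1 y2 h1 h2|i _].
- by rewrite ComplexField.Normc.normc0.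
- by apply: le_trans (le_normcD _ _) _; exact: lerD.
- by rewrite ComplexField.Normc.normcM ler_wpM2r//; exact: normc_ge0.
Qed.

(** If a finite-rank perturbation of an operator is boundedly invertible, the
    operator is Fredholm: modulo the solution map of the perturbed problem,
    kernel and range are described by the coefficient vectors [m u], that is
    by linear subspaces of a finite-dimensional space. *)
Theorem finite_rank_perturbation_Fredholm : Fredholm mu D Op.
Proof. by split; [exact: kernel_finite|exact: range_closed|exact: codim_finite]. Qed.

End FiniteRankPerturbation.

(** * The Fredholm property off the half-line *)

Section GuideForm.
Context {R : realType}.
Variable D : set (R * R).

Let MR2 := (measurableTypeR R * measurableTypeR R)%type.
Hypothesis mD : measurable (D : set MR2).

Local Notation ipD := (inner_product (@area R) (D : set MR2)).
Local Notation sqA := (sqi (@area R) (D : set MR2)).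
Implicit Types (U W : @jet R) (f g eta : R * R -> R) (u h : R * R -> R[i]).

Let ipS f g : ipD f g = ipD g f. Proof. exact: ipC. Qed.

Definition mass U W := ipD U.1.1 W.1.1.
Definition energy U W := ipD U.1.2 W.1.2 + ipD U.2 W.2.

Lemma ipj_mass_energy U W : ipj D U W = mass U W + energy U W.
Proof. by rewrite /ipj /mass /energy addrA. Qed.

Lemma energy_ge0 U : 0 <= energy U U.
Proof. by rewrite addr_ge0// ip_ge0. Qed.

Lemma mass_sym U W : mass U W = mass W U.
Proof. exact: ipS. Qed.

Lemma mass_ge0 U : 0 <= mass U U.
Proof. exact: ip_ge0. Qed.

Lemma mass_le U : mass U U <= ipj D U U.
Proof. by rewrite ipj_mass_energy lerDl energy_ge0. Qed.

Lemma ipj_bilinear_form_dom : bilinear_on (form_dom D) (ipj D).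
Proof.
have [L1 L2] := ipj_bilinear mD.
by split=> a U V W hU hV hW; [apply: L1|apply: L2]; exact: form_dom_sqj.
Qed.

Let sq0 U : form_dom D U -> sqA U.1.1. Proof. by case/form_dom_sqj. Qed.
Let sq1 U : form_dom D U -> sqA U.1.2. Proof. by case/form_dom_sqj. Qed.
Let sq2 U : form_dom D U -> sqA U.2. Proof. by case/form_dom_sqj. Qed.

(** Mass and energy are sums of such forms. *)
Lemma bounded_form_component (pr : @jet R -> R * R -> R) :
  (forall a U W, pr (a *: U + W) = (fun x => a * pr U x + pr W x)) ->
  (forall U, sqj D U -> sqA (pr U)) -> (forall U, ipD (pr U) (pr U) <= ipj D U U) ->
  bounded_form (sqj D) (ipj D) (fun U W => ipD (pr U) (pr W)).
Proof.
move=> prL prS prB.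
have L a U V W : sqj D U -> sqj D V -> sqj D W ->
    ipD (pr (a *: U + V)) (pr W) = a * ipD (pr U) (pr W) + ipD (pr V) (pr W).
  by move=> /prS hU /prS hV /prS hW; rewrite prL; exact: (ip_lin1 mD a hU hV hW).
split.
  by split=> a U V W hU hV hW; [exact: L|rewrite !(ipS (pr W)); exact: L].
exists 1 => // U W hU hW; rewrite mul1r.
apply: le_trans (ip_CS mD (prS U hU) (prS W hW)) _.
by apply: ler_pM; rewrite ?ip_ge0 ?prB.
Qed.

Lemma bounded_form_mass : bounded_form (sqj D) (ipj D) mass.
Proof.
by apply: (@bounded_form_component (fun U => U.1.1)) => // [U [] //|U]; exact: mass_le.
Qed.

Lemma bounded_form_energy : bounded_form (sqj D) (ipj D) energy.
Proof.
have b1 : bounded_form (sqj D) (ipj D) (fun U W => ipD U.1.2 W.1.2).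
  apply: (@bounded_form_component (fun U => U.1.2)) => // [U [] //|U].
  by rewrite /ipj addrAC lerDr addr_ge0// ip_ge0.
have b2 : bounded_form (sqj D) (ipj D) (fun U W => ipD U.2 W.2).
  apply: (@bounded_form_component (fun U => U.2)) => // [U [] //|U].
  by rewrite /ipj lerDr addr_ge0// ip_ge0.
have := bounded_form_lin 1 b1 b2.
by congr bounded_form; apply/funext => U; apply/funext => W; rewrite mul1r.
Qed.

Lemma bounded_functional_ip f : sqA f -> bounded_functional (sqj D) (ipj D) (fun U => ipD f U.1.1).
Proof.
move=> sf; split=> [a U V [hU _ _] [hV _ _]|].
  by rewrite !(ipS f); exact: (ip_lin1 mD a hU hV sf).
exists (ipD f f); first exact: ip_ge0.
move=> U [hU _ _]; apply: le_trans (ip_CS mD sf hU) _.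
by rewrite ler_wpM2l ?ip_ge0 ?mass_le.
Qed.

(** Testing against the whole form domain is what Lax-Milgram provides and what
    the a priori bound needs. *)
Lemma weak_sol_form U f : sqA f -> weak_sol D U f <->
  form_dom D U /\ forall W, form_dom D W -> energy U W = ipD f W.1.1.
Proof.
move=> sf; split=> -[hU H]; split=> //.
  move=> W hW; have sN : sqA (fun x => - f x).
    by have := sqiZ mD (-1) sf; congr sqi; apply/funext => x; rewrite mulN1r.
  have H' : ipD W.1.1 (fun x => - f x) + ipD W.1.2 U.1.2 + ipD W.2 U.2 = 0.
    apply: (ip_density mD hW sN (sq1 hU) (sq2 hU)) => eta te.
    have [t0 t1 t2] := sq_test mD te.
    rewrite (ipS eta) (ipS ('D_e1 eta)) (ipS ('D_e2 eta)).
    by rewrite (ipNl mD sf t0) -addrA H// addNr.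
  move: H'; rewrite (ipS W.1.1) (ipNl mD sf (sq0 hW)) (ipS W.1.2) (ipS W.2).
  by move=> H'; rewrite /energy; lra.
move=> eta te; exact: (H (jet_of eta) (form_dom_test mD te)).
Qed.

Section Shift.
Variables (a b : R).

(** Real and imaginary part of the weak equation (A - (a + i b)) u = h. *)
Definition shift_forms u h U1 U2 :=
  [/\ form_dom D U1, form_dom D U2, U1.1.1 = re u & U2.1.1 = im u] /\
  (forall W, form_dom D W -> energy U1 W - a * mass U1 W + b * mass U2 W = ipD (re h) W.1.1) /\
  (forall W, form_dom D W -> energy U2 W - a * mass U2 W - b * mass U1 W = ipD (im h) W.1.1).

Lemma re_shift u h : re (fun x => h x + (a +i* b) * u x)
  = (fun x => a * re u x + ((- b) * im u x + re h x)).
Proof.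
by apply/funext => x; rewrite /re /im; case: (u x) (h x) => p q [p' q'] /=; ring.
Qed.

Lemma im_shift u h : im (fun x => h x + (a +i* b) * u x)
  = (fun x => a * im u x + (b * re u x + im h x)).
Proof.
by apply/funext => x; rewrite /re /im; case: (u x) (h x) => p q [p' q'] /=; ring.
Qed.

Lemma op_shiftP u h : L2 area (D : set MR2) h ->
  op_shift (dirichlet_laplacian D) (a +i* b) u h <-> exists U1 U2, shift_forms u h U1 U2.
Proof.
move=> Lh; have [h1 h2] := (L2P _ mD h).1 Lh.
have key U1 U2 (k : R * R -> R[i]) : form_dom D U1 -> form_dom D U2 -> U1.1.1 = re u -> U2.1.1 = im u ->
    k = (fun x => h x + (a +i* b) * u x) ->
    [/\ sqA (re k), sqA (im k), forall W, form_dom D W -> ipD (re k) W.1.1 = a * mass U1 W - b * mass U2 W + ipD (re h) W.1.1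
    & forall W, form_dom D W -> ipD (im k) W.1.1 = a * mass U2 W + b * mass U1 W + ipD (im h) W.1.1].
  move=> d1 d2 E1 E2 ->; rewrite re_shift im_shift -E1 -E2.
  have s1 := sq0 d1; have s2 := sq0 d2; split.
  - by apply: (sqi_lin1 mD) => //; exact: (sqi_lin1 mD).
  - by apply: (sqi_lin1 mD) => //; exact: (sqi_lin1 mD).
  - move=> W /sq0 hW; rewrite (ip_lin1 mD a s1 (sqi_lin1 mD (- b) s2 h1) hW).
    by rewrite (ip_lin1 mD (- b) s2 h1 hW) /mass; ring.
  - move=> W /sq0 hW; rewrite (ip_lin1 mD a s2 (sqi_lin1 mD b s1 h2) hW).
    by rewrite (ip_lin1 mD b s1 h2 hW) /mass; ring.
split=> [/(dirichlet_forward mD)[Lk [U1 [U2 [w1 w2 [E1 E2]]]]]|[U1 [U2 [[d1 d2 E1 E2] [H1 H2]]]]].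
  have d1 := proj1 w1; have d2 := proj1 w2.
  have [k1 k2 K1 K2] := key U1 U2 _ d1 d2 E1 E2 erefl.
  have [_ H1] := (weak_sol_form U1 k1).1 w1; have [_ H2] := (weak_sol_form U2 k2).1 w2.
  exists U1, U2; split=> //; split=> W hW.
  - by rewrite (H1 W hW) (K1 W hW); ring.
  - by rewrite (H2 W hW) (K2 W hW); ring.
have [k1 k2 K1 K2] := key U1 U2 _ d1 d2 E1 E2 erefl.
apply: (dirichlet_backward mD _ _ _ E1 E2).
- exact/(L2P _ mD).
- by apply/(weak_sol_form _ k1); split=> // W hW; have := H1 W hW; rewrite (K1 W hW); lra.
- by apply/(weak_sol_form _ k2); split=> // W hW; have := H2 W hW; rewrite (K2 W hW); lra.
Qed.

Lemma op_shift_L2 u h : op_shift (dirichlet_laplacian D) (a +i* b) u h ->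
  L2 area (D : set MR2) u /\ L2 area (D : set MR2) h.
Proof.
move=> [[Lu _] Lk _]; split=> //.
have := L2_lin mD (- (a +i* b)) Lu Lk; congr L2; apply/funext => x.
by rewrite mulNr addrC addrK.
Qed.

Lemma re_lin (c : R[i]) u h : re (fun x => c * u x + h x)
  = (fun x => complex.Re c * re u x + (- complex.Im c * im u x + re h x)).
Proof.
by apply/funext => x; rewrite /re /im; case: c (u x) (h x) => c1 c2 [p q] [p' q'] /=; ring.
Qed.

Lemma im_lin (c : R[i]) u h : im (fun x => c * u x + h x)
  = (fun x => complex.Re c * im u x + (complex.Im c * re u x + im h x)).
Proof.
by apply/funext => x; rewrite /re /im; case: c (u x) (h x) => c1 c2 [p q] [p' q'] /=; ring.
Qed.

Lemma op_shift_lin (c : R[i]) u h v k : op_shift (dirichlet_laplacian D) (a +i* b) u h ->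
  op_shift (dirichlet_laplacian D) (a +i* b) v k ->
  op_shift (dirichlet_laplacian D) (a +i* b) (fun x => c * u x + v x) (fun x => c * h x + k x).
Proof.
move=> O1 O2; have [_ Lh] := op_shift_L2 O1; have [_ Lk] := op_shift_L2 O2.
have [h1 h2] := (L2P _ mD h).1 Lh; have [k1 k2] := (L2P _ mD k).1 Lk.
have [U1 [U2 [[d1 d2 E1 E2] [H1 H2]]]] := (op_shiftP u Lh).1 O1.
have [V1 [V2 [[p1 p2 F1 F2] [K1 K2]]]] := (op_shiftP v Lk).1 O2.
apply/op_shiftP; first exact: L2_lin.
set c1 := complex.Re c; set c2 := complex.Im c.
have fl := @form_dom_lin R D mD.
exists (c1 *: U1 + ((- c2) *: U2 + V1)), (c1 *: U2 + (c2 *: U1 + V2)).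
have [[EL _] _] := bounded_formS (@form_dom_sqj R D) bounded_form_energy.
have [[ML _] _] := bounded_formS (@form_dom_sqj R D) bounded_form_mass.
have q1 := fl (- c2) _ _ d2 p1; have q2 := fl c2 _ _ d1 p2.
split; first split.
- exact: fl.
- exact: fl.
- by rewrite re_lin -E1 -E2 -F1.
- by rewrite im_lin -E1 -E2 -F2.
rewrite re_lin im_lin; split=> W hW.
- have hW0 := sq0 hW.
  rewrite (ip_lin1 mD _ h1 (sqi_lin1 mD _ h2 k1) hW0) (ip_lin1 mD _ h2 k1 hW0).
  rewrite (EL _ _ _ _ d1 q1 hW) (EL _ _ _ _ d2 p1 hW) (ML _ _ _ _ d1 q1 hW) (ML _ _ _ _ d2 p1 hW).
  rewrite (ML _ _ _ _ d2 q2 hW) (ML _ _ _ _ d1 p2 hW).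
  by rewrite -(H1 W hW) -(H2 W hW) -(K1 W hW); ring.
- have hW0 := sq0 hW.
  rewrite (ip_lin1 mD _ h2 (sqi_lin1 mD _ h1 k2) hW0) (ip_lin1 mD _ h1 k2 hW0).
  rewrite (EL _ _ _ _ d2 q2 hW) (EL _ _ _ _ d1 p2 hW) (ML _ _ _ _ d1 q1 hW) (ML _ _ _ _ d2 p1 hW).
  rewrite (ML _ _ _ _ d2 q2 hW) (ML _ _ _ _ d1 p2 hW).
  by rewrite -(H1 W hW) -(H2 W hW) -(K2 W hW); ring.
Qed.

Variables (mu t C : R) (n : nat) (w : 'I_n -> R * R -> R).
Hypothesis mu_ge0 : 0 <= mu.
Hypothesis ab_lt : a - t * b < mu.
Hypothesis C_ge0 : 0 <= C.
Hypothesis w_sq : forall i, sqA (w i).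
Hypothesis coercive : forall f, rtest D f -> mu * ipD f f <=
  ipD ('D_e1 f) ('D_e1 f) + ipD ('D_e2 f) ('D_e2 f) + C * \sum_(i < n) (ipD f (w i)) ^+ 2.

Let E U W := energy U W + C * \sum_(i < n) ipD (w i) U.1.1 * ipD (w i) W.1.1.

Let bE : bounded_form (sqj D) (ipj D) E.
Proof.
have bs := bounded_form_sum (ipj_ge0 D) (fun i => bounded_form_rank1 (ipj_ge0 D) (bounded_functional_ip (w_sq i))).
have := bounded_form_lin C bs bounded_form_energy.
by congr bounded_form; apply/funext => U; apply/funext => W; rewrite /E addrC.
Qed.

Let E_sym U W : E U W = E W U.
Proof.
rewrite /E /energy; congr (_ + _ + _ * _); [exact: ipC|exact: ipC|].
by apply: eq_bigr => i _; rewrite mulrC.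
Qed.

Let IP_le U : form_dom D U -> ipj D U U <= mass U U + E U U.
Proof.
move=> _; rewrite ipj_mass_energy lerD2l /E lerDl mulr_ge0//.
by apply: sumr_ge0 => i _; rewrite -expr2 sqr_ge0.
Qed.

Let E_ge U : form_dom D U -> mu * mass U U <= E U U.
Proof.
move=> hU; rewrite -subr_ge0.
have -> : E U U - mu * mass U U = - mu * mass U U + E U U by rewrite addrC mulNr.
have bQ := bounded_form_lin (- mu) bounded_form_mass bE.
apply: (closure_of_form_ge0 (sqj_lin mD) (ipj_ge0 D) (test_jet_sqj mD) bQ) hU.
move=> _ [f tf ->]; have := coercive tf.
rewrite /mass /E /energy /=; under eq_bigr do rewrite ipS expr2.
lra.
Qed.

Let wc i : R * R -> R[i] := fun x => (w i x)%:C.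
Let m i u : R[i] := (C * ipD (w i) (re u)) +i* (C * ipD (w i) (im u)).
Let pert u (f : R * R -> R[i]) : R * R -> R[i] := fun x => f x - \sum_(i < n) m i u * wc i x.

Let re_pert u (f : R * R -> R[i]) : re (pert u f) = fun x => re f x - \sum_(i < n) C * ipD (w i) (re u) * w i x.
Proof.
apply/funext => x; rewrite /re /pert raddfB /= raddf_sum; congr (_ - _).
by apply: eq_bigr => i _; rewrite /= mulr0 subr0.
Qed.

Let im_pert u (f : R * R -> R[i]) : im (pert u f) = fun x => im f x - \sum_(i < n) C * ipD (w i) (im u) * w i x.
Proof.
apply/funext => x; rewrite /im /pert raddfB /= raddf_sum; congr (_ - _).
by apply: eq_bigr => i _; rewrite /= mulr0 add0r.
Qed.

Let ip_pert g f U W : sqA f -> form_dom D W -> U.1.1 = g ->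
  sqA (fun x => f x - \sum_(i < n) C * ipD (w i) g * w i x) /\
  ipD (fun x => f x - \sum_(i < n) C * ipD (w i) g * w i x) W.1.1
  = ipD f W.1.1 - (E U W - energy U W).
Proof.
move=> sf /sq0 hW <-.
have [s1 H1] := sqi_comb mD (fun i => C * ipD (w i) U.1.1) w_sq.
split; first exact: (sqiB mD).
rewrite (ipBl mD sf s1 hW) H1// /E [energy _ _ + _]addrC addrK mulr_sumr; congr (_ - _).
by apply: eq_bigr => i _; rewrite mulrA.
Qed.

Let form_dom0' : form_dom D 0 := form_dom0 mD.

Let op_pertP u (f : R * R -> R[i]) : L2 area (D : set MR2) f ->
  op_shift (dirichlet_laplacian D) (a +i* b) u (pert u f) <-> exists U1 U2,
  [/\ form_dom D U1, form_dom D U2, U1.1.1 = re u & U2.1.1 = im u] /\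
  (forall W, form_dom D W -> E U1 W - a * mass U1 W + b * mass U2 W = ipD (re f) W.1.1) /\
  (forall W, form_dom D W -> E U2 W - a * mass U2 W - b * mass U1 W = ipD (im f) W.1.1).
Proof.
move=> Lf; have [f1 f2] := (L2P _ mD f).1 Lf.
have key U1 U2 : U1.1.1 = re u -> U2.1.1 = im u -> L2 area (D : set MR2) (pert u f) /\
   forall W, form_dom D W -> ipD (re (pert u f)) W.1.1 = ipD (re f) W.1.1 - (E U1 W - energy U1 W)
     /\ ipD (im (pert u f)) W.1.1 = ipD (im f) W.1.1 - (E U2 W - energy U2 W).
  move=> E1 E2; split.
    apply/(L2P _ mD); rewrite re_pert im_pert.
    by split; [case: (ip_pert f1 form_dom0' E1)|case: (ip_pert f2 form_dom0' E2)].
  by move=> W hW; rewrite re_pert im_pert; split; [case: (ip_pert f1 hW E1)|case: (ip_pert f2 hW E2)].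
split=> [Oup|[U1 [U2 [[d1 d2 E1 E2] [H1 H2]]]]].
  have [_ Lp] := op_shift_L2 Oup; have [U1 [U2 [[d1 d2 E1 E2] [H1 H2]]]] := (op_shiftP u Lp).1 Oup.
  have [_ K] := key U1 U2 E1 E2.
  exists U1, U2; split=> //; split=> W hW; have [K1 K2] := K W hW.
  - by have := H1 W hW; rewrite K1; lra.
  - by have := H2 W hW; rewrite K2; lra.
have [Lp K] := key U1 U2 E1 E2; apply/(op_shiftP u Lp).
exists U1, U2; split=> //; split=> W hW; have [K1 K2] := K W hW.
- by rewrite K1; have := H1 W hW; lra.
- by rewrite K2; have := H2 W hW; lra.
Qed.

Let dom_sqj : forall U, form_dom D U -> sqj D U := @form_dom_sqj R D.

Let solvable (f : R * R -> R[i]) : L2 area (D : set MR2) f ->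
  exists u, op_shift (dirichlet_laplacian D) (a +i* b) u (pert u f).
Proof.
move=> Lf; have [f1 f2] := (L2P _ mD f).1 Lf.
have bf g : sqA g -> bounded_functional (form_dom D) (ipj D) (fun U => ipD g U.1.1).
  move=> sg; have [lin [L L0 Lb]] := bounded_functional_ip sg.
  by split=> [x U V hU hV|]; [apply: lin; exact: dom_sqj|exists L => // v /dom_sqj; exact: Lb].
have [U1 [U2 [d1 d2 H1 H2]]] := complex_resolvent_exists (@form_dom_lin R D mD) form_dom0'
  ipj_bilinear_form_dom (@ipj_sym R D) (ipj_ge0 D) (@form_dom_complete R D mD)
  (bounded_formS dom_sqj bE) (bounded_formS dom_sqj bounded_form_mass) E_sym
  mass_sym mass_ge0 IP_le E_ge mu_ge0 ab_lt
  (bf _ f1) (bf _ f2).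
exists (fun x => U1.1.1 x +i* U2.1.1 x); apply/(op_pertP _ Lf).
by exists U1, U2.
Qed.

Let bound : exists2 K, 0 <= K & forall u (f : R * R -> R[i]), L2 area (D : set MR2) f ->
  op_shift (dirichlet_laplacian D) (a +i* b) u (pert u f) ->
  (L2normsq area (D : set MR2) u <= K%:E * L2normsq area (D : set MR2) f)%E /\
  forall i, ((ComplexField.Normc.normc (m i u) ^+ 2)%:E <= K%:E * L2normsq area (D : set MR2) f)%E.
Proof.
have [K K0 KP] := complex_resolvent_bound E_sym mass_sym mass_ge0 (fun U _ => mass_le U) IP_le E_ge mu_ge0 ab_lt.
pose s := \sum_(i < n) ipD (w i) (w i).
have s0 : 0 <= s by apply: sumr_ge0 => i _; exact: ip_ge0.
exists (K * (1 + C ^+ 2 * s)).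
  by rewrite mulr_ge0// addr_ge0// mulr_ge0// sqr_ge0.
move=> u f Lf Oupf; have [f1 f2] := (L2P _ mD f).1 Lf.
have [U1 [U2 [[d1 d2 E1 E2] [H1 H2]]]] := (op_pertP u Lf).1 Oupf.
have [u1 u2] := (L2P _ mD u).1 (proj1 (op_shift_L2 Oupf)).
pose L := ipD (re f) (re f) + ipD (im f) (im f).
have L0 : 0 <= L by rewrite addr_ge0// ip_ge0.
have lb g : sqA g -> ipD g g <= L -> forall W, form_dom D W -> ipD g W.1.1 ^+ 2 <= L * mass W W.
  move=> sg gL W /sq0 hW; apply: le_trans (ip_CS mD sg hW) _.
  by rewrite ler_wpM2r ?ip_ge0.
have l1 : ipD (re f) (re f) <= L by rewrite lerDl ip_ge0.
have l2 : ipD (im f) (im f) <= L by rewrite lerDr ip_ge0.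
have := KP U1 U2 (fun W => ipD (re f) W.1.1) (fun W => ipD (im f) W.1.1) L L0 d1 d2 (lb _ f1 l1) (lb _ f2 l2) H1 H2.
rewrite /mass E1 E2 => KL.
rewrite (L2normsqE mD u1 u2) (L2normsqE mD f1 f2) -/L -EFinM lee_fin; split=> [|i].
  apply: le_trans KL _; rewrite -mulrA ler_wpM2l// mulrDl mul1r lerDl.
  by rewrite !mulr_ge0// sqr_ge0.
rewrite lee_fin normc_sqr /= !exprMn -mulrDr.
have si : ipD (w i) (w i) <= s.
  rewrite /s (bigD1 i)//= lerDl; apply: sumr_ge0 => j _; exact: ip_ge0.
have c1 := ip_CS mD (w_sq i) u1; have c2 := ip_CS mD (w_sq i) u2.
have h : ipD (w i) (re u) ^+ 2 + ipD (w i) (im u) ^+ 2 <= s * (K * L).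
  apply: (@le_trans _ _ (ipD (w i) (w i) * (ipD (re u) (re u) + ipD (im u) (im u)))).
    by rewrite mulrDr lerD.
  by apply: ler_pM; rewrite ?ip_ge0 ?addr_ge0 ?ip_ge0.
apply: (@le_trans _ _ (C ^+ 2 * (s * (K * L)))); first by rewrite ler_wpM2l ?sqr_ge0.
rewrite (_ : K * (1 + C ^+ 2 * s) * L = K * L + C ^+ 2 * (s * (K * L))); last by ring.
by rewrite lerDr mulr_ge0.
Qed.

Let m_lin i (c : R[i]) u v : L2 area (D : set MR2) u -> L2 area (D : set MR2) v ->
  m i (fun x => c * u x + v x) = c * m i u + m i v.
Proof.
move=> /(L2P _ mD)[u1 u2] /(L2P _ mD)[v1 v2]; rewrite /m re_lin im_lin.
rewrite (ipS (w i)) (ip_lin1 mD _ u1 (sqi_lin1 mD _ u2 v1) (w_sq i)) (ip_lin1 mD _ u2 v1 (w_sq i)).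
rewrite (ipS (w i)) (ip_lin1 mD _ u2 (sqi_lin1 mD _ u1 v2) (w_sq i)) (ip_lin1 mD _ u1 v2 (w_sq i)).
rewrite !(ipS (w i)); case: c => c1 c2 /=.
by rewrite -[RHS]/((_ - _ + _) +i* (_ + _ + _)); congr (_ +i* _); ring.
Qed.

(** Adding [C \sum_i (u, w i) w i] to the operator turns coercivity up to finitely
    many functionals into coercivity, so the perturbed operator is boundedly
    invertible. *)
Lemma coercive_Fredholm :
  Fredholm area (D : set MR2) (op_shift (dirichlet_laplacian D) (a +i* b)).
Proof.
have [K K0 KP] := bound.
apply: (@finite_rank_perturbation_Fredholm _ _ _ (@area R) (D : set MR2) mD _ _ _ n wc m K) => //.
- exact: op_shift_L2.
- by move=> c u f v g; exact: op_shift_lin.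
- move=> i; apply/(L2P _ mD); split; first exact: w_sq.
  exact: sqi0.
Qed.

End Shift.
End GuideForm.

Section GuideFredholm.
Context {R : realType}.
Variable theta : R.
Hypothesis theta_gt0 : 0 < theta.
Hypothesis theta_lt : theta < pi / 2.

Theorem guide_Fredholm (lambda : R[i]) : ~ (exists2 x : R, 1 <= x & lambda = x%:C) ->
  Fredholm area (broken_guide theta) (op_shift (dirichlet_laplacian (broken_guide theta)) lambda).
Proof.
case: lambda => a b nab.
(* Only a real parameter must be below 1: otherwise the imaginary part helps. *)
have [t ht] : exists t, a - t * b < 1.
  have [b0|bn] := eqVneq b 0; last first.
    by exists (a / b); rewrite divfK// subrr ltr01.
  exists 0; rewrite mul0r subr0 ltNge; apply/negP => a1; apply: nab; exists a => //.
  by rewrite b0.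
(* Any number strictly between the shifted spectral parameter and 1 would do. *)
pose mu : R := Num.max ((a - t * b + 1) / 2) 0.
have mu0 : 0 <= mu by rewrite le_max lexx orbT.
have mu1 : mu < 1 by rewrite gt_max ltr01 andbT; lra.
have ab : a - t * b < mu by rewrite lt_max; apply/orP; left; lra.
have [n [w [C [C0 sw H]]]] := guide_coercive theta_gt0 theta_lt mu1.
exact: (coercive_Fredholm (guide_measurable theta_gt0 theta_lt) mu0 ab C0 sw H).
Qed.

End GuideFredholm.

(** * Quasimodes and infinite codimension *)

Section QuasimodeObstruction.
Context {d : measure_display} {T : measurableType d} {R : realType}.
Variables (mu : {measure set T -> \bar R}) (D : set T).
Hypothesis mD : measurable D.
Implicit Types (u f : T -> R[i]).
Local Notation ip := (inner_product mu D).

Variable v : nat -> T -> R.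
Hypothesis v_sqi : forall n, sqi mu D (v n).
Hypothesis v_ortho : forall m n, ip (v m) (v n) = (m == n)%:R.

Lemma orthonormal_series (b : nat -> R) : (forall n, `|b n| <= 2^-1 ^+ n) ->
  exists2 h, sqi mu D h & forall n, ip h (v n) = b n.
Proof.
move=> bn; pose f (k : nat) x := \sum_(i < k) b i * v i x.
have sf k : sqi mu D (f k) by case: (sqi_comb mD (fun i : 'I_k => b i) (fun i => v_sqi i)).
have fv k n : ip (f k) (v n) = if (n < k)%N then b n else 0.
  have [_ ->//] := sqi_comb mD (fun i : 'I_k => b i) (fun i => v_sqi i).
  case: ifPn => nk.
    rewrite (bigD1 (Ordinal nk))//= v_ortho eqxx mulr1 big1 ?addr0// => i.
    by move=> /eqP/eqP; rewrite v_ortho -val_eqE /= => /negbTE ->; rewrite mulr0.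
  rewrite big1// => i _; rewrite v_ortho; case: eqP => [E|]; last by rewrite mulr0.
  by move: nk; rewrite -E ltn_ord.
pose S (m : nat) := \sum_(i < m) b i ^+ 2.
have ff m n : (n <= m)%N -> ip (f m) (f n) = S n.
  move=> nm; have [_ H] := sqi_comb mD (fun i : 'I_n => b i) (fun i => v_sqi i).
  rewrite ipC H//; apply: eq_bigr => i _.
  by rewrite ipC fv (leq_trans (ltn_ord i) nm) expr2.
have dist m n : (n <= m)%N -> ip (fun x => f m x - f n x) (fun x => f m x - f n x) = S m - S n.
  move=> nm; have sB : sqi mu D (fun x => f m x - f n x) by exact: sqiB.
  rewrite ipBl// !ipBr// (ipC mu D (f n)) !ff//; ring.
have q0 (n : nat) : 0 < (2^-1 : R) ^+ n by rewrite exprn_gt0// invr_gt0.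
have Sn m n : (n <= m)%N -> S m - S n <= 2 * 2^-1 ^+ n.
  move=> /subnK <-; move: (m - n)%N => k.
  suff : S (k + n)%N + 2 * 2^-1 ^+ (k + n) <= S n + 2 * 2^-1 ^+ n.
    by have := q0 (k + n)%N; lra.
  elim: k => // k IH; apply: le_trans IH; rewrite addSn /S big_ord_recr /= [2^-1 ^+ _.+1]exprS.
  have : b (k + n)%N ^+ 2 <= 2^-1 ^+ (k + n).
    rewrite -real_normK ?num_real//; apply: (@le_trans _ _ ((2^-1 ^+ (k + n)) ^+ 2)).
      by rewrite ler_sqr ?nnegrE// ltW.
    by rewrite expr2 ler_piMl ?exprn_ile1 ?invr_ge0 ?invf_le1 ?ler1n ?(ltW (q0 _)).
  lra.
have qN (N : nat) : (2^-1 : R) ^+ N <= N.+1%:R^-1.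
  by rewrite exprVn lef_pV2 ?posrE ?exprn_gt0// -natrX ler_nat ltn_expl.
have [e e0|h sh hf] := L2_complete mD sf.
  have e4 : 0 < e / 2 by lra.
  have [N NP] := natSinv_small e4; exists N => m n Nm Nn.
  have q_le k : (N <= k)%N -> 2 * (2^-1 : R) ^+ k < e.
    move=> Nk; have := qN k; have : (k.+1%:R : R)^-1 <= N.+1%:R^-1.
      by rewrite lef_pV2 ?posrE ?ltr0n// ler_nat.
    move: NP; set x := N.+1%:R^-1; set y := _ ^+ k; set z := k.+1%:R^-1.
    clearbody x y z; clear => h1 h2 h3; lra.
  have [mn|nm] := leqP m n; last first.
    by rewrite dist ?(ltnW nm)//; apply: le_lt_trans (Sn _ _ (ltnW nm)) (q_le _ Nn).
  have -> : ip (fun x => f m x - f n x) (fun x => f m x - f n x)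
     = ip (fun x => f n x - f m x) (fun x => f n x - f m x).
    by rewrite !ipE; congr Rintegral; apply/funext => x; ring.
  by rewrite dist//; apply: le_lt_trans (Sn _ _ mn) (q_le _ Nm).
exists h => // n; apply/eqP; rewrite -subr_eq0 -sqrf_eq0 eq_le sqr_ge0 andbT.
apply: (@le0_small _ _ 1) => // e e0; rewrite mulr1.
have [N NP] := hf e e0; pose k := maxn N n.+1.
have hk := NP k (leq_maxl _ _).
have E : ip h (v n) - b n = - ip (fun x => f k x - h x) (v n).
  by rewrite ipBl// fv leq_maxr opprB.
rewrite E sqrrN; apply: le_trans (ip_CS mD _ (v_sqi n)) _; first exact: sqiB.
by rewrite v_ortho eqxx mulr1 ltW.
Qed.

Variable Op : (T -> R[i]) -> (T -> R[i]) -> Prop.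
Hypothesis Op_lin : forall c u f u' f', Op u f -> Op u' f' ->
  Op (fun x => c * u x + u' x) (fun x => c * f x + f' x).
Hypothesis quasimode : forall u f, Op u f -> exists B : R, forall n,
  `|ip (re f) (v n)| <= B * 4^-1 ^+ n /\ `|ip (im f) (v n)| <= B * 4^-1 ^+ n.

(** Functions in the range have rapidly decaying coefficients along the
    quasimodes [v n], whereas the series [h j], supported on the residue class
    of [j] modulo [N + 1], decay slowly: they are independent modulo the range,
    and there are more of them than the alleged codimension [N]. *)
Theorem quasimode_infinite_codim : ~ finite_codim_range mu D Op.
Proof.
move=> [N [e [Le eP]]].
pose b (j : 'I_N.+1) n : R := if (n %% N.+1 == j)%N then 2^-1 ^+ n else 0.
have q0 (n : nat) : 0 < (2^-1 : R) ^+ n by rewrite exprn_gt0// invr_gt0.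
have /choice[h hP] j : exists h, sqi mu D h /\ forall n, ip h (v n) = b j n.
  have [n|h sh hP] := @orthonormal_series (b j); last by exists h.
  by rewrite /b; case: ifP => _; rewrite ?normr0 ?ger0_norm// ltW.
pose hc j x : R[i] := (h j x)%:C.
have Lh j : L2 mu D (hc j).
  by apply/(L2P _ mD); split; [exact: (proj1 (hP j))|exact: sqi0].
have /choice[c cP] j : exists c : 'I_N -> R[i], op_range Op (fun x => hc j x - \sum_(i < N) c i * e i x).
  exact: eP.
pose M := \matrix_(j < N.+1, i < N) c j i.
have kM : kermx M != 0.
  rewrite -mxrank_eq0 mxrank_ker subn_eq0 -ltnNge ltnS; exact: rank_leq_col.
have /rowV0Pn[a /sub_kermxP aM a0] := kM.
have Op0 : op_range Op (fun=> 0).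
  have [u Ou] := cP ord0; exists (fun x => -1 * u x + u x).
  by have := Op_lin (-1) Ou Ou; congr Op; apply/funext => x; rewrite mulN1r addNr.
have comb k (al : 'I_k -> R[i]) (f : 'I_k -> T -> R[i]) : (forall i, op_range Op (f i)) ->
    op_range Op (fun x => \sum_(i < k) al i * f i x).
  elim: k al f => [|k IH] al f rf.
    by move: Op0; congr op_range; apply/funext => x; rewrite big_ord0.
  have [u Ou] := IH (fun i => al (widen_ord (leqnSn k) i)) _ (fun i => rf (widen_ord (leqnSn k) i)).
  have [u' Ou'] := rf ord_max; exists (fun x => al ord_max * u' x + u x).
  by have := Op_lin (al ord_max) Ou' Ou; congr Op; apply/funext => x; rewrite big_ord_recr addrC.
have [u Ou] : op_range Op (fun x => \sum_(j < N.+1) a 0 j * hc j x).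
  have := comb _ (fun j => a 0 j) _ cP; congr op_range; apply/funext => x.
  under eq_bigr do rewrite mulrBr; rewrite sumrB [X in _ - X](_ : _ = 0) ?subr0//.
  under eq_bigr do rewrite mulr_sumr; rewrite exchange_big /= big1// => i _.
  have := congr1 (fun X : 'rV_N => X 0 i) aM; rewrite !mxE => E.
  transitivity ((\sum_j a 0 j * M j i) * e i x); last by rewrite E mul0r.
  by rewrite mulr_suml; apply: eq_bigr => j _; rewrite mxE mulrA.
have [B BP] := quasimode Ou.
have comp (p : R[i] -> R) (g : T -> R) : g = (fun x => \sum_(j < N.+1) p (a 0 j) * h j x) ->
    (forall n, `|ip g (v n)| <= B * 4^-1 ^+ n) -> forall j, p (a 0 j) = 0.
  move=> -> H j; have sh i := proj1 (hP i).
  have [_ ipg] := sqi_comb mD (fun j => p (a 0 j)) sh.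
  have B0 : 0 <= B by apply: le_trans (normr_ge0 _) (le_trans (H 0%N) _); rewrite expr0 mulr1.
  have key k : `|p (a 0 j)| <= B * 2^-1 ^+ (j + k * N.+1).
    set n := (j + k * N.+1)%N; have := H n; rewrite ipg//.
    have nj : (n %% N.+1 = j)%N by rewrite /n addnC modnMDl modn_small.
    rewrite (bigD1 j)//= (proj2 (hP j)) /b nj eqxx big1 ?addr0 => [|i ij]; last first.
      by rewrite (proj2 (hP i)) /b nj ifN ?mulr0// eq_sym.
    rewrite normrM (ger0_norm (ltW (q0 n))).
    have -> : (4^-1 : R) = 2^-1 * 2^-1 by field.
    by rewrite exprMn mulrA ler_pM2r.
  apply/eqP; rewrite -normr_le0; apply: (@le0_small _ _ B) => // x x0.
  have [k kP] := natSinv_small x0; apply: le_trans (key k) _; rewrite mulrC ler_wpM2r//.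
  apply: le_trans (ltW kP); rewrite exprVn lef_pV2 ?posrE ?exprn_gt0// -natrX ler_nat.
  apply: leq_trans (ltn_expl _ (ltnSn 1)) _; rewrite leq_exp2l//.
  by rewrite (leq_trans _ (leq_addl _ _))// leq_pmulr.
move/eqP: a0; apply; apply/rowP => j; rewrite [RHS]mxE.
have := comp (@complex.Re R) _ _ (fun n => (BP n).1) j.
have := comp (@complex.Im R) _ _ (fun n => (BP n).2) j.
have E1 : re (fun x => \sum_(j < N.+1) a 0 j * hc j x) = (fun x => \sum_(j < N.+1) complex.Re (a 0 j) * h j x).
  apply/funext => x; rewrite /re raddf_sum; apply: eq_bigr => i _.
  by rewrite /hc; case: (a 0 i) => p q /=; rewrite mulr0 subr0.
have E2 : im (fun x => \sum_(j < N.+1) a 0 j * hc j x) = (fun x => \sum_(j < N.+1) complex.Im (a 0 j) * h j x).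
  apply/funext => x; rewrite /im raddf_sum; apply: eq_bigr => i _.
  by rewrite /hc; case: (a 0 i) => p q /=; rewrite mulr0 add0r.
move=> /(_ E2) i0 /(_ E1) r0; apply/eqP; rewrite eq_complex.
by rewrite i0 r0 !eqxx.
Qed.

End QuasimodeObstruction.

(** * Tools for the construction of quasimodes *)

Lemma Rintegral_identity {d : measure_display} {T : measurableType d} {R : realType}
    (mu : {measure set T -> \bar R}) (f1 f2 f3 f4 f5 f6 g1 g2 : T -> R) (k : R) :
  let I g := mu.-integrable setT (EFin \o g) in
  I f1 -> I f2 -> I f3 -> I f4 -> I f5 -> I f6 -> I g1 -> I g2 ->
  (forall x, f1 x + f2 x - k * f3 x - (f4 x + f5 x - f6 x) = g1 x + g2 x) ->
  \int[mu]_x g1 x = 0 -> \int[mu]_x g2 x = 0 ->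
  \int[mu]_x f1 x + \int[mu]_x f2 x - k * \int[mu]_x f3 x
  = \int[mu]_x f4 x + \int[mu]_x f5 x - \int[mu]_x f6 x.
Proof.
move=> I i1 i2 i3 i4 i5 i6 j1 j2 E z1 z2.
have lin := @Rintegral_lin _ _ _ mu setT measurableT.
have ilin := @integrable_lin _ _ _ mu setT measurableT.
have A1 := ilin 1 1 _ _ i1 i2; have A2 := ilin 1 (- k) _ _ A1 i3.
have B1 := ilin 1 1 _ _ i4 i5; have B2 := ilin 1 (-1) _ _ B1 i6.
have H1 := lin 1 (-1) _ _ A2 B2; have H2 := lin 1 1 _ _ j1 j2.
rewrite (lin _ _ _ _ A1 i3) (lin _ _ _ _ i1 i2) (lin _ _ _ _ B1 i6) (lin _ _ _ _ i4 i5) in H1.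
rewrite z1 z2 in H2.
have H3 : \int[mu]_x (1 * (1 * (1 * f1 x + 1 * f2 x) + - k * f3 x)
    + -1 * (1 * (1 * f4 x + 1 * f5 x) + -1 * f6 x)) = \int[mu]_x (1 * g1 x + 1 * g2 x).
  by congr Rintegral; apply/funext => x; rewrite -!mulrDr -E; ring.
move: H3; rewrite H1 H2.
move: (\int[mu]_x f1 x) (\int[mu]_x f2 x) (\int[mu]_x f3 x) (\int[mu]_x f4 x) (\int[mu]_x f5 x) (\int[mu]_x f6 x).
clear => a1 a2 a3 a4 a5 a6; lra.
Qed.

Section QuasimodeTools.
Context {R : realType}.
Variable D : set (R * R).

Let MR2 := (measurableTypeR R * measurableTypeR R)%type.
Hypothesis mD : measurable (D : set MR2).

Local Notation ipD := (inner_product (@area R) (D : set MR2)).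
Local Notation sqA := (sqi (@area R) (D : set MR2)).
Implicit Types (f g w chi psi : R * R -> R).

Lemma elem_smooth_is_derive f v x : elem_smooth f -> is_derive x v f ('D_v f x).
Proof.
by move=> /elem_smooth_derive[df _]; apply/derivableP/diff_derivable.
Qed.

Lemma elem_smoothM_derive f g v x : elem_smooth f -> elem_smooth g ->
  'D_v (fun y => f y * g y) x = f x * 'D_v g x + g x * 'D_v f x.
Proof.
move=> /elem_smooth_derive[df _] /elem_smooth_derive[dg _].
exact: (deriveM (@diff_derivable _ _ _ f x v (df x)) (@diff_derivable _ _ _ g x v (dg x))).
Qed.

(** Multiplying the generalised eigenfunction [psi] by a cut-off [chi] only
    leaves first derivatives of [chi] in the weak form of the equation: the
    difference of the two sides is the integral of a divergence. *)
Lemma cutoff_eigenfunction chi psi w (lambda : R) : elem_smooth chi -> elem_smooth psi ->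
  rtest D w ->
  (forall x, 'D_e1 ('D_e1 psi) x + 'D_e2 ('D_e2 psi) x = - (lambda * psi x)) ->
  ipD ('D_e1 w) ('D_e1 (fun x => chi x * psi x)) + ipD ('D_e2 w) ('D_e2 (fun x => chi x * psi x))
    - lambda * ipD w (fun x => chi x * psi x)
  = ipD ('D_e1 w) (fun x => psi x * 'D_e1 chi x) + ipD ('D_e2 w) (fun x => psi x * 'D_e2 chi x)
    - ipD w (fun x => 'D_e1 chi x * 'D_e1 psi x + 'D_e2 chi x * 'D_e2 psi x).
Proof.
move=> sc sp tw eig.
have t1 := rtestD e1 tw; have t2 := rtestD e2 tw.
have D_ v f : elem_smooth f -> elem_smooth ('D_v f) by move=> /elem_smooth_derive[_].
have cw := rtest_cc tw; have cw1 := rtest_cc t1; have cw2 := rtest_cc t2.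
have sq : elem_smooth (fun x => chi x * psi x) by exact: es_mul.
have c_ f : elem_smooth f -> continuous f by exact: elem_smooth_continuous.
pose G i x := chi x * 'D_i psi x.
have sG i : elem_smooth (G i) by apply: es_mul => //; exact: D_.
pose F i x := w x * G i x.
have dF i x : is_derive x i (F i) (w x * 'D_i (G i) x + G i x * 'D_i w x).
  have := is_deriveM (rtest_derive i x tw) (elem_smooth_is_derive i x (sG i)); exact.
have cF i : cc (F i) by apply: cc_mul => //; exact/c_/sG.
have cdF i : cc (fun x => w x * 'D_i (G i) x + G i x * 'D_i w x).
  apply: cc_add; first by apply: cc_mul => //; exact/c_/D_/sG.
  have := cc_mul (rtest_cc (rtestD i tw)) (c_ _ (sG i)).
  by congr cc; apply/funext => x; rewrite mulrC.
have I1 := int_partial1 (dF e1) (cF e1) (cdF e1).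
have I2 := int_partial2 (dF e2) (cF e2) (cdF e2).
have s1 : elem_smooth (fun x => psi x * 'D_e1 chi x) by apply: es_mul => //; exact: D_.
have s2 : elem_smooth (fun x => psi x * 'D_e2 chi x) by apply: es_mul => //; exact: D_.
have s3 : elem_smooth (fun x => 'D_e1 chi x * 'D_e1 psi x + 'D_e2 chi x * 'D_e2 psi x).
  by apply: es_add; apply: es_mul; exact: D_.
have -> := int_test_domain ('D_e1 (fun x => chi x * psi x)) t1.
have -> := int_test_domain ('D_e2 (fun x => chi x * psi x)) t2.
have -> := int_test_domain (fun x => chi x * psi x) tw.
have -> := int_test_domain (fun x => psi x * 'D_e1 chi x) t1.
have -> := int_test_domain (fun x => psi x * 'D_e2 chi x) t2.
have -> := int_test_domain (fun x => 'D_e1 chi x * 'D_e1 psi x + 'D_e2 chi x * 'D_e2 psi x) tw.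
have i1 := cc_integrable (cc_mul cw1 (c_ _ (D_ e1 _ sq))).
have i2 := cc_integrable (cc_mul cw2 (c_ _ (D_ e2 _ sq))).
have i3 := cc_integrable (cc_mul cw (c_ _ sq)).
have i4 := cc_integrable (cc_mul cw1 (c_ _ s1)).
have i5 := cc_integrable (cc_mul cw2 (c_ _ s2)).
have i6 := cc_integrable (cc_mul cw (c_ _ s3)).
apply: (Rintegral_identity i1 i2 i3 i4 i5 i6 (cc_integrable (cdF e1)) (cc_integrable (cdF e2)) _ I1 I2).
move=> x; rewrite /G !(elem_smoothM_derive _ _ sc sp) !(elem_smoothM_derive _ _ sc (D_ _ _ sp)).
have := eig x; move: ('D_e1 ('D_e1 psi) x) ('D_e2 ('D_e2 psi) x) ('D_e1 psi x) ('D_e2 psi x) (psi x)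
  ('D_e1 chi x) ('D_e2 chi x) (chi x) ('D_e1 w x) ('D_e2 w x) (w x).
by clear => a b p1 p2 p c1 c2 c w1 w2 w0 /(canRL (addrK _)) ->; ring.
Qed.

Lemma ip_le_area f (S : set MR2) (M a : R) : measurable_fun D f -> measurable S ->
  (area S <= a%:E)%E -> 0 <= M -> (forall x, D x -> `|f x| <= M) ->
  (forall x, D x -> ~ S x -> f x = 0) -> sqA f /\ ipD f f <= M ^+ 2 * a.
Proof.
move=> mf mS aS M0 fM fS.
have H : (\int[@area R]_(x in D) (f x ^+ 2)%:E <= (M ^+ 2 * a)%:E)%E.
  apply: (@le_trans _ _ (\int[@area R]_(x in setT) ((M ^+ 2)%:E * (\1_S x)%:E))%E).
    apply: (@le_trans _ _ (\int[@area R]_(x in D) ((M ^+ 2)%:E * (\1_S x)%:E))%E).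
      apply: ge0_le_integral => //.
      - by move=> x _; rewrite lee_fin sqr_ge0.
      - by apply/measurable_EFinP; under eq_fun do rewrite expr2; exact: measurable_funM.
      - by apply/measurable_EFinP; apply: measurable_funTS; apply: measurable_funM.
      - move=> x Dx; rewrite -EFinM lee_fin indicE; have [Sx|nSx] := boolP (x \in S).
          by rewrite mulr1 -[f x ^+ 2]real_normK ?num_real// ler_sqr ?nnegrE ?fM.
        by rewrite (fS x Dx) ?expr2 ?mul0r ?mulr0//; rewrite notin_setE in nSx.
    apply: ge0_subset_integral => //.
    - by apply/measurable_EFinP; apply: measurable_funM.
    - by move=> x _; rewrite -EFinM lee_fin mulr_ge0 ?sqr_ge0.
  rewrite ge0_integralZl//; last by rewrite lee_fin sqr_ge0.
    2: by apply/measurable_EFinP; exact: measurable_indic.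
  have -> : (\int[@area R]_(x in setT) (\1_S x)%:E)%E = area S by rewrite integral_indic ?setIT.
  by rewrite [leRHS]EFinM; apply: lee_wpmul2l; rewrite ?lee_fin ?sqr_ge0.
have sf : sqA f by apply: (sqi_of_lty mD mf); apply: le_lt_trans H _; rewrite ltry.
split=> //; rewrite -lee_fin -ip_fin//; exact: H.
Qed.

Lemma ip_ge_area f (S : set MR2) (M a : R) : sqA f -> measurable S -> S `<=` D ->
  area S = a%:E -> 0 <= M -> (forall x, S x -> M <= f x ^+ 2) -> M * a <= ipD f f.
Proof.
move=> sf mS SD aS M0 fM; rewrite -lee_fin -ip_fin//.
apply: (@le_trans _ _ (\int[@area R]_(x in S) (f x * f x)%:E)%E); last first.
  apply: ge0_subset_integral => //.
    by apply/measurable_EFinP; apply: measurable_funM; case: sf.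
  by move=> x _; rewrite lee_fin -expr2 sqr_ge0.
have -> : (M * a)%:E = (\int[@area R]_(x in S) M%:E)%E.
  by rewrite integral_cst// aS.
apply: ge0_le_integral => //.
apply/measurable_EFinP; apply: (measurable_funS mD SD).
by apply: measurable_funM; case: sf.
Qed.

Definition slab (s c a b p q : R) : set MR2 :=
  [set x | a <= x.1 <= b /\ p <= - s * x.1 + c * x.2 <= q].

Lemma slab_measurable s c a b p q : measurable (slab s c a b p q).
Proof.
pose g (x : R * R) := - s * x.1 + c * x.2.
have mg := continuous_measurable2 (@continuous_linear R (- s) c : continuous g).
have -> : slab s c a b p q = (`[a, b]%classic `*` setT) `&` (setT `&` (g @^-1` `[p, q]%classic)).
  rewrite setTI; apply/seteqP; split=> x; first by move=> [h1 h2]; split => //=; rewrite ?in_itv.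
  by move=> [[h1 _] h2]; split; move: h1 h2; rewrite /= !in_itv.
apply: measurableI; first by apply: measurableX; [exact: measurable_itv|exact: measurableT].
exact: (mg measurableT _ (measurable_itv `[p, q])).
Qed.

Lemma slabP s c a b p q (x y : R) : slab s c a b p q (x, y) <->
  a <= x <= b /\ p + s * x <= y * c <= q + s * x.
Proof.
rewrite /slab /=; split=> -[h1 /andP[h2 h3]]; split=> //; apply/andP; split; lra.
Qed.

(** Vertical sections of the oblique slab are intervals of length [(q - p) / c]. *)
Lemma slab_area s c a b p q : 0 < c -> a <= b -> p <= q ->
  area (slab s c a b p q) = ((b - a) * (q - p) / c)%:E.
Proof.
move=> c0 ab pq; rewrite /area /product_measure1 /=.
rewrite -[LHS]/(\int[@lebesgue_measure R]_x (lebesgue_measure (xsection (slab s c a b p q) x)))%E.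
transitivity (\int[@lebesgue_measure R]_(x in `[a, b]%classic) (((q - p) / c)%:E))%E.
  rewrite [RHS]integral_mkcond; apply: eq_integral => x _; rewrite patchE.
  have [xab|xab] := boolP (x \in `[a, b]%classic).
    have -> : xsection (slab s c a b p q) x = `[(p + s * x) / c, (q + s * x) / c]%classic.
      apply/seteqP; split=> y; rewrite /xsection /= inE /= in_itv /= ler_pdivrMr// ler_pdivlMr//.
        by move=> /slabP[].
      by move=> h; apply/slabP; split=> //; move: xab; rewrite inE /= in_itv.
    rewrite lebesgue_bounded_itv; first by congr EFin; field; rewrite gt_eqF.
    by rewrite ler_pM2r ?invr_gt0// lerD2r.
  have -> : xsection (slab s c a b p q) x = set0; last by rewrite measure0.
  apply/seteqP; split=> // y; rewrite /xsection /= inE => /slabP[h _].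
  by apply/negP: xab; rewrite negbK inE /= in_itv.
rewrite integral_cst; last exact: measurable_itv.
transitivity (((q - p) / c)%:E * (b - a)%:E)%E.
  by congr (_ * _)%E; exact: (lebesgue_bounded_itv true false ab).
by rewrite -EFinM; congr EFin; ring.
Qed.

End QuasimodeTools.

(** * Longitudinal and transversal profiles *)

Section Separated.
Context {R : realType}.
Implicit Types (f g df dg : R -> R) (l v x : R * R).

Definition linform l x : R := l.1 * x.1 + l.2 * x.2.

(** Functions that factor along two linear coordinates. *)
Definition sep (l1 l2 : R * R) f g x : R := f (linform l1 x) * g (linform l2 x).

Lemma elem_smooth_linform l : elem_smooth (linform l).
Proof.
apply: (@es_affine _ _ _ (linform l)) => [x|v x].
  by case: (linear_form_derive l.1 l.2 0 x).
by case: (linear_form_derive l.1 l.2 v x).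
Qed.

Lemma sep_derive l1 l2 f g df dg : (forall t : R, is_derive t 1 f (df t)) ->
  (forall t : R, is_derive t 1 g (dg t)) -> forall v x,
  'D_v (sep l1 l2 f g) x = linform l2 v * sep l1 l2 f dg x + linform l1 v * sep l1 l2 df g x.
Proof.
move=> hf hg v x.
have [d1 D1] : differentiable (linform l1) x /\ 'D_v (linform l1) x = linform l1 v
  := linear_form_derive l1.1 l1.2 v x.
have [d2 D2] : differentiable (linform l2) x /\ 'D_v (linform l2) x = linform l2 v
  := linear_form_derive l2.1 l2.2 v x.
have [e1 E1] := derive_comp v (hf (linform l1 x)) d1.
have [e2 E2] := derive_comp v (hg (linform l2 x)) d2.
have H := deriveM (@diff_derivable _ _ _ _ x v e1) (@diff_derivable _ _ _ _ x v e2).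
rewrite E1 E2 D1 D2 in H; apply: (etrans H); rewrite /sep /GRing.scale /=; ring.
Qed.

End Separated.

Section Profiles.
Context {R : realType}.
Implicit Types (t y e k : R).

Lemma two_wall_split (a b p q u w : R) :
  (a * (- w * q) + p * (w * b)) * u = p * (w * b * u) - a * (w * q * u).
Proof. ring. Qed.

Lemma two_wall_bound (p q x y C : R) : `|p| <= 1 -> `|q| <= 1 ->
  `|x| <= 2 * C -> `|y| <= 2 * C -> `|p * x - q * y| <= 4 * C.
Proof.
move=> p1 q1 hx hy; apply: le_trans (ler_normB _ _) _; rewrite !normrM.
have := ler_piMl (normr_ge0 x) p1; have := ler_piMl (normr_ge0 y) q1; lra.
Qed.

Lemma sin_le_id t : 0 <= t -> sin t <= t.
Proof.
move=> t0; have [|z _] := @MVT_segment R sin cos 0 t t0.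
- by apply: continuous_subspaceT => y; exact: continuous_sin.
- by rewrite sin0 !subr0 => ->; rewrite ler_piMl// cos_le1.
Qed.

Lemma norm_step_le1 t : `|step t| <= 1.
Proof. by rewrite ger0_norm ?step_ge0 ?step_le1. Qed.

Lemma is_derive_step_affine a b t :
  is_derive t 1 (fun t => step (a * t + b)) (a * dstep (a * t + b)).
Proof.
have h : is_derive t 1 (fun t : R => a * t + b) a.
  have h1 := is_deriveZ a (@is_derive_id _ _ t 1).
  have h2 := is_deriveD h1 (is_derive_cst b t 1).
  by apply: (is_derive_eq h2); rewrite addr0 /GRing.scale /= mulr1.
have hs := is_derive_step (a * t + b).
have H : is_derive t 1 (step \o (fun t : R => a * t + b)) (dstep (a * t + b) * a).
  exact: is_derive1_comp.
by apply: (is_derive_eq H); rewrite mulrC.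
Qed.

(** Plateau function: 0 outside (1, 4), 1 on [2, 3]. *)
Definition bump y := step (1 * y + -1) * step (-1 * y + 4).
Definition dbump y := step (1 * y + -1) * (-1 * dstep (-1 * y + 4)) + step (-1 * y + 4) * (1 * dstep (1 * y + -1)).

Lemma is_derive_bump y : is_derive y 1 bump (dbump y).
Proof.
have H := is_deriveM (is_derive_step_affine 1 (-1) y) (is_derive_step_affine (-1) 4 y).
by apply: (is_derive_eq H); rewrite /dbump /GRing.scale /=.
Qed.

Lemma bump_out y : y < 1 \/ 4 < y -> bump y = 0 /\ dbump y = 0.
Proof.
rewrite /bump /dbump => -[h|h].
  rewrite (@step_eq0 _ (1 * y + -1)); last lra.
  by rewrite (@dstep_out _ (1 * y + -1)) ?mulr0 ?mul0r ?addr0//; left; lra.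
rewrite (@step_eq0 _ (-1 * y + 4)); last lra.
by rewrite (@dstep_out _ (-1 * y + 4)) ?mulr0 ?mul0r ?addr0//; left; lra.
Qed.

Lemma bump_eq1 y : 2 <= y <= 3 -> bump y = 1.
Proof. by move=> /andP[h1 h2]; rewrite /bump !step_eq1 ?mulr1//; lra. Qed.

Lemma bump_le1 y : `|bump y| <= 1.
Proof. by rewrite normrM mulr_ile1// norm_step_le1. Qed.

(** The transversal ground state [sin], truncated near the walls 0 and [pi]
    at the scale [e]. *)
Definition cut e t := step (e^-1 * t + -1) * step (- e^-1 * t + (e^-1 * pi - 1)).
Definition dcut e t := step (e^-1 * t + -1) * (- e^-1 * dstep (- e^-1 * t + (e^-1 * pi - 1)))
  + step (- e^-1 * t + (e^-1 * pi - 1)) * (e^-1 * dstep (e^-1 * t + -1)).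
Definition profile e t := cut e t * sin t.
Definition dprofile e t := cut e t * cos t + dcut e t * sin t.

Lemma is_derive_profile e t : is_derive t 1 (profile e) (dprofile e t).
Proof.
have H : is_derive t 1 (cut e) (dcut e t).
  exact: (is_deriveM (is_derive_step_affine e^-1 (-1) t) (is_derive_step_affine (- e^-1) (e^-1 * pi - 1) t)).
have H2 := is_deriveM H (is_derive_sin t).
by apply: (is_derive_eq H2); rewrite /dprofile /GRing.scale /= [sin t * _]mulrC.
Qed.

Variable e : R.
Hypothesis e0 : 0 < e.

Let e_inv t a : (e^-1 * t + a) * e = t + a * e.
Proof. by field; rewrite gt_eqF. Qed.

Let pos_l t : (0 < e^-1 * t + -1) = (e < t).
Proof. by rewrite -(pmulr_lgt0 _ e0) e_inv mulN1r subr_gt0. Qed.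

Let pos_r t : (0 < - e^-1 * t + (e^-1 * pi - 1)) = (t < pi - e).
Proof.
rewrite -(pmulr_lgt0 _ e0) (_ : _ * e = pi - e - t) ?subr_gt0//.
by field; rewrite gt_eqF.
Qed.

Let one_l t : (1 <= e^-1 * t + -1) = (2 * e <= t).
Proof. by rewrite -(ler_pM2r e0) e_inv; apply/idP/idP; lra. Qed.

Let one_r t : (1 <= - e^-1 * t + (e^-1 * pi - 1)) = (t <= pi - 2 * e).
Proof.
rewrite -(ler_pM2r e0) (_ : (_ + (_ - 1)) * e = pi - e - t).
  by apply/idP/idP; lra.
by field; rewrite gt_eqF.
Qed.

Lemma profile_out t : ~ (e <= t <= pi - e) -> profile e t = 0.
Proof.
move=> /negP; rewrite negb_and -!ltNge => /orP[h|h]; rewrite /profile /cut.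
  by rewrite (@step_eq0 _ (e^-1 * t + -1)) ?mul0r// leNgt pos_l -leNgt ltW.
by rewrite (@step_eq0 _ (- e^-1 * t + _)) ?mulr0 ?mul0r// leNgt pos_r -leNgt ltW.
Qed.

Lemma profile_in t : 2 * e <= t <= pi - 2 * e -> profile e t = sin t.
Proof.
by move=> /andP[h1 h2]; rewrite /profile /cut !step_eq1 ?mul1r// ?one_l ?one_r.
Qed.

Lemma dprofile_in t : 2 * e < t < pi - 2 * e -> dprofile e t = cos t.
Proof.
move=> /andP[h1 h2]; rewrite /dprofile /cut /dcut !step_eq1 ?one_l ?one_r ?(ltW h1) ?(ltW h2)//.
have l1 : 1 < e^-1 * t + -1 by rewrite -(ltr_pM2r e0) e_inv; lra.
have l2 : 1 < - e^-1 * t + (e^-1 * pi - 1).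
  rewrite -(ltr_pM2r e0) (_ : (_ + (_ - 1)) * e = pi - e - t); first lra.
  by field; rewrite gt_eqF.
rewrite (dstep_out (or_intror l1)) (dstep_out (or_intror l2)); ring.
Qed.

Lemma profile_dist t : `|profile e t - sin t| <= 1.
Proof.
rewrite /profile -{2}[sin t]mul1r -mulrBl normrM mulr_ile1// ?sin_max//.
have : 0 <= cut e t <= 1.
  rewrite /cut mulr_ge0 ?step_ge0//= mulr_ile1 ?step_ge0 ?step_le1//.
by move=> /andP[h1 h2]; rewrite ler_norml; apply/andP; split; lra.
Qed.

(** The factor [1 / e] in the derivative of the cut-off is compensated by the
    vanishing of [sin] at the walls, so the truncation costs a bounded amount
    of energy per unit area of a strip of width of order [e]. *)
Lemma dprofile_dist C t : (forall t, `|dstep t| <= C) -> 0 < t < pi ->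
  `|dprofile e t - cos t| <= 4 * C + 1.
Proof.
move=> dC /andP[t0 tpi]; have C0 : 0 <= C by exact: le_trans (normr_ge0 _) (dC 0).
have ei : 0 < e^-1 by rewrite invr_gt0.
have -> : dprofile e t - cos t = (cut e t - 1) * cos t + dcut e t * sin t by rewrite /dprofile; ring.
have s0 : 0 <= sin t by apply: sin_ge0_pi; rewrite !ltW.
have h1 : `|(cut e t - 1) * cos t| <= 1.
  have : 0 <= cut e t <= 1.
    rewrite /cut mulr_ge0 ?step_ge0//= mulr_ile1 ?step_ge0 ?step_le1//.
  move=> /andP[c0 c1]; rewrite normrM mulr_ile1 ?cos_max//.
  by rewrite ler_norml; apply/andP; split; lra.
have l1 : `|e^-1 * dstep (e^-1 * t + -1) * sin t| <= 2 * C.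
  have [h|h] := leP (e^-1 * t + -1) 1; last first.
    by rewrite (dstep_out (or_intror h)) mulr0 mul0r normr0 mulr_ge0.
  have te : t <= 2 * e by move: h; rewrite -(ler_pM2r e0) e_inv; lra.
  rewrite !normrM (gtr0_norm ei) (ger0_norm s0) mulrAC.
  apply: ler_pM => //; first by rewrite mulr_ge0// ltW.
  rewrite mulrC ler_pdivrMr//; exact: le_trans (sin_le_id (ltW t0)) te.
have l2 : `|e^-1 * dstep (- e^-1 * t + (e^-1 * pi - 1)) * sin t| <= 2 * C.
  have [h|h] := leP (- e^-1 * t + (e^-1 * pi - 1)) 1; last first.
    by rewrite (dstep_out (or_intror h)) mulr0 mul0r normr0 mulr_ge0.
  have te : pi - t <= 2 * e.
    move: h; rewrite -(ler_pM2r e0) (_ : (_ + (_ - 1)) * e = pi - e - t); first lra.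
    by field; rewrite gt_eqF.
  rewrite !normrM (gtr0_norm ei) (ger0_norm s0) mulrAC.
  apply: ler_pM => //; first by rewrite mulr_ge0// ltW.
  rewrite mulrC ler_pdivrMr//; apply: le_trans te.
  have -> : sin t = sin (pi - t) by rewrite sinB sinpi cospi; ring.
  by apply: sin_le_id; rewrite subr_ge0 ltW.
have h2 : `|dcut e t * sin t| <= 4 * C.
  rewrite /dcut two_wall_split.
  exact: (two_wall_bound (norm_step_le1 _) (norm_step_le1 _) l1 l2).
by apply: le_trans (ler_normD _ _) _; rewrite addrC lerD.
Qed.

End Profiles.

(** * Quasimodes in the upper arm *)

Section SmoothOuter.
Context {R : realType}.
Implicit Types (f g : R -> R) (k phi e : R).

(** Outer functions whose composites with elementary smooth functions are
    again elementary smooth. *)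
Definition smooth_outer f := forall h : R * R -> R, elem_smooth h -> elem_smooth (fun x => f (h x)).

Lemma smooth_outer_affine f (a b : R) : smooth_outer f -> smooth_outer (fun t => f (a * t + b)).
Proof.
move=> sf h sh; apply: (sf (fun x => a * h x + b)); apply: es_add; last exact: es_cst.
by apply: es_mul => //; exact: es_cst.
Qed.

Lemma smooth_outer_mul f g : smooth_outer f -> smooth_outer g -> smooth_outer (fun t => f t * g t).
Proof. by move=> sf sg h sh; apply: es_mul; [exact: sf|exact: sg]. Qed.

Lemma smooth_outer_step : smooth_outer step.
Proof. by move=> h sh; exact: elem_smooth_step. Qed.

Lemma smooth_outer_sin : smooth_outer sin. Proof. by move=> h sh; exact: es_sin. Qed.
Lemma smooth_outer_cos : smooth_outer cos. Proof. by move=> h sh; exact: es_cos. Qed.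

Lemma smooth_outer_bump : smooth_outer bump.
Proof. by apply: smooth_outer_mul; apply: smooth_outer_affine; exact: smooth_outer_step. Qed.

Lemma smooth_outer_profile e : smooth_outer (profile e).
Proof.
apply: smooth_outer_mul; last exact: smooth_outer_sin.
by apply: smooth_outer_mul; apply: smooth_outer_affine; exact: smooth_outer_step.
Qed.

Lemma smooth_outer_lin (a b : R) f g : smooth_outer f -> smooth_outer g ->
  smooth_outer (fun t => a * f t + b * g t).
Proof.
move=> sf sg h sh; apply: es_add; apply: es_mul; by [exact: es_cst|exact: sf|exact: sg].
Qed.

Lemma elem_smooth_sep (l l' : R * R) f g : smooth_outer f -> smooth_outer g -> elem_smooth (sep l l' f g).
Proof. by move=> sf sg; apply: es_mul; [apply: sf|apply: sg]; exact: elem_smooth_linform. Qed.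

Definition osc k phi y := cos (k * y - phi).
Definition dosc k phi y := - k * sin (k * y - phi).

Lemma smooth_outer_osc k phi : smooth_outer (osc k phi).
Proof. exact: smooth_outer_affine smooth_outer_cos. Qed.

Lemma smooth_outer_dosc k phi : smooth_outer (dosc k phi).
Proof.
move=> h sh; apply: es_mul; first exact: es_cst.
exact: (smooth_outer_affine k (- phi) smooth_outer_sin).
Qed.

Lemma is_derive_phase k phi (y : R) : is_derive y 1 (fun y : R => k * y - phi) k.
Proof.
have h2 := is_deriveD (is_deriveZ k (@is_derive_id _ _ y 1)) (is_derive_cst (- phi) y 1).
by apply: (is_derive_eq h2); rewrite addr0 /GRing.scale /= mulr1.
Qed.

Lemma is_derive_osc k phi (y : R) : is_derive y 1 (osc k phi) (dosc k phi y).
Proof.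
have h := is_derive_phase k phi y; have hc := is_derive_cos (k * y - phi).
have H : is_derive y 1 (cos \o (fun y : R => k * y - phi)) (- sin (k * y - phi) * k) by exact: is_derive1_comp.
by apply: (is_derive_eq H); rewrite /dosc mulNr mulrC mulNr.
Qed.

Lemma is_derive_dosc k phi (y : R) : is_derive y 1 (dosc k phi) (- (k ^+ 2) * osc k phi y).
Proof.
have h := is_derive_phase k phi y; have hc := is_derive_sin (k * y - phi).
have H : is_derive y 1 (sin \o (fun y : R => k * y - phi)) (cos (k * y - phi) * k) by exact: is_derive1_comp.
have H2 := is_deriveZ (- k) H.
by apply: (is_derive_eq H2); rewrite /GRing.scale /= /osc; ring.
Qed.

Lemma osc_le1 k phi y : `|osc k phi y| <= 1. Proof. exact: cos_max. Qed.

Lemma dosc_le k phi y : 0 <= k -> `|dosc k phi y| <= k.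
Proof.
move=> k0; rewrite normrM normrN (ger0_norm k0) -[leRHS]mulr1.
by rewrite ler_wpM2l// sin_max.
Qed.

End SmoothOuter.

Lemma defect_arith {R : realFieldType} (P A B l z1 z2 z3 z4 z5 z6 y : R) : 1 <= l ->
  z1 ^+ 2 <= P * A -> z2 ^+ 2 <= P * A -> z3 ^+ 2 <= P * A ->
  z4 ^+ 2 <= P * B -> z5 ^+ 2 <= P * B -> z6 ^+ 2 <= P * B ->
  y = (z4 + z5 - z6) + (z1 + z2 - l * z3) -> y ^+ 2 <= 18 * l ^+ 2 * (A + B) * P.
Proof.
move=> l1 h1 h2 h3 h4 h5 h6 ->.
have l2 : 1 <= l ^+ 2 by rewrite exprn_ege1.
have e1 : (z4 + z5 - z6 + (z1 + z2 - l * z3)) ^+ 2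
    <= 6 * (z1 ^+ 2 + z2 ^+ 2 + l ^+ 2 * z3 ^+ 2 + z4 ^+ 2 + z5 ^+ 2 + z6 ^+ 2).
  rewrite -exprMn; move: (l * z3) => z; clear.
  have := sqr_ge0 (z4 - z5); have := sqr_ge0 (z4 + z6); have := sqr_ge0 (z4 - z1).
  have := sqr_ge0 (z4 - z2); have := sqr_ge0 (z4 + z); have := sqr_ge0 (z5 + z6).
  have := sqr_ge0 (z5 - z1); have := sqr_ge0 (z5 - z2); have := sqr_ge0 (z5 + z).
  have := sqr_ge0 (z6 + z1); have := sqr_ge0 (z6 + z2); have := sqr_ge0 (z6 - z).
  have := sqr_ge0 (z1 - z2); have := sqr_ge0 (z1 + z); have := sqr_ge0 (z2 + z).
  lra.
apply: le_trans e1 _.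
have a0 : 0 <= P * A by exact: le_trans (sqr_ge0 _) h1.
have b0 : 0 <= P * B by exact: le_trans (sqr_ge0 _) h4.
have la : P * A <= l ^+ 2 * (P * A) by rewrite ler_peMl.
have lb : P * B <= l ^+ 2 * (P * B) by rewrite ler_peMl.
have h3' : l ^+ 2 * z3 ^+ 2 <= l ^+ 2 * (P * A) by rewrite ler_wpM2l ?sqr_ge0.
rewrite (_ : 18 * l ^+ 2 * (A + B) * P = 18 * (l ^+ 2 * (P * A)) + 18 * (l ^+ 2 * (P * B))); last by ring.
lra.
Qed.

(** Bound of a weak residual along the splitting [v = m + r] into a main part,
    whose residual is given by the commutator terms [q], and a small rest. *)
Lemma defect_bound {d : measure_display} {T : measurableType d} {R : realType}
    (mu : {measure set T -> \bar R}) (D : set T) (w0 w1 w2 v0 v1 v2 m0 m1 m2 r0 r1 r2 q1 q2 q3 : T -> R)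
    (l P A B : R) : let ip := inner_product mu D in
  measurable D -> 1 <= l ->
  [/\ sqi mu D w0, sqi mu D w1 & sqi mu D w2] -> [/\ sqi mu D v0, sqi mu D v1 & sqi mu D v2] ->
  v0 = (fun x => 1 * m0 x + 1 * r0 x) -> v1 = (fun x => 1 * m1 x + 1 * r1 x) ->
  v2 = (fun x => 1 * m2 x + 1 * r2 x) ->
  [/\ sqi mu D r0 /\ ip r0 r0 <= A, sqi mu D r1 /\ ip r1 r1 <= A & sqi mu D r2 /\ ip r2 r2 <= A] ->
  [/\ sqi mu D q1 /\ ip q1 q1 <= B, sqi mu D q2 /\ ip q2 q2 <= B & sqi mu D q3 /\ ip q3 q3 <= B] ->
  [/\ ip w0 w0 <= P, ip w1 w1 <= P & ip w2 w2 <= P] ->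
  ip w1 m1 + ip w2 m2 - l * ip w0 m0 = ip w1 q1 + ip w2 q2 - ip w0 q3 ->
  (ip w1 v1 + ip w2 v2 - l * ip w0 v0) ^+ 2 <= 18 * l ^+ 2 * (A + B) * P.
Proof.
move=> ip mD l1 [s0 s1 s2] [v0s v1s v2s] E0 E1 E2 [[r0s R0] [r1s R1] [r2s R2]] [[q1s Q1] [q2s Q2] [q3s Q3]] [p0 p1 p2] Es.
have sub (v m r : T -> R) : v = (fun x => 1 * m x + 1 * r x) -> sqi mu D v -> sqi mu D r -> sqi mu D m.
  move=> -> sv sr; have := sqi_lin mD 1 (-1) sv sr; congr sqi; apply/funext => x; ring.
have m0s := sub _ _ _ E0 v0s r0s; have m1s := sub _ _ _ E1 v1s r1s; have m2s := sub _ _ _ E2 v2s r2s.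
have bd (f g : T -> R) b : sqi mu D f -> sqi mu D g -> ip f f <= P -> ip g g <= b -> ip f g ^+ 2 <= P * b.
  by move=> sf sg fP gB; apply: le_trans (ip_CS mD sf sg) _; apply: ler_pM; rewrite ?ip_ge0.
apply: (@defect_arith R P A B l (ip w1 r1) (ip w2 r2) (ip w0 r0) (ip w1 q1) (ip w2 q2) (ip w0 q3) _ l1).
- exact: bd. - exact: bd. - exact: bd. - exact: bd. - exact: bd. - exact: bd.
- rewrite -Es E0 E1 E2 /ip !ip_linr//; ring.
Qed.

Section Quasimode.
Context {R : realType}.
Variable theta : R.
Hypothesis theta_gt0 : 0 < theta.
Hypothesis theta_lt : theta < pi / 2.
Let D := broken_guide theta.
Let MR2 := (measurableTypeR R * measurableTypeR R)%type.
Let mD : measurable (D : set MR2) := guide_measurable theta_gt0 theta_lt.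

Local Notation ipD := (inner_product (@area R) (D : set MR2)).
Local Notation sqA := (sqi (@area R) (D : set MR2)).
Local Notation c := (cos theta).
Local Notation s := (sin theta).
Let c0 : 0 < c := guide_cos_gt0 theta_gt0 theta_lt.
Let s0 : 0 < s := guide_sin_gt0 theta_gt0 theta_lt.
Implicit Types (f g w : R * R -> R) (x : R * R).

Definition arm_wave (f g : R -> R) : R * R -> R := sep (c, s) (- s, c) f g.

Local Notation tau x := (linform (- s, c) x).

(** The coordinates along and across the arm are orthonormal, so the two second
    derivatives contribute [k ^ 2] and 1. *)
Lemma arm_wave_eigenfunction (k phi : R) x :
  'D_e1 ('D_e1 (arm_wave (osc k phi) sin)) x + 'D_e2 ('D_e2 (arm_wave (osc k phi) sin)) x
  = - ((1 + k ^+ 2) * arm_wave (osc k phi) sin x).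
Proof.
have dsin (t : R) : is_derive t 1 sin (cos t) by exact: is_derive_sin.
have dcos (t : R) : is_derive t 1 cos (- sin t) by exact: is_derive_cos.
have dif (f g : R -> R) y : smooth_outer f -> smooth_outer g -> differentiable (arm_wave f g) y.
  by move=> sf sg; have [+ _] := elem_smooth_derive (elem_smooth_sep (c, s) (- s, c) sf sg); apply.
have D1 v : 'D_v (arm_wave (osc k phi) sin) = fun y => linform (- s, c) v * arm_wave (osc k phi) cos y
     + linform (c, s) v * arm_wave (dosc k phi) sin y.
  apply/funext => y; exact: (sep_derive _ _ (is_derive_osc k phi) dsin).
have D2 v : 'D_v ('D_v (arm_wave (osc k phi) sin)) x =
    linform (- s, c) v * (linform (- s, c) v * arm_wave (osc k phi) (fun t => - sin t) x
       + linform (c, s) v * arm_wave (dosc k phi) cos x)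
    + linform (c, s) v * (linform (- s, c) v * arm_wave (dosc k phi) cos x
       + linform (c, s) v * arm_wave (fun y => - (k ^+ 2) * osc k phi y) sin x).
  rewrite D1 derive_lin.
  - congr (_ * _ + _ * _); first exact: (sep_derive _ _ (is_derive_osc k phi) dcos).
    exact: (sep_derive _ _ (is_derive_dosc k phi) dsin).
  - exact: dif (smooth_outer_osc k phi) smooth_outer_cos.
  - exact: dif (smooth_outer_dosc k phi) smooth_outer_sin.
rewrite !D2 /arm_wave /sep /linform /=.
have := cos2Dsin2 theta => cs.
rewrite (_ : (1 + k ^+ 2) = (c ^+ 2 + s ^+ 2) * (1 + k ^+ 2)); last by rewrite cs mul1r.
ring.
Qed.

Variables (k C : R).
Hypothesis k_ge0 : 0 <= k.
Hypothesis dstep_le : forall t : R, `|dstep t| <= C.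
Let C_ge0 : 0 <= C. Proof. exact: le_trans (normr_ge0 _) (dstep_le 0). Qed.

Section Cutoff.
Variables (L e phi : R).
Hypothesis L_ge4 : 4 <= L.
Hypothesis L_ge : c <= L * s.
Hypothesis e_gt0 : 0 < e.
Let L0 : 0 < L. Proof. by apply: lt_le_trans L_ge4; rewrite ltr0n. Qed.

(** Localises to the part L < x_1 < 4 L of the upper arm; the factor in x_2 is
    constant there. *)
Definition arm_cutoff : R * R -> R := sep (L^-1, 0) (0, 1) bump step.

Lemma elem_smooth_arm_cutoff : elem_smooth arm_cutoff.
Proof. exact: (elem_smooth_sep _ _ smooth_outer_bump smooth_outer_step). Qed.

Lemma arm_cutoff_derive1 x : 'D_e1 arm_cutoff x = L^-1 * (dbump (linform (L^-1, 0) x) * step (linform (0, 1) x)).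
Proof.
have := sep_derive (L^-1, 0) (0, 1) is_derive_bump (@is_derive_step R) e1 x.
have -> : linform (0, 1) e1 = 0 :> R by rewrite /linform /= mul0r mulr0 addr0.
have -> : linform (L^-1, 0) e1 = L^-1 by rewrite /linform /= mulr1 mulr0 addr0.
by rewrite mul0r add0r.
Qed.

Lemma arm_cutoff_derive2 x : 'D_e2 arm_cutoff x = bump (linform (L^-1, 0) x) * dstep (linform (0, 1) x).
Proof.
have := sep_derive (L^-1, 0) (0, 1) is_derive_bump (@is_derive_step R) e2 x.
have -> : linform (0, 1) e2 = 1 :> R by rewrite /linform /= mul0r mulr1 add0r.
have -> : linform (L^-1, 0) e2 = 0 by rewrite /linform /= mulr0 mul0r addr0.
by rewrite mul1r mul0r addr0.
Qed.

Lemma dbump_le (y : R) : `|dbump y| <= 2 * C.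
Proof.
have aux (p q z w : R) : `|p| <= 1 -> `|q| <= 1 -> `|z| <= C -> `|w| <= C ->
    `|p * (-1 * z) + q * (1 * w)| <= 2 * C.
  move=> p1 q1 zC wC; apply: le_trans (ler_normD _ _) _.
  rewrite mulN1r mul1r mulrN normrN !normrM.
  have := ler_piMl (normr_ge0 z) p1; have := ler_piMl (normr_ge0 w) q1; lra.
exact: (aux _ _ _ _ (norm_step_le1 _) (norm_step_le1 _) (dstep_le _) (dstep_le _)).
Qed.

(** In the guide, the cut-off lives in the upper arm, and there it only varies in
    the first coordinate, at the slow scale [L]: the choice of [L] keeps the arms
    at a height above 1 where the vertical factor is constant. *)
Lemma arm_cutoff_guide x : D x ->
  [/\ arm_cutoff x = 0, 'D_e1 arm_cutoff x = 0 & 'D_e2 arm_cutoff x = 0] \/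
  [/\ L <= x.1 <= 4 * L, 0 < tau x < pi, `|arm_cutoff x| <= 1,
      `|'D_e1 arm_cutoff x| <= 2 * C / L & 'D_e2 arm_cutoff x = 0].
Proof.
move=> Dx; rewrite arm_cutoff_derive1 arm_cutoff_derive2 /arm_cutoff /sep.
have -> : linform (0, 1) x = x.2 by rewrite /linform /= mul0r add0r mul1r.
have -> : linform (L^-1, 0) x = x.1 / L by rewrite /linform /= mul0r addr0 mulrC.
have [t0 t1] := guide_bounds theta_gt0 theta_lt Dx.
have [h|h] := ltP x.1 L.
  have [-> ->] : bump (x.1 / L) = 0 /\ dbump (x.1 / L) = 0.
    by apply: bump_out; left; rewrite ltr_pdivrMr// mul1r.
  by left; rewrite !mul0r mulr0.
have [h4|h4] := ltP (4 * L) x.1.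
  have [-> ->] : bump (x.1 / L) = 0 /\ dbump (x.1 / L) = 0.
    by apply: bump_out; right; rewrite ltr_pdivlMr.
  by left; rewrite !mul0r mulr0.
have Ls : L * s <= x.1 * s by rewrite ler_wpM2r// ltW.
have xc : 1 * c < `|x.2| * c by rewrite mul1r; apply: le_lt_trans L_ge _; lra.
have x1 : 1 < `|x.2| by move: xc; rewrite ltr_pM2r.
have [x2|x2] := ltP x.2 0.
  left; rewrite (step_eq0 (ltW x2)) (dstep_out (or_introl x2)).
  by rewrite !mulr0.
rewrite (ger0_norm x2) in x1 t0 t1.
right; split.
- by [].
- by rewrite /linform /=; apply/andP; split; lra.
- by rewrite normrM mulr_ile1// ?bump_le1 ?norm_step_le1.
- rewrite (step_eq1 (ltW x1)) mulr1 normrM gtr0_norm ?invr_gt0// mulrC ler_pM2r ?invr_gt0//.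
  exact: dbump_le.
- by rewrite (dstep_out (or_intror x1)) mulr0.
Qed.

Definition quasimode : R * R -> R := fun x => arm_cutoff x * arm_wave (osc k phi) (profile e) x.

Lemma rtest_quasimode : rtest D quasimode.
Proof.
split.
  move=> vs x; apply: elem_smooth_all; apply: es_mul; first exact: elem_smooth_arm_cutoff.
  exact: (elem_smooth_sep _ _ (smooth_outer_osc k phi) (smooth_outer_profile e)).
pose X := (pi + 4 * L * s) / c.
exists ((`[L, 4 * L]%classic `*` `[0, X]%classic) `&` ((fun x => - s * x.1 + c * x.2) @^-1` `[e, pi - e]%classic)); split.
- apply: compact_closedI; first by apply: compact_setX; exact: segment_compact.
  apply: preimage_closed; last exact: interval_closed.
  by move=> x _; exact: continuous_linear.
- move=> x [[/= + +] +]; rewrite !in_itv /= => /andP[h1 h2] /andP[h3 h4] /andP[h5 h6].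
  have e1 := e_gt0.
  by apply/(guideP theta_gt0 theta_lt); rewrite (ger0_norm h3); apply/andP; split; lra.
- move=> x nK; apply/eqP; apply: contra_notT nK; rewrite /quasimode mulf_eq0 negb_or => /andP[].
  rewrite /arm_cutoff /arm_wave /sep mulf_eq0 negb_or => /andP[b0 st0].
  rewrite mulf_eq0 negb_or => /andP[_ p0].
  have lx : linform (L^-1, 0) x = x.1 / L by rewrite /linform /= mul0r addr0 mulrC.
  have l2 : linform (0, 1) x = x.2 by rewrite /linform /= mul0r add0r mul1r.
  rewrite lx in b0; rewrite l2 in st0.
  have x1 : L <= x.1 <= 4 * L.
    apply: contraNT b0; rewrite negb_and -!ltNge => h; apply/eqP.
    suff [] : bump (x.1 / L) = 0 /\ dbump (x.1 / L) = 0 by [].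
    by apply: bump_out; case/orP: h => h; [left; rewrite ltr_pdivrMr// mul1r|right; rewrite ltr_pdivlMr].
  have x2 : 0 <= x.2.
    by apply: contraNT st0; rewrite -ltNge => h; apply/eqP/step_eq0/ltW.
  have xt : e <= tau x <= pi - e.
    by apply: contraNT p0 => /negP h; apply/eqP; exact: profile_out.
  have /andP[h1 h2] := x1; have /andP[h3 h4] := xt; rewrite /linform /= in h3 h4.
  split; last by rewrite /= in_itv /= h3 h4.
  split; rewrite /= in_itv //= x2 /= /X ler_pdivlMr// mulrC.
  have : x.1 * s <= 4 * L * s by rewrite ler_wpM2r// ltW.
  by have := e_gt0; lra.
Qed.

Let psi := arm_wave (osc k phi) sin.
(** The error made by truncating the ground state at the walls. *)
Let rest := fun x => arm_cutoff x * arm_wave (osc k phi) (fun t => 1 * profile e t + -1 * sin t) x.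

Let sm_rest_profile : smooth_outer (fun t => 1 * profile e t + -1 * sin t).
Proof. exact: (smooth_outer_lin 1 (-1) (smooth_outer_profile e) smooth_outer_sin). Qed.

Let es_psi : elem_smooth psi.
Proof. exact: (elem_smooth_sep _ _ (smooth_outer_osc k phi) smooth_outer_sin). Qed.

Let es_rest : elem_smooth rest.
Proof.
apply: es_mul; first exact: elem_smooth_arm_cutoff.
exact: (elem_smooth_sep _ _ (smooth_outer_osc k phi) sm_rest_profile).
Qed.

Let es_main : elem_smooth (fun x => arm_cutoff x * psi x).
Proof. by apply: es_mul => //; exact: elem_smooth_arm_cutoff. Qed.

Let quasimodeE : quasimode = fun x => 1 * (arm_cutoff x * psi x) + 1 * rest x.
Proof. by apply/funext => x; rewrite /quasimode /rest /psi /arm_wave /sep; ring. Qed.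

Let quasimode_derive v : 'D_v quasimode = fun x => 1 * 'D_v (fun x => arm_cutoff x * psi x) x + 1 * 'D_v rest x.
Proof.
have [d1 _] := elem_smooth_derive es_main; have [d2 _] := elem_smooth_derive es_rest.
by rewrite quasimodeE; apply/funext => x; exact: derive_lin.
Qed.

Let linform_e (i : R * R) : i = e1 \/ i = e2 -> `|linform (c, s) i| <= 1 /\ `|linform (- s, c) i| <= 1.
Proof.
rewrite /linform /= => -[->|->] /=; rewrite ?mulr0 ?mulr1 ?addr0 ?add0r ?normrN;
  by rewrite ?cos_max ?sin_max.
Qed.

Let strip_edge : set MR2 := slab s c L (4 * L) 0 (2 * e) `|` slab s c L (4 * L) (pi - 2 * e) pi.

Let M := 6 * C + k + 2.
Let M_ge0 : 0 <= M.
Proof. by rewrite /M !addr_ge0// mulr_ge0. Qed.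

Let es_measurable (f : R * R -> R) : elem_smooth f -> measurable_fun (D : set MR2) f.
Proof. by move=> /elem_smooth_continuous cf; apply: measurable_funTS; exact: continuous_measurable2. Qed.

Let edge_area : 2 * e <= pi -> (area strip_edge <= (12 * (L * e) / c)%:E)%E.
Proof.
move=> epi; have e1 := e_gt0; have L1 := L0; apply: le_trans (measureU2 _ _ _) _; try exact: slab_measurable.
have p2 : (0 : R) <= 2 * e by lra. have l4 : L <= 4 * L by lra.
have p3 : pi - 2 * e <= pi by lra.
have eqle (x y : \bar R) : x = y -> (x <= y)%E by move=> ->.
apply: le_trans (leeD (eqle _ _ (slab_area s c0 l4 p2)) (eqle _ _ (slab_area s c0 l4 p3))) _.
rewrite -EFinD lee_fin -mulrDl ler_pM2r ?invr_gt0//; lra.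
Qed.

(** The error is bounded together with its gradient, and it lives on two strips
    of width [2 e] along the walls. *)
Lemma rest_small : 2 * e <= pi ->
  [/\ sqA rest /\ ipD rest rest <= M ^+ 2 * (12 * (L * e) / c),
      sqA ('D_e1 rest) /\ ipD ('D_e1 rest) ('D_e1 rest) <= M ^+ 2 * (12 * (L * e) / c) &
      sqA ('D_e2 rest) /\ ipD ('D_e2 rest) ('D_e2 rest) <= M ^+ 2 * (12 * (L * e) / c)].
Proof.
move=> epi.
have dg (t : R) : is_derive t 1 (fun t => 1 * profile e t + -1 * sin t) (1 * dprofile e t + -1 * cos t).
  exact: (is_deriveD (is_deriveZ 1 (is_derive_profile e t)) (is_deriveZ (-1) (is_derive_sin t))).
have restD v x : 'D_v rest x = arm_cutoff x * 'D_v (arm_wave (osc k phi) (fun t => 1 * profile e t + -1 * sin t)) x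
   + arm_wave (osc k phi) (fun t => 1 * profile e t + -1 * sin t) x * 'D_v arm_cutoff x.
  exact: (elem_smoothM_derive _ _ elem_smooth_arm_cutoff (elem_smooth_sep _ _ (smooth_outer_osc k phi) sm_rest_profile)).
have waveD v x : 'D_v (arm_wave (osc k phi) (fun t => 1 * profile e t + -1 * sin t)) x
   = linform (- s, c) v * arm_wave (osc k phi) (fun t => 1 * dprofile e t + -1 * cos t) x
   + linform (c, s) v * arm_wave (dosc k phi) (fun t => 1 * profile e t + -1 * sin t) x.
  exact: (sep_derive _ _ (is_derive_osc k phi) dg).
have L1 : 2 * C / L <= 2 * C.
  by rewrite ler_pdivrMr// ler_peMr ?mulr_ge0//; have := L_ge4; lra.
have pw x : D x -> [/\ `|rest x| <= M, forall i, i = e1 \/ i = e2 -> `|'D_i rest x| <= M &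
    ~ strip_edge x -> rest x = 0 /\ forall i, i = e1 \/ i = e2 -> 'D_i rest x = 0].
  move=> Dx.
  have [[z0 z1 z2]|[xL xt ch1 dch1 dch2]] := arm_cutoff_guide Dx.
    have Z i : i = e1 \/ i = e2 -> 'D_i rest x = 0.
      by move=> ie; rewrite restD z0 mul0r add0r; case: ie => ->; rewrite ?z1 ?z2 mulr0.
    have Z0 : rest x = 0 by rewrite /rest z0 mul0r.
    split=> [|i ie|_]; [by rewrite Z0 normr0|by rewrite Z// normr0|by split].
  set g0 := 1 * profile e (tau x) + -1 * sin (tau x).
  set g1 := 1 * dprofile e (tau x) + -1 * cos (tau x).
  have g0_le : `|g0| <= 1 by rewrite /g0 mul1r mulN1r; exact: profile_dist.
  have g1_le : `|g1| <= 4 * C + 1 by rewrite /g1 mul1r mulN1r; exact: dprofile_dist.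
  have of1 := osc_le1 k phi (linform (c, s) x).
  have of2 := dosc_le phi (linform (c, s) x) k_ge0.
  have E0 : rest x = arm_cutoff x * (osc k phi (linform (c, s) x) * g0) by [].
  have E1 i : 'D_i rest x = arm_cutoff x * (linform (- s, c) i * (osc k phi (linform (c, s) x) * g1)
      + linform (c, s) i * (dosc k phi (linform (c, s) x) * g0))
      + osc k phi (linform (c, s) x) * g0 * 'D_i arm_cutoff x.
    by rewrite restD waveD.
  have m1 (p q B : R) : `|p| <= 1 -> `|q| <= B -> `|p * q| <= B.
    by move=> p1 qB; rewrite normrM; apply: le_trans qB; rewrite ler_piMl.
  split=> [|i ie|nS].
  - rewrite E0; apply: (m1 _ _ _ ch1); apply: (m1 _ _ _ of1); apply: le_trans g0_le _.
    by rewrite /M; have := C_ge0; have := k_ge0; lra.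
  - have [a1 a2] := linform_e ie.
    have dch : `|'D_i arm_cutoff x| <= 2 * C.
      by case: ie => ->; [exact: le_trans dch1 L1|rewrite dch2 normr0 mulr_ge0].
    rewrite E1 /M (_ : 6 * C + k + 2 = (4 * C + 1 + k) + (2 * C + 1)); last by ring.
    apply: le_trans (ler_normD _ _) _; apply: lerD.
      apply: (m1 _ _ _ ch1); apply: le_trans (ler_normD _ _) _; apply: lerD.
        by apply: (m1 _ _ _ a2); exact: (m1 _ _ _ of1).
      apply: (m1 _ _ _ a1); rewrite mulrC; exact: (m1 _ _ _ g0_le).
    apply: (m1 _ _ _ (m1 _ _ _ of1 g0_le)); apply: le_trans dch _; lra.
  - have xt2 : 2 * e < tau x < pi - 2 * e.
      move/andP: xt => [t0 t1]; apply/andP; split; rewrite ltNge; apply/negP => h; apply: nS.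
        by left; split=> //; apply/andP; split; [exact: ltW|].
      by right; split=> //; apply/andP; split; [|exact: ltW].
    have Z0 : g0 = 0.
      move/andP: xt2 => [t0 t1]; rewrite /g0 profile_in ?mul1r ?mulN1r ?subrr//.
      by apply/andP; split; exact: ltW.
    have Z1 : g1 = 0 by rewrite /g1 dprofile_in// mul1r mulN1r subrr.
    split=> [|i _]; first by rewrite E0 Z0 !mulr0.
    by rewrite E1 Z0 Z1 !(mulr0, mul0r, addr0).
have [_ D_rest] := elem_smooth_derive es_rest.
have mS : measurable strip_edge by apply: measurableU; exact: slab_measurable.
have eA := edge_area epi.
split; apply: (@ip_le_area _ D mD _ strip_edge) => //; try exact: es_measurable.
- by move=> x /pw[].
- by move=> x /pw[_ _ H] /H[].
- by move=> x /pw[_ H _]; apply: H; left.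
- by move=> x /pw[_ _ H] /H[_]; apply; left.
- by move=> x /pw[_ H _]; apply: H; right.
- by move=> x /pw[_ _ H] /H[_]; apply; right.
Qed.

Let shell : set MR2 := slab s c L (4 * L) 0 pi.

Let N := 2 * C / L * (1 + k).

Let psi_le x : `|psi x| <= 1 /\ forall i, i = e1 \/ i = e2 -> `|'D_i psi x| <= 1 + k.
Proof.
have m1 (p q B : R) : `|p| <= 1 -> `|q| <= B -> `|p * q| <= B.
  by move=> p1 qB; rewrite normrM; apply: le_trans qB; rewrite ler_piMl.
have of1 := osc_le1 k phi (linform (c, s) x).
have of2 := dosc_le phi (linform (c, s) x) k_ge0.
split=> [|i ie]; first by apply: (m1 _ _ _ of1); exact: sin_max.
have [a1 a2] := linform_e ie.
have -> : 'D_i psi x = linform (- s, c) i * arm_wave (osc k phi) cos x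
   + linform (c, s) i * arm_wave (dosc k phi) sin x.
  exact: (sep_derive _ _ (is_derive_osc k phi) (@is_derive_sin R)).
apply: le_trans (ler_normD _ _) _; apply: lerD.
  by apply: (m1 _ _ _ a2); apply: (m1 _ _ _ of1); exact: cos_max.
by apply: (m1 _ _ _ a1); rewrite /arm_wave /sep mulrC; apply: m1 => //; exact: sin_max.
Qed.

Lemma commutator_small :
  [/\ sqA (fun x => psi x * 'D_e1 arm_cutoff x) /\
        ipD (fun x => psi x * 'D_e1 arm_cutoff x) (fun x => psi x * 'D_e1 arm_cutoff x) <= N ^+ 2 * (3 * L * pi / c),
      sqA (fun x => psi x * 'D_e2 arm_cutoff x) /\
        ipD (fun x => psi x * 'D_e2 arm_cutoff x) (fun x => psi x * 'D_e2 arm_cutoff x) <= N ^+ 2 * (3 * L * pi / c) &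
      sqA (fun x => 'D_e1 arm_cutoff x * 'D_e1 psi x + 'D_e2 arm_cutoff x * 'D_e2 psi x) /\
        ipD (fun x => 'D_e1 arm_cutoff x * 'D_e1 psi x + 'D_e2 arm_cutoff x * 'D_e2 psi x)
          (fun x => 'D_e1 arm_cutoff x * 'D_e1 psi x + 'D_e2 arm_cutoff x * 'D_e2 psi x) <= N ^+ 2 * (3 * L * pi / c)].
Proof.
have L1 := L0; have k1 := k_ge0; have p0 := pi_ge0 R.
have B0 : 0 <= 2 * C / L by rewrite divr_ge0 ?mulr_ge0// ltW.
have N0 : 0 <= N by apply: mulr_ge0 => //; lra.
have BN : 2 * C / L <= N by rewrite /N ler_peMr//; lra.
have pw x : D x -> [/\ `|'D_e1 arm_cutoff x| <= 2 * C / L, 'D_e2 arm_cutoff x = 0 &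
    ~ shell x -> 'D_e1 arm_cutoff x = 0].
  move=> Dx; have [[_ z1 z2]|[xL xt _ d1 d2]] := arm_cutoff_guide Dx.
    by split; [rewrite z1 normr0|exact: z2|move=> _; exact: z1].
  have xs : shell x.
    move: xt => /andP[/ltW h1 /ltW h2]; split; first exact: xL.
    by apply/andP; split; [exact: h1|exact: h2].
  by split; [exact: d1|exact: d2|case/(_ xs)].
have aU : (area shell <= (3 * L * pi / c)%:E)%E.
  have l4 : L <= 4 * L by lra.
  have -> := slab_area s c0 l4 p0; rewrite lee_fin subr0 ler_pM2r ?invr_gt0// ler_wpM2r//; lra.
have mS : measurable shell by exact: slab_measurable.
have [_ D_ch] := elem_smooth_derive elem_smooth_arm_cutoff.
have [_ D_psi] := elem_smooth_derive es_psi.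
have z x : D x -> psi x * 'D_e2 arm_cutoff x = 0 by move=> /pw[_ -> _]; rewrite mulr0.
have z' x : D x -> 'D_e1 arm_cutoff x * 'D_e1 psi x + 'D_e2 arm_cutoff x * 'D_e2 psi x
    = 'D_e1 arm_cutoff x * 'D_e1 psi x by move=> /pw[_ -> _]; rewrite mul0r addr0.
split; apply: (@ip_le_area _ D mD _ shell) => //.
- by apply: es_measurable; exact: es_mul.
- move=> x /pw[h _ _]; have [h1 _] := psi_le x; rewrite normrM.
  by apply: le_trans (le_trans h BN); rewrite ler_piMl.
- by move=> x /pw[_ _ h] /h ->; rewrite mulr0.
- by apply: es_measurable; exact: es_mul.
- by move=> x /z ->; rewrite normr0.
- by move=> x /z.
- by apply: es_measurable; apply: es_add; exact: es_mul.
- move=> x Dx; rewrite z'//; have [h _ _] := pw x Dx; have [_ h1] := psi_le x.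
  by rewrite normrM /N; apply: ler_pM => //; apply: h1; left.
- by move=> x Dx nS; rewrite z'//; have [_ _ h] := pw x Dx; rewrite h// mul0r.
Qed.

(** The weak form of [- Delta v - lambda v] is small in the dual of H^1: the
    truncation at the walls costs the area of two thin strips, the truncation
    along the arm only sees the slow variation of the cut-off. *)
Lemma quasimode_defect w : 2 * e <= pi -> rtest D w ->
  (ipD ('D_e1 w) ('D_e1 quasimode) + ipD ('D_e2 w) ('D_e2 quasimode)
    - (1 + k ^+ 2) * ipD w quasimode) ^+ 2
  <= 18 * (1 + k ^+ 2) ^+ 2 * (M ^+ 2 * (12 * (L * e) / c) + N ^+ 2 * (3 * L * pi / c))
     * ipj D (jet_of w) (jet_of w).
Proof.
move=> epi tw; have [s00 s1 s2] := sq_test mD tw.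
have i0 : ipD w w <= ipj D (jet_of w) (jet_of w) by rewrite /ipj -addrA lerDl addr_ge0// ip_ge0.
have i1 : ipD ('D_e1 w) ('D_e1 w) <= ipj D (jet_of w) (jet_of w) by rewrite /ipj addrAC lerDr addr_ge0// ip_ge0.
have i2 : ipD ('D_e2 w) ('D_e2 w) <= ipj D (jet_of w) (jet_of w) by rewrite /ipj lerDr addr_ge0// ip_ge0.
have l1 : 1 <= 1 + k ^+ 2 by rewrite lerDl sqr_ge0.
exact: (defect_bound mD l1 (And3 s00 s1 s2) (sq_test mD rtest_quasimode) quasimodeE (quasimode_derive e1)
  (quasimode_derive e2) (rest_small epi) commutator_small (And3 i0 i1 i2)
  (cutoff_eigenfunction elem_smooth_arm_cutoff es_psi tw (arm_wave_eigenfunction k phi))).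
Qed.

End Cutoff.
End Quasimode.

(** * Normalised quasimodes *)

Section WeylSequence.
Context {R : realType}.
Variable theta : R.
Hypothesis theta_gt0 : 0 < theta.
Hypothesis theta_lt : theta < pi / 2.
Let D := broken_guide theta.
Let MR2 := (measurableTypeR R * measurableTypeR R)%type.
Let mD : measurable (D : set MR2) := guide_measurable theta_gt0 theta_lt.

Local Notation ipD := (inner_product (@area R) (D : set MR2)).
Local Notation sqA := (sqi (@area R) (D : set MR2)).
Local Notation c := (cos theta).
Local Notation s := (sin theta).
Let c0 : 0 < c := guide_cos_gt0 theta_gt0 theta_lt.
Let s0 : 0 < s := guide_sin_gt0 theta_gt0 theta_lt.
Implicit Types (f g w : R * R -> R) (x : R * R).

Lemma sin_pi4_gt0 : 0 < sin (pi / 4 : R).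
Proof. by have := pi_gt0 R => p0; apply: sin_gt0_pi; apply/andP; split; lra. Qed.

(** The two phases 0 and pi/2 have total density cos^2 + sin^2 = 1 along the
    arm, so their masses cannot both be small compared with the length. *)
Lemma quasimode_mass (k L e : R) : 4 <= L -> c <= L * s -> 0 < e -> 2 * e <= pi / 4 ->
  sin (pi / 4) ^+ 2 * (L * (pi / 4) / c) <=
  ipD (quasimode theta k L e 0) (quasimode theta k L e 0)
  + ipD (quasimode theta k L e (pi / 2)) (quasimode theta k L e (pi / 2)).
Proof.
move=> L4 Ls e0 epi; have p0 := pi_gt0 R.
have L0 : 0 < L by apply: lt_le_trans L4; rewrite ltr0n.
have tq (k' phi : R) := rtest_quasimode theta_gt0 theta_lt k' phi L4 e0.
have sq (k' phi : R) : sqA (quasimode theta k' L e phi) := cc_sqi mD (rtest_cc (tq k' phi)).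
pose f := quasimode theta 0 L e 0.
have -> : ipD (quasimode theta k L e 0) (quasimode theta k L e 0)
  + ipD (quasimode theta k L e (pi / 2)) (quasimode theta k L e (pi / 2)) = ipD f f.
  rewrite !ipE -(RintegralD mD (sqiM mD (sq k 0) (sq k 0)) (sqiM mD (sq k (pi / 2)) (sq k (pi / 2)))).
  congr Rintegral; apply/funext => x; rewrite /f /quasimode /arm_wave /sep /osc.
  rewrite cosBpihalf mul0r !subr0 cos0.
  move: (cos2Dsin2 (k * linform (c, s) x)).
  move: (arm_cutoff L x) (cos (k * _)) (sin (k * _)) (profile e _) => a b d p E.
  rewrite (_ : a * (b * p) * (a * (b * p)) + a * (d * p) * (a * (d * p)) = (b ^+ 2 + d ^+ 2) * (a * p * (a * p))); last by ring.
  by rewrite E !mul1r.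
pose S := slab s c (2 * L) (3 * L) (pi / 4) (pi / 2).
have x2P x : S x -> 0 < - x.1 * s + x.2 * c < pi /\ 1 <= x.2.
  move=> [/andP[h1 h2] /andP[h3 h4]]; split; first by apply/andP; split; lra.
  have hs : 2 * L * s <= x.1 * s by rewrite ler_wpM2r// ltW.
  have : 1 * c <= x.2 * c by have := c0; lra.
  by rewrite ler_pM2r.
have aS : area S = (L * (pi / 4) / c)%:E.
  have l1 : 2 * L <= 3 * L by lra. have l2 : pi / 4 <= pi / 2 :> R by lra.
  apply: (etrans (slab_area s c0 l1 l2)); congr (_ %:E); field; rewrite gt_eqF//.
apply: (ip_ge_area mD (sq 0 0) (slab_measurable _ _ _ _ _ _) _ aS); rewrite ?sqr_ge0//.
  move=> x /x2P[h1 h2]; apply/(guideP theta_gt0 theta_lt).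
  by rewrite ger0_norm// (le_trans _ h2).
move=> x Sx; have [_ h2] := x2P x Sx; have [/andP[l1 l2] /andP[l3 l4]] := Sx.
have pt : 2 * e <= linform (- s, c) x <= pi - 2 * e.
  by rewrite /linform /=; apply/andP; split; lra.
rewrite /quasimode /arm_wave /sep /arm_cutoff /sep (profile_in e0 pt) /osc mul0r subr0 cos0 mul1r.
have -> : linform (0, 1) x = x.2 by rewrite /linform /= mul0r add0r mul1r.
have -> : linform (L^-1, 0) x = x.1 / L by rewrite /linform /= mul0r addr0 mulrC.
rewrite step_eq1// bump_eq1 ?mul1r//; last first.
  by rewrite ler_pdivlMr// ler_pdivrMr// l1 l2.
have m0 := sin_pi4_gt0.
have : sin (pi / 4) <= sin (linform (- s, c) x).
  have y3 : pi / 4 <= linform (- s, c) x := l3; have y4 : linform (- s, c) x <= pi / 2 := l4.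
  move: y3 y4; move: (linform _ x) => y; rewrite le_eqVlt => /orP[/eqP -> //|y3] y4.
  by apply/ltW; rewrite ltr_sin// in_itv /=; apply/andP; split; lra.
by move=> h; rewrite ler_sqr// nnegrE; [exact: ltW|exact: le_trans (ltW m0) h].
Qed.

Lemma rtest_scale (r : R) f : rtest D f -> rtest D (fun x => r * f x) /\
  forall v, 'D_v (fun x => r * f x) = fun x => r * 'D_v f x.
Proof.
move=> tf; have E g : (fun x => r * g x + 0 * g x) = fun x => r * g x.
  by apply/funext => x; rewrite mul0r addr0.
split; first by rewrite -E; exact: rtest_lin.
move=> v; apply/funext => x; rewrite -(E f); have [sf _] := tf.
by apply: (etrans (derive_lin r 0 v (sf [::] x) (sf [::] x))); rewrite mul0r addr0.
Qed.

(** The squared defect of the truncated wave is of order [1 / L], its mass of order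
    [L]: after normalisation the defect tends to 0 as the scale [L] grows. *)
Lemma weyl_quasimode (lambda A delta : R) : 1 <= lambda -> 0 < delta ->
  exists v, [/\ rtest D v, forall x, x.1 <= A -> v x = 0, ipD v v = 1 &
    forall w, rtest D w ->
    (energy D (jet_of w) (jet_of v) - lambda * mass D (jet_of w) (jet_of v)) ^+ 2
    <= delta * ipj D (jet_of w) (jet_of w)].
Proof.
move=> l1 d0; pose k := Num.sqrt (lambda - 1).
have k0 : 0 <= k by exact: sqrtr_ge0.
have lE : 1 + k ^+ 2 = lambda by rewrite sqr_sqrtr ?subr_ge0//; ring.
have [C C0 CP] := @dstep_bounded R.
have p0 := pi_gt0 R; have m0 := sin_pi4_gt0.
(* Of the truncated wave, [K / L] bounds the squared defect from above and
   [kap * L] the mass, for one of the two phases, from below. *)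
pose K : R := 18 * lambda ^+ 2 * ((6 * C + k + 2) ^+ 2 * (12 / c) + (2 * C * (1 + k)) ^+ 2 * (3 * pi / c)).
pose kap : R := sin (pi / 4) ^+ 2 * ((pi / 4) / c) / 2.
have kap0 : 0 < kap by rewrite /kap !(divr_gt0, mulr_gt0, exprn_gt0).
have K0 : 0 <= K.
  apply: mulr_ge0; first by apply: mulr_ge0 => //; exact: sqr_ge0.
  apply: addr_ge0; apply: mulr_ge0; rewrite ?sqr_ge0//; apply: divr_ge0 => //; try exact: ltW.
  by rewrite mulr_ge0// ltW.
have cs0 : 0 < c / s by exact: divr_gt0.
have q0 : 0 <= K / (kap * delta) by rewrite divr_ge0// ltW// mulr_gt0.
(* Beyond [A], and so long that the defect, of order 1 / L, is negligible
   compared with the mass, of order L. *)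
pose L : R := 4 + c / s + `|A| + K / (kap * delta).
have L4 : 4 <= L by rewrite /L; have := normr_ge0 A; lra.
have L0 : 0 < L by lra.
have Ls : c <= L * s by rewrite -ler_pdivrMr// /L; have := normr_ge0 A; lra.
have LA : A < L by rewrite /L; have := ler_norm A; lra.
have LK : K <= L * (kap * delta).
  have h : K / (kap * delta) <= L by rewrite /L lerDr !addr_ge0// ltW.
  by rewrite -(ler_pdivrMr _ _ (mulr_gt0 kap0 d0)).
(* The truncation at the walls then costs an area of order 1 / L. *)
pose e : R := (L ^+ 2)^-1.
have e0 : 0 < e by rewrite invr_gt0 exprn_gt0.
have e_le : e <= 1 / 8.
  rewrite /e -[leRHS]invrK lef_pV2 ?posrE ?exprn_gt0// ?invr_gt0//.
  by rewrite invf_div divr1; nra.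
have epi : 2 * e <= pi / 4 by have := pi_ge2 R; lra.
have epi2 : 2 * e <= pi by lra.
have Le : L * e = L^-1 by rewrite /e; field; rewrite gt_eqF.
have := quasimode_mass k L4 Ls e0 epi.
have -> : sin (pi / 4) ^+ 2 * (L * (pi / 4) / c) = kap * L + kap * L.
  by rewrite /kap; field; rewrite gt_eqF.
move=> mass2.
have [phi massL] : exists phi, kap * L <= ipD (quasimode theta k L e phi) (quasimode theta k L e phi).
  have [h|h] := leP (kap * L) (ipD (quasimode theta k L e 0) (quasimode theta k L e 0)); first by exists 0.
  by exists (pi / 2); lra.
clear mass2.
pose q := quasimode theta k L e phi.
have tq : rtest D q by exact: (rtest_quasimode theta_gt0 theta_lt k phi L4 e0).
have defect w : rtest D w -> (ipD ('D_e1 w) ('D_e1 q) + ipD ('D_e2 w) ('D_e2 q) - lambda * ipD w q) ^+ 2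
    <= K / L * ipj D (jet_of w) (jet_of w).
  move=> tw; have := quasimode_defect theta_gt0 theta_lt k0 CP phi L4 Ls e0 epi2 tw.
  rewrite lE Le; congr (_ <= _ * _).
  by rewrite /K; field; rewrite !gt_eqF.
clearbody K kap.
pose N := ipD q q.
have N0 : 0 < N by apply: lt_le_trans massL; exact: mulr_gt0.
pose r := (Num.sqrt N)^-1.
have rN : r ^+ 2 * N = 1.
  by rewrite /r exprVn sqr_sqrtr ?ltW// mulVf// gt_eqF.
have [tv Dv] := rtest_scale r tq.
have [sq s1 s2] := sq_test mD tq.
have scale f g : sqA f -> sqA g -> ipD f (fun x => r * g x) = r * ipD f g.
  by move=> sf sg; rewrite ipC ipZl// ipC.
exists (fun x => r * q x); split=> //.
- move=> x xA; rewrite /q /quasimode /arm_cutoff /sep.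
  have -> : linform (L^-1, 0) x = x.1 / L by rewrite /linform /= mul0r addr0 mulrC.
  have [-> _] : bump (x.1 / L) = 0 /\ dbump (x.1 / L) = 0.
    by apply: bump_out; left; rewrite ltr_pdivrMr// mul1r (le_lt_trans xA).
  by rewrite !mul0r mulr0.
- rewrite ipZl//; last exact: sqiZ.
  by rewrite (scale _ _ sq sq) mulrA -expr2.
- move=> w tw; have [w0 w1 w2] := sq_test mD tw.
  have -> : energy D (jet_of w) (jet_of (fun x => r * q x)) - lambda * mass D (jet_of w) (jet_of (fun x => r * q x))
    = r * (ipD ('D_e1 w) ('D_e1 q) + ipD ('D_e2 w) ('D_e2 q) - lambda * ipD w q).
    have E1 : ipD ('D_e1 w) ('D_e1 (fun x => r * q x)) = r * ipD ('D_e1 w) ('D_e1 q).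
      rewrite Dv; exact: (scale _ _ w1 s1).
    have E2 : ipD ('D_e2 w) ('D_e2 (fun x => r * q x)) = r * ipD ('D_e2 w) ('D_e2 q).
      rewrite Dv; exact: (scale _ _ w2 s2).
    have E0 := scale _ _ w0 sq.
    transitivity (r * ipD ('D_e1 w) ('D_e1 q) + r * ipD ('D_e2 w) ('D_e2 q) - lambda * (r * ipD w q)).
      by congr (_ + _ - _ * _); [exact: E1|exact: E2|exact: E0].
    by move: (ipD ('D_e1 w) _) (ipD ('D_e2 w) _) (ipD w q); clear => a b z; ring.
  rewrite exprMn; apply: le_trans (ler_wpM2l (sqr_ge0 r) (defect w tw)) _.
  rewrite mulrA ler_wpM2r ?ipj_ge0//.
  have r2 : r ^+ 2 <= (kap * L)^-1.
    rewrite -[r ^+ 2]mulr1 -(divff (lt0r_neq0 N0)) mulrA rN mul1r lef_pV2 ?posrE//; exact: mulr_gt0.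
  have KL : 0 <= K / L by rewrite divr_ge0// ltW.
  apply: le_trans (ler_wpM2r KL r2) _.
  rewrite -(ler_pM2r (_ : 0 < kap * L * L)); last by exact: (mulr_gt0 (mulr_gt0 kap0 L0) L0).
  rewrite (_ : (kap * L)^-1 * (K / L) * (kap * L * L) = K); last by field; rewrite !gt_eqF.
  apply: le_trans LK _.
  have : 0 <= kap * delta * L by rewrite !mulr_ge0// ltW.
  by nra.
Qed.

End WeylSequence.

(** * The essential spectrum *)

Section GuideSpectrum.
Context {R : realType}.
Variable theta : R.
Hypothesis theta_gt0 : 0 < theta.
Hypothesis theta_lt : theta < pi / 2.
Let D := broken_guide theta.
Let MR2 := (measurableTypeR R * measurableTypeR R)%type.
Let mD : measurable (D : set MR2) := guide_measurable theta_gt0 theta_lt.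

Local Notation ipD := (inner_product (@area R) (D : set MR2)).

(** The estimate says that a bounded quadratic form is nonnegative, which passes
    to limits of test jets. *)
Lemma defect_form_dom (lambda delta : R) v U : rtest D v -> 0 <= delta ->
  (forall w, rtest D w ->
    (energy D (jet_of w) (jet_of v) - lambda * mass D (jet_of w) (jet_of v)) ^+ 2
    <= delta * ipj D (jet_of w) (jet_of w)) ->
  form_dom D U ->
  (energy D U (jet_of v) - lambda * mass D U (jet_of v)) ^+ 2 <= delta * ipj D U U.
Proof.
move=> tv d0 H hU; pose l W := energy D W (jet_of v) - lambda * mass D W (jet_of v).
have sv := sqj_test mD tv.
have bl : bounded_functional (sqj D) (ipj D) l.
  have [[L1 _] [M M0 BM]] := bounded_form_lin (- lambda) (bounded_form_mass mD) (bounded_form_energy mD).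
  have lE W : l W = - lambda * mass D W (jet_of v) + energy D W (jet_of v) by rewrite /l addrC mulNr.
  split=> [a W X sW sX|]; first by rewrite !lE L1.
  exists (M * ipj D (jet_of v) (jet_of v)); first by rewrite mulr_ge0 ?ipj_ge0// ltW.
  by move=> W sW; rewrite lE mulrAC; exact: BM.
have b1 := bounded_form_lin 1 (bounded_form_mass mD) (bounded_form_energy mD).
have b2 := bounded_form_lin (-1) (bounded_form_rank1 (ipj_ge0 D) bl) (bounded_form0 (sqj D) (ipj_ge0 D)).
have bQ := bounded_form_lin delta b1 b2.
have QE W : delta * (1 * mass D W W + energy D W W) + (-1 * (l W * l W) + 0) = delta * ipj D W W - l W ^+ 2.
  by rewrite ipj_mass_energy expr2; ring.
have := closure_of_form_ge0 (sqj_lin mD) (ipj_ge0 D) (test_jet_sqj mD) bQ _ hU.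
rewrite QE subr_ge0; apply=> _ [w tw ->].
by rewrite QE subr_ge0; exact: H.
Qed.

(** Successive quasimodes are placed further out than all previous ones, which
    makes them orthogonal. *)
Lemma weyl_sequence (lambda : R) : 1 <= lambda -> exists v : nat -> R * R -> R,
  [/\ forall n, rtest D (v n), forall m n, ipD (v m) (v n) = (m == n)%:R &
    forall n w, rtest D w ->
    (energy D (jet_of w) (jet_of (v n)) - lambda * mass D (jet_of w) (jet_of (v n))) ^+ 2
    <= (4^-1 ^+ n) ^+ 2 * ipj D (jet_of w) (jet_of w)].
Proof.
move=> l1.
have /choice[F FP] (p : R * nat) : exists q : (R * R -> R) * R,
    [/\ rtest D q.1, forall x, x.1 <= p.1 \/ q.2 < x.1 -> q.1 x = 0, p.1 <= q.2, ipD q.1 q.1 = 1 &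
    forall w, rtest D w ->
    (energy D (jet_of w) (jet_of q.1) - lambda * mass D (jet_of w) (jet_of q.1)) ^+ 2
    <= (4^-1 ^+ p.2) ^+ 2 * ipj D (jet_of w) (jet_of w)].
  have d0 : 0 < ((4^-1 : R) ^+ p.2) ^+ 2 by rewrite !exprn_gt0// invr_gt0.
  have [v [tv vA nv Hv]] := weyl_quasimode theta_gt0 theta_lt p.1 l1 d0.
  have [_ [M vM]] := rtest_cc tv.
  exists (v, Num.max p.1 `|M|); split=> //=; last by rewrite le_max lexx.
  move=> x [/vA //|]; rewrite gt_max => /andP[_ h]; apply: vM; left.
  by apply: le_lt_trans (ler_norm M) _; apply: lt_le_trans h (ler_norm _).
pose A := fix A n := if n is m.+1 then (F (A m, m)).2 else 0.
pose v n := (F (A n, n)).1.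
have vP n := FP (A n, n).
have A_mono m n : (m <= n)%N -> A m <= A n.
  move=> /subnK <-; elim: (n - m)%N => // k IH; apply: le_trans IH _.
  by have [_ _ + _ _] := vP (k + m)%N.
exists v; split=> [n|m n|n w tw]; [by case: (vP n)| |by case: (vP n) => _ _ _ _; exact].
have z i j : (i < j)%N -> forall x, v i x * v j x = 0.
  move=> ij x; have [h|h] := leP x.1 (A j).
    by have [_ vz _ _ _] := vP j; rewrite [v j x]vz ?mulr0//; left.
  have [_ vz _ _ _] := vP i; rewrite [v i x]vz ?mul0r//; right.
  exact: le_lt_trans (A_mono _ _ ij) h.
have [->|ne] := eqVneq m n; first by case: (vP n).
rewrite ipE (_ : (fun x => _) = fun=> 0); first by rewrite Rintegral_cst// mul0r.
apply/funext => x; move: ne; rewrite neq_ltn => /orP[h|h]; first exact: z.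
by rewrite mulrC; exact: z.
Qed.

Theorem guide_not_Fredholm (lambda : R) : 1 <= lambda ->
  ~ Fredholm area D (op_shift (dirichlet_laplacian D) lambda%:C).
Proof.
move=> l1 [_ _]; have [v [tv ov dv]] := weyl_sequence l1.
have sv n : sqi area (D : set MR2) (v n) := cc_sqi mD (rtest_cc (tv n)).
apply: (quasimode_infinite_codim mD sv ov).
  by move=> z u f u' f'; exact: (op_shift_lin mD).
move=> u f Ouf; have [_ Lf] := op_shift_L2 mD Ouf.
have [U1 [U2 [[d1 d2 _ _] [H1 H2]]]] := (op_shiftP mD lambda 0 u Lf).1 Ouf.
pose B := Num.sqrt (ipj D U1 U1) + Num.sqrt (ipj D U2 U2).
have s1 : 0 <= Num.sqrt (ipj D U1 U1) by exact: sqrtr_ge0.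
have s2 : 0 <= Num.sqrt (ipj D U2 U2) by exact: sqrtr_ge0.
have q0 (n : nat) : 0 <= (4^-1 : R) ^+ n by rewrite exprn_ge0// invr_ge0.
have key U n : form_dom D U -> Num.sqrt (ipj D U U) <= B ->
    `|energy D U (jet_of (v n)) - lambda * mass D U (jet_of (v n))| <= B * 4^-1 ^+ n.
  move=> hU UB.
  have h := defect_form_dom (tv n) (sqr_ge0 _) (dv n) hU.
  apply: (@le_trans _ _ (Num.sqrt (ipj D U U) * 4^-1 ^+ n)); last by rewrite ler_wpM2r.
  rewrite -ler_sqr ?nnegrE ?mulr_ge0 ?sqrtr_ge0// real_normK ?num_real//.
  apply: le_trans h _; rewrite exprMn sqr_sqrtr ?ipj_ge0// [leRHS]mulrC; exact: lexx.
exists B => n; have hv := form_dom_test mD (tv n).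
have E1 : ipD (re f) (v n) = energy D U1 (jet_of (v n)) - lambda * mass D U1 (jet_of (v n)).
  by have := H1 _ hv; rewrite mul0r addr0 => ->.
have E2 : ipD (im f) (v n) = energy D U2 (jet_of (v n)) - lambda * mass D U2 (jet_of (v n)).
  by have := H2 _ hv; rewrite mul0r subr0 => ->.
split; [rewrite [X in `|X|]E1|rewrite [X in `|X|]E2]; apply: key => //.
- by rewrite /B lerDl.
- by rewrite /B lerDr.
Qed.

End GuideSpectrum.

Theorem proposition2p1 (R : realType) (theta : R)
    (theta_gt0 : 0 < theta) (theta_lt : theta < pi / 2) :
  essential_spectrum area (broken_guide theta)
    (dirichlet_laplacian (broken_guide theta))
  = [set lambda%:C | lambda in `[1, +oo[%classic].
Proof.
apply/seteqP; split=> [lambda nF|_ [lambda l1 <-]].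
  apply: contra_notP nF => nl; apply: (guide_Fredholm theta_gt0 theta_lt) => -[x x1 E].
  by apply: nl; exists x => //; rewrite /= in_itv /= x1.
apply: (guide_not_Fredholm theta_gt0 theta_lt).
by move: l1; rewrite /= in_itv /= andbT.
Qed.
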